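(* Let $w:I\to(0,\infty)$ be a decreasing weight on $I=(0,a)$, $0<a\le\infty$, with $W(t)=\int_0^t w\,dm<\infty$ for all $t\in I$. Let $b=\int_I w\,dm\in(0,\infty]$, $J=(0,b)$, and let $E$ be a fully symmetric Banach function space on $J$ with support $J$. If $E$ has the Fatou property then so has $Q_{E,w}$, and moreover $(\Lambda_{E',w})'=Q_{E,w}$ with equal norms.
   Context: $m$ is Lebesgue measure; functions are identified when equal a.e.; ''decreasing'' means non-increasing. $L^0(I)$ is the space of real Lebesgue measurable functions on $I$. For a measure $\mu$ and a $\mu$-measurable $f$ on $\Omega$, $d_f^\mu(s)=\mu\{|f|>s\}$ and $f^{*,\mu}(t)=\inf\{s>0:d_f^\mu(s)\le t\}$ for $0\le t<\mu(\Omega)$; $f^*$ is the rearrangement for $\mu=m$, and $f^{*,w}$ the rearrangement with respect to the measure $w\,dm$ on $I$, a function on $J$. For functions on the same interval ($I$ or $J$), $f\prec g$ means $\int_0^x f^*\,dm\le\int_0^x g^*\,dm$ for all $x$ in the interval. A Banach function space on an interval is a solid linear subspace $E$ of $L^0$ with full support, complete under a monotone norm ($|f|\le|g|$ a.e. implies $\|f\|_E\le\|g\|_E$). It is fully symmetric if equimeasurable functions have equal norms and $f\prec g$, $f\in L^0$, $g\in E$ imply $f\in E$ and $\|f\|_E\le\|g\|_E$. ''Support $J$'' means $\chi_A\in E$ whenever $m(A)<\infty$. A Banach function space $F$ has the Fatou property if $f_n\in F$, $f_n\uparrow f$ a.e., $\sup_n\|f_n\|_F<\infty$ imply $f\in F$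 and $\|f_n\|_F\uparrow\|f\|_F$. The Köthe dual $F'$ of $F$ (on $J$ or $I$, Lebesgue measure) is the set of measurable $f$ with $\|f\|_{F'}=\sup\{\int|fg|\,dm:\|g\|_F\le1\}<\infty$. For a fully symmetric space $F$ on $J$: $F_w=\{f\in L^0(I):f^{*,w}\in F\}$, $\|f\|_{F_w}=\|f^{*,w}\|_F$; $\Lambda_{F,w}=\{f\in L^0(I):f^*\in F_w\}$, $\|f\|_{\Lambda_{F,w}}=\|f^*\|_{F_w}$; $M_{F,w}=\{f\in L^0(I): f^*/w\in F_w\}$ with gauge $\|f\|_{M_{F,w}}=\|f^*/w\|_{F_w}$. $Q_{F,w}$ is the set of $f\in L^0(I)$ such that $f\prec g$ for some $g\in M_{F,w}$, with norm $\|f\|_{Q_{F,w}}=\inf\{\|g\|_{M_{F,w}}: f\prec g\}$. *)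

(* Defs.v *)
From mathcomp Require Import all_boot all_order all_algebra.
From mathcomp Require Import all_classical all_reals all_analysis.

Set Implicit Arguments.
Unset Strict Implicit.
Unset Printing Implicit Defensive.
Import Order.TTheory GRing.Theory Num.Theory.
Import numFieldNormedType.Exports.
Local Open Scope classical_set_scope.
Local Open Scope ring_scope.
Local Open Scope ereal_scope.

(* Functions on the interval (0, c) are represented by total functions R -> R,
   whose values outside (0, c) are never used.  Functions equal a.e. are
   identified in the theory, and every Lebesgue measurable function is a.e.
   equal to a Borel one; L0 is accordingly given by Borel representatives,
   which is what measurable_fun means for the Borel sigma-algebra carried by R
   and its lebesgue_measure. *)

Section measurable_functions.
Context {R : realType}.
Local Notation m := (@lebesgue_measure R).

Definition oint (c : \bar R) : set R := [set x | (0 < x)%R /\ x%:E < c].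

Definition L0 (c : \bar R) : set (R -> R) := [set f | measurable_fun (oint c) f].

(* The set function A |-> \int_A w dm, i.e. the measure "w dm". *)
Definition weighted (w : R -> R) (A : set R) : \bar R :=
  \int[m]_(x in A) (w x)%:E.

Definition dist (mu : set R -> \bar R) (c : \bar R) (f : R -> R) (s : R) :
    \bar R :=
  mu (oint c `&` [set x | (s < `|f x|)%R]).

(* The infimum over the empty set is +oo, so rearrangements are a priori
   extended-valued. *)
Definition rearr (mu : set R -> \bar R) (c : \bar R) (f : R -> R) (t : R) :
    \bar R :=
  ereal_inf [set s%:E | s in [set s : R | (0 < s)%R /\ dist mu c f s <= t%:E]].

(* The Hardy-Littlewood-Polya relation f \prec g on (0, c). *)
Definition submaj (c : \bar R) (f g : R -> R) : Prop :=
  forall x : R, oint c x ->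
    \int[m]_(t in oint x%:E) rearr m c f t <=
    \int[m]_(t in oint x%:E) rearr m c g t.

Definition equimeasurable (c : \bar R) (f g : R -> R) : Prop :=
  forall s : R, dist m c f s = dist m c g s.

End measurable_functions.

(* A set of functions with a gauge; values of the gauge outside the set are
   irrelevant. *)
Record fspace (R : realType) := FSpace {
  carrier : set (R -> R);
  fnorm : (R -> R) -> R }.

Section function_spaces.
Context {R : realType}.
Local Notation m := (@lebesgue_measure R).
Implicit Types (c : \bar R) (F : fspace R) (w : R -> R).

Record banach_function_space c F : Prop := {
  bfs_L0 : carrier F `<=` L0 c ;
  bfs_0 : carrier F (fun=> 0%R) ;
  bfs_D : forall f g, carrier F f -> carrier F g ->
    carrier F (fun x => f x + g x)%R ;
  bfs_Z : forall (k : R) f, carrier F f -> carrier F (fun x => k * f x)%R ;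
  bfs_solid : forall f g, L0 c f -> carrier F g ->
    {ae m, forall x, oint c x -> (`|f x| <= `|g x|)%R} -> carrier F f ;
  bfs_full_support : forall A : set R, measurable A -> A `<=` oint c ->
    (forall f, carrier F f -> {ae m, forall x, A x -> f x = 0%R}) -> m A = 0 ;
  bfs_norm_ge0 : forall f, carrier F f -> (0 <= fnorm F f)%R ;
  bfs_norm_eq0 : forall f, carrier F f -> fnorm F f = 0%R ->
    {ae m, forall x, oint c x -> f x = 0%R} ;
  bfs_normD : forall f g, carrier F f -> carrier F g ->
    (fnorm F (fun x => f x + g x) <= fnorm F f + fnorm F g)%R ;
  bfs_normZ : forall (k : R) f, carrier F f ->
    fnorm F (fun x => k * f x)%R = (`|k| * fnorm F f)%R ;
  bfs_norm_mono : forall f g, carrier F f -> carrier F g ->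
    {ae m, forall x, oint c x -> (`|f x| <= `|g x|)%R} ->
    (fnorm F f <= fnorm F g)%R ;
  bfs_complete : forall f_ : nat -> R -> R, (forall n, carrier F (f_ n)) ->
    (forall e : R, (0 < e)%R -> exists N : nat, forall p q : nat,
      (N <= p)%N -> (N <= q)%N ->
      (fnorm F (fun x => f_ p x - f_ q x) < e)%R) ->
    exists2 f, carrier F f &
      fnorm F (fun x => f_ n x - f x)%R @[n --> \oo] --> (0%R : R) }.

Record fully_symmetric c F : Prop := {
  fs_bfs : banach_function_space c F ;
  fs_equi : forall f g, carrier F f -> carrier F g -> equimeasurable c f g ->
    fnorm F f = fnorm F g ;
  fs_submaj : forall f g, L0 c f -> carrier F g -> submaj c f g ->
    carrier F f /\ (fnorm F f <= fnorm F g)%R }.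

Definition has_support c F : Prop :=
  forall A : set R, measurable A -> A `<=` oint c -> m A < +oo ->
    carrier F \1_A.

(* The sequence has to be nonnegative: for f_n = - chi_A / n, which increases to
   0, the norms decrease. *)
Definition fatou_property c F : Prop :=
  banach_function_space c F /\
  forall (f_ : nat -> R -> R) (f : R -> R),
    (forall n, carrier F (f_ n)) -> L0 c f ->
    {ae m, forall x, oint c x ->
      [/\ (forall n, 0 <= f_ n x)%R,
          nondecreasing_seq (fun n => f_ n x) &
          f_ n x @[n --> \oo] --> f x]} ->
    (exists C : R, forall n, (fnorm F (f_ n) <= C)%R) ->
    [/\ carrier F f,
        nondecreasing_seq (fun n => fnorm F (f_ n)) &
        fnorm F (f_ n) @[n --> \oo] --> fnorm F f].

Definition kothe_gauge c F (f : R -> R) : \bar R :=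
  ereal_sup [set \int[m]_(x in oint c) `|f x * g x|%:E | g in
    [set g | carrier F g /\ (fnorm F g <= 1)%R]].

Definition kothe_dual c F : fspace R :=
  FSpace [set f | L0 c f /\ kothe_gauge c F f < +oo]
         (fun f => fine (kothe_gauge c F f)).

(* Membership of an extended-valued function on (0, c) in a space of (classes
   of) real functions: it is finite a.e. and its real part is in the space. *)
Definition emem c F (h : R -> \bar R) : Prop :=
  {ae m, forall x, oint c x -> h x \is a fin_num} /\ carrier F (fine \o h).

(* In what follows the functions live on (0, a) and F is a space on (0, b),
   b being the integral of w over (0, a). *)

Definition sp_w (a b : \bar R) w F : fspace R :=
  FSpace [set f | L0 a f /\ emem b F (rearr (weighted w) a f)]
         (fun f => fnorm F (fine \o rearr (weighted w) a f)).

Definition Lambda (a b : \bar R) w F : fspace R :=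
  FSpace [set f | L0 a f /\ emem a (sp_w a b w F) (rearr m a f)]
         (fun f => fnorm (sp_w a b w F) (fine \o rearr m a f)).

Definition Mspace (a b : \bar R) w F : fspace R :=
  FSpace [set f | L0 a f /\
            emem a (sp_w a b w F) (fun t => rearr m a f t * ((w t)^-1)%:E)]
         (fun f => fnorm (sp_w a b w F)
            (fine \o (fun t => rearr m a f t * ((w t)^-1)%:E))).

Definition Qspace (a b : \bar R) w F : fspace R :=
  FSpace [set f | L0 a f /\
            exists2 g, carrier (Mspace a b w F) g & submaj a f g]
         (fun f => inf [set fnorm (Mspace a b w F) g | g in
            [set g | carrier (Mspace a b w F) g /\ submaj a f g]]).

End function_spaces.

(* Main.v *)
(* That Q_{E,w} lies in the dual is Hardy-Littlewood for m on the superlevel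
   sets of h, the definition of submajorization, Hardy-Littlewood for w dm on
   initial intervals, and Hoelder for the pair E, E'.

   For the converse let f have dual gauge at most K, let F be the primitive of
   f^* (first for dyadic truncations of f) and W that of w.  If tau(c) is the
   largest maximum point of F - c W, then tau decreases in c, so the intervals
   (0, tau(c)) are the superlevel sets of a decreasing function k.  The primitive
   of w k is at least F, hence f is submajorized by w k, and it equals F at the
   points tau(c).  The gauge of w k in M_{E,w} is the norm in E of the decreasing
   function phi with superlevel sets (0, W(tau(c))).  As E is fully symmetric,
   finite-dimensional Hahn-Banach norms phi by a decreasing step function eta in
   the unit ball of E', and the integral of phi eta only involves the values of F
   at the points tau(c).  It is thus at most the integral of |f h|, where h is
   equimeasurable with eta o W and arranged along the level sets of f; this is at
   most K.  The Fatou property of E passes to the limit over the truncations.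

   Koethe duals of spaces containing the indicators of initial intervals are
   Banach function spaces with the Fatou property, so Q_{E,w} inherits it. *)
Require Import Defs.
From mathcomp Require Import all_boot all_order all_algebra.
From mathcomp Require Import all_classical all_reals all_analysis.
From mathcomp Require Import measurable_realfun zify ring lra.
Import Order.TTheory GRing.Theory Num.Theory.
Import numFieldNormedType.Exports.
Local Open Scope classical_set_scope.
Local Open Scope ring_scope.
Local Open Scope ereal_scope.

Set Implicit Arguments.
Unset Strict Implicit.
Unset Printing Implicit Defensive.

(** * Dyadic sums and superlevel sets *)

(** The function w k is Halperin's level function in disguise: up to the discretization its
    primitive is the least majorant of F that is concave as a function of W. Going through the
    maximum points tau(c), that is through a Legendre transform, gives the superlevel sets of [k]
    directly and makes monotonicity in the truncation a comparison of maximum points.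

    The truncations remove two obstacles. F may be infinite and F - c W need not attain its maximum;
    and the interval (0, tau(c)) has to be matched by a set of measure tau(c) over which |f| has
    integral at least F(tau(c)). With finitely many levels inside a bounded interval F is piecewise
    affine, its break points are measures of superlevel sets of |f|, and concavity of W places the
    maximum points at 0 or at break points. So every interval that occurs has the length of a level
    set of [f], and no level set has to be cut.

    The price is an error 2^-n W(x) in the submajorization, which vanishes in the limit. *)

Definition dyadic (R : realType) (N n : nat) (q : R -> R) : R :=
  (2 ^- n * \sum_(j < N * 2 ^ n) q (j.+1%:R * 2 ^- n))%R.

(** The nodes are the right ends of the cells, so for a decreasing function this is a lower sum.
    Halving a cell keeps its node and adds one to the left, where [q'] is at least as large. The
    function may change with the mesh because the truncations of [f] will. *)
Lemma dyadic_le (R : realType) (N N' n : nat) (q q' : R -> R) : (N <= N')%N ->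
  (forall s, 0 <= q' s)%R -> (forall s, 0 < s -> q s <= q' s)%R ->
  (forall s t, 0 < s -> s <= t -> q' t <= q' s)%R ->
  (dyadic N n q <= dyadic N' n.+1 q')%R.
Proof.
move=> NN q'0 qq' q'd; rewrite /dyadic exprS invfM -mulrA mulrCA.
rewrite ler_pM2l ?invr_gt0 ?exprn_gt0//.
have -> : (N' * 2 ^ n.+1 = (N' * 2 ^ n) * 2)%N by rewrite expnS; lia.
have H (M : nat) (F : nat -> R) :
    (\sum_(i < M * 2) F i = \sum_(j < M) (F (2 * j)%N + F (2 * j).+1))%R.
  elim: M => [|M IH]; first by rewrite mul0n !big_ord0.
  rewrite [RHS]big_ord_recr/= -IH mulSn add2n 2!big_ord_recr/= mulnC addrA.
  by [].
rewrite (H _ (fun i => q' (i.+1%:R * (2^-1 * 2^-n))%R)).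
rewrite mulr_sumr.
apply: (@le_trans _ _ (\sum_(j < N * 2 ^ n) q' (j.+1%:R * 2 ^- n))%R).
  by apply: ler_sum => j _; apply: qq'; rewrite mulr_gt0 ?invr_gt0 ?exprn_gt0.
have le1 : (N * 2 ^ n <= N' * 2 ^ n)%N by rewrite leq_mul2r NN orbT.
apply: (@le_trans _ _ (\sum_(j < N' * 2 ^ n) q' (j.+1%:R * 2 ^- n))%R).
  rewrite [leRHS](bigID (fun j : 'I__ => (j < N * 2 ^ n)%N))/=.
  rewrite (big_ord_widen _ (fun j => q' (j.+1%:R * 2 ^- n)%R) le1) lerDl.
  exact: sumr_ge0.
apply: ler_sum => j _.
have -> : ((2 * j).+2%:R * (2^-1 * 2 ^- n) = j.+1%:R * 2 ^- n :> R)%R.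
  have -> : (2 * j).+2 = (2 * j.+1)%N by lia.
  by rewrite natrM mulrA; congr *%R; rewrite mulrAC divff// mul1r.
have : (q' (j.+1%:R * 2 ^- n) <= q' ((2 * j).+1%:R * (2^-1 * 2 ^- n)))%R.
  apply: q'd; first by rewrite !mulr_gt0 ?invr_gt0 ?exprn_gt0.
  rewrite mulrA ler_pM2r ?invr_gt0 ?exprn_gt0//.
  rewrite ler_pdivrMr// -natrM ler_nat; lia.
lra.
Qed.

Lemma dyadic_nat_le (R : realType) (N n : nat) (P : R -> bool) (s : R) :
  (0 <= s)%R -> (forall t, s < t -> P t = false)%R ->
  (dyadic N n (fun t => (P t)%:R) <= s)%R.
Proof.
move=> s0 Ps; rewrite /dyadic mulrC ler_pdivrMr ?exprn_gt0//.
have s20 : (0 <= s * 2 ^+ n)%R by rewrite mulr_ge0// exprn_ge0.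
apply: (@le_trans _ _ (Num.truncn (s * 2 ^+ n))%:R); last by rewrite truncn_le.
set M := Num.truncn _.
apply: (@le_trans _ _ (\sum_(j < N * 2 ^ n | (j < M)%N) 1)%R).
  rewrite [leRHS]big_mkcond/=; apply: ler_sum => j _.
  case: ifPn => jM; first by rewrite lern1 leq_b1.
  rewrite Ps// ltr_pdivlMr ?exprn_gt0//.
  rewrite (lt_le_trans (truncnS_gt _))// ler_nat ltnS -/M; lia.
rewrite big_mkcond/=.
have : forall K, (\sum_(j < K) (if (j < M)%N then 1 else 0) <= M%:R :> R)%R.
  move=> K; have -> : (\sum_(j < K) (if (j < M)%N then 1 else 0) = (minn K M)%:R :> R)%R.
    elim: K => [|K IH]; first by rewrite big_ord0 min0n.
    rewrite big_ord_recr/= IH; case: ifPn => KM.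
      by rewrite natr1; congr (_%:R)%R; lia.
    by rewrite addr0; congr (_%:R)%R; lia.
  by rewrite ler_nat geq_minr.
exact.
Qed.

(** The loss is at most one cell; [s <= N] ensures that the grid reaches [s]. *)
Lemma dyadic_nat_ge (R : realType) (N n : nat) (P : R -> bool) (s : R) :
  (0 <= s)%R -> (s <= N%:R)%R -> (forall t, 0 < t -> t <= s -> P t)%R ->
  (s - 2 ^- n <= dyadic N n (fun t => (P t)%:R))%R.
Proof.
move=> s0 sN Ps; rewrite /dyadic.
have s20 : (0 <= s * 2 ^+ n)%R by rewrite mulr_ge0// exprn_ge0.
set M := Num.truncn (s * 2 ^+ n).
have MN : (M <= N * 2 ^ n)%N.
  rewrite -(ler_nat R) (le_trans (_ : _ <= s * 2 ^+ n)%R) ?truncn_le//.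
  by rewrite natrM natrX ler_pM2r// exprn_gt0.
rewrite -(ler_pM2l (_ : 0 < 2 ^+ n)%R) ?exprn_gt0// mulrA mulfV; last first.
  by rewrite gt_eqF// exprn_gt0.
rewrite mul1r mulrBr mulfV; last by rewrite gt_eqF// exprn_gt0.
apply: (@le_trans _ _ (M%:R)).
  by rewrite lerBlDr natr1 mulrC ltW// truncnS_gt.
have -> : (M%:R = \sum_(j < M) 1 :> R)%R by rewrite sumr_const card_ord.
rewrite (big_ord_widen _ (fun=> 1%R) MN) big_mkcond/=.
apply: ler_sum => j _; case: ifPn => // jM.
rewrite Ps// ?mulr_gt0 ?invr_gt0 ?exprn_gt0//.
rewrite ler_pdivrMr ?exprn_gt0//.
rewrite (le_trans (_ : _ <= M%:R)%R) ?ler_nat// truncn_le//.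
Qed.

Lemma dyadic_ge0 (R : realType) (N n : nat) (q : R -> R) :
  (forall s, 0 <= q s)%R -> (0 <= dyadic N n q)%R.
Proof.
by move=> q0; rewrite mulr_ge0 ?invr_ge0 ?exprn_ge0// sumr_ge0.
Qed.

Lemma lee_of_real_lt (R : realType) (x y : \bar R) :
  (forall r : R, r%:E < x -> r%:E <= y) -> x <= y.
Proof.
move=> xy; rewrite leNgt; apply/negP => yx.
case: y x xy yx => [t||] [s||] //= xy.
- rewrite lte_fin => ts.
  by have := xy ((t + s) / 2)%R; rewrite lte_fin lee_fin midf_lt// => /(_ isT); lra.
- by move=> _; have := xy (t + 1)%R; rewrite ltry lee_fin => /(_ isT); lra.
- by move=> _; have := xy (s - 1)%R; rewrite lte_fin ltrBlDr ltrDl ltr01 => /(_ isT).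
- by move=> _; have := xy 0%R; rewrite ltry => /(_ isT).
Qed.

Lemma ereal_cvg_of_approx (R : realType) (u : nat -> R) (l : \bar R) :
  (forall n, u n <= u n.+1)%R -> (forall n, (u n)%:E <= l) ->
  (forall r : R, r%:E < l -> exists n, (r <= u n)%R) ->
  (u n)%:E @[n --> \oo] --> l.
Proof.
move=> nd ul lu; suff <- : ereal_sup (range (fun n => (u n)%:E)) = l.
  apply: ereal_nondecreasing_cvgn; apply/nondecreasing_seqP => n.
  by rewrite lee_fin.
apply/eqP; rewrite eq_le; apply/andP; split.
  by apply: ge_ereal_sup => _ [n _ <-].
apply: lee_of_real_lt => r /lu[n rn].
by apply: (@le_trans _ _ (u n)%:E) => //; apply: ereal_sup_ubound; exists n.
Qed.

(** * Intervals (0, c) with an extended real endpoint *)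

Section oint_theory.
Variable R : realType.
Local Notation m := (@lebesgue_measure R).
Implicit Types (c d : \bar R) (x y : R).

Lemma oint_EFin x : oint x%:E = `]0%R, x[%classic.
Proof.
apply/seteqP; split => y.
  by move=> [y0]; rewrite lte_fin /= in_itv/= => yx; rewrite y0.
by rewrite /= in_itv/= => /andP[y0 yx]; split => //; rewrite lte_fin.
Qed.

Lemma ointy : oint +oo = `]0%R, +oo[%classic :> set R.
Proof.
apply/seteqP; split => y; first by move=> [y0 _] /=; rewrite in_itv/= y0.
by rewrite /= in_itv/= andbT => y0; split => //; rewrite ltry.
Qed.

Lemma ointNy : oint -oo = set0 :> set R.
Proof. by apply/seteqP; split => y //= []. Qed.

Lemma oint_measurable c : measurable (oint c : set R).
Proof.
case: c => [x||]; [rewrite oint_EFin|rewrite ointy|rewrite ointNy].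
- exact: measurable_itv.
- exact: measurable_itv.
- exact: measurable0.
Qed.
Hint Resolve oint_measurable : core.

Lemma lebesgue_oint c : 0 <= c -> m (oint c) = c.
Proof.
case: c => [x||//] c0.
- rewrite oint_EFin lebesgue_measure_itv/=.
  rewrite lte_fin; case: ltP => [_|x0]; first by rewrite -EFinD subr0.
  by move: c0; rewrite lee_fin => c0; have -> : x = 0%R by apply/eqP; rewrite eq_le c0 x0.
- by rewrite ointy lebesgue_measure_itv/= ltry.
Qed.

Lemma oint_sub c d : c <= d -> (oint c : set R) `<=` oint d.
Proof. by move=> cd x [x0 xc]; split => //; exact: lt_le_trans cd. Qed.

Lemma ointI c d : oint c `&` oint d = oint (Order.min c d) :> set R.
Proof.
apply/seteqP; split => x.
  by move=> [[x0 xc] [_ xd]]; split => //; rewrite lt_min xc.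
by move=> [x0]; rewrite lt_min => /andP[xc xd].
Qed.

Lemma ointIl c d : c <= d -> oint d `&` oint c = oint c :> set R.
Proof. by move=> cd; rewrite ointI min_r. Qed.

(* An exhaustion of (0, c) that also makes sense for c = +oo. *)
Definition oexh c (n : nat) : R :=
  if c is r%:E then (r - r / n.+2%:R)%R else n.+1%:R.

Lemma oexh_oint c n : 0 < c -> oint c (oexh c n).
Proof.
case: c => [r||//] /=; rewrite ?lte_fin => c0.
- split; rewrite /oexh ?lte_fin.
    rewrite subr_gt0 ltr_pdivrMr// ltr_pMr// ltr1n//.
  by rewrite ltrBlDr ltrDl divr_gt0.
- by split => //=; rewrite ltry.
Qed.

Lemma oexh_nd c n p : 0 < c -> (n <= p)%N -> (oexh c n <= oexh c p)%R.
Proof.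
case: c => [r||//] /=; rewrite ?lte_fin => c0 np; rewrite /oexh.
- rewrite lerD2l lerN2 ler_pM2l// lef_pV2 ?posrE// ler_nat; lia.
- by rewrite ler_nat.
Qed.

Lemma oexh_lt c x : oint c x -> exists n, (x < oexh c n)%R.
Proof.
case: c => [r||] [x0] //; rewrite ?lte_fin => xc.
- have rx : (0 < r - x)%R by rewrite subr_gt0.
  have r0 : (0 < r)%R by exact: lt_trans xc.
  exists (Num.truncn (r / (r - x)))%R; rewrite /oexh.
  rewrite ltrBrDl -ltrBrDr ltr_pdivrMr//.
  rewrite mulrC -ltr_pdivrMr//.
  rewrite (lt_trans (truncnS_gt _))// ltr_nat.
  by [].
- exists (Num.truncn x) => /=; exact: truncnS_gt.
Qed.

Lemma bigcup_oexh c : 0 < c -> \bigcup_n oint (oexh c n)%:E = oint c.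
Proof.
move=> c0; apply/seteqP; split => x.
  move=> [n _]; apply: oint_sub; exact/ltW/(oexh_oint n c0).2.
by move=> cx; have [n xn] := oexh_lt cx; exists n => //; split => //; case: cx.
Qed.

Lemma ge0_integral_sub (A B : set R) (f : R -> \bar R) :
  measurable A -> measurable B -> measurable_fun B f -> A `<=` B ->
  (forall x, B x -> 0 <= f x) ->
  \int[m]_(x in A) f x <= \int[m]_(x in B) f x.
Proof. by move=> mA mB mf AB f0; exact: ge0_subset_integral. Qed.

End oint_theory.

#[global] Hint Extern 0 (measurable (oint _)) => solve [exact: oint_measurable] : core.

(** * Layer-cake approximation of extended-valued functions *)

Section layers.
Variable R : realType.
Local Notation m := (@lebesgue_measure R).

(** A layer-cake sum cut off at height [n]: real even where [h] is infinite, increasing to [h x]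
    when this is nonnegative, and with integrals that involve only the superlevel sets of [h]. *)
Definition layer (h : R -> \bar R) (n : nat) (x : R) : R :=
  dyadic n n (fun s : R => (s%:E < h x)%E%:R).

Lemma layer_nd h x n : (layer h n x <= layer h n.+1 x)%R.
Proof.
apply: dyadic_le => // s t s0 st; rewrite ler_nat.
case: (ltP t%:E) => // th; first by rewrite (le_lt_trans _ th)// lee_fin.
Qed.

Lemma layer_ge0 h x n : (0 <= layer h n x)%R.
Proof. by apply: dyadic_ge0. Qed.

Lemma layer_le h x n : 0 <= h x -> (layer h n x)%:E <= h x.
Proof.
case hx: (h x) => [r||//] r0; last by rewrite leey.
rewrite lee_fin; apply: dyadic_nat_le => // t rt; rewrite hx lte_fin.
by apply/negbTE; rewrite -leNgt ltW.
Qed.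

Lemma expr2V_small (e : R) : (0 < e)%R ->
  exists n0, forall n, (n0 <= n)%N -> (2 ^- n < e)%R.
Proof.
move=> e0; exists (Num.truncn e^-1)%R => n n0n.
rewrite -[ltRHS]invrK ltf_pV2 ?posrE ?exprn_gt0// ?invr_gt0//.
apply: (lt_le_trans (truncnS_gt _)).
rewrite -natrX ler_nat; apply: (leq_ltn_trans n0n).
exact: ltn_expl.
Qed.

Lemma layer_approx h x (r : R) : r%:E < h x -> exists n, (r <= layer h n x)%R.
Proof.
move=> rh.
have [r0|r0] := leP r 0%R; first by exists 0%N; exact: le_trans (layer_ge0 _ _ _).
(* A level strictly between [r] and [h x] leaves room [s - r] for the mesh error. *)
have [s [rs sh]] : exists s, (r < s)%R /\ s%:E < h x.
  case: (h x) rh => [t||//]; rewrite ?lte_fin => rh.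
    by exists ((r + t) / 2)%R; rewrite lte_fin midf_lt//; split => //; rewrite midf_lt.
  by exists (r + 1)%R; rewrite ltrDl ltry.
have [n0 n0P] := @expr2V_small (s - r)%R ltac:(by rewrite subr_gt0).
have [n [n0n sn]] : exists n, (n0 <= n)%N /\ (s <= n%:R)%R.
  exists (maxn n0 (Num.truncn s).+1); split; first exact: leq_maxl.
  by rewrite (le_trans (ltW (truncnS_gt _)))// ler_nat leq_maxr.
exists n; rewrite /layer.
have H := @dyadic_nat_ge R n n (fun t => t%:E < h x) s (ltW (lt_trans r0 rs)) sn.
apply: le_trans (H _); first by have := n0P _ n0n; lra.
by move=> t t0 ts; rewrite (le_lt_trans _ sh)// lee_fin.
Qed.

Lemma layer_cvg h x : 0 <= h x -> (layer h n x)%:E @[n --> \oo] --> h x.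
Proof.
move=> h0; apply: ereal_cvg_of_approx => [n|n|r]; first exact: layer_nd.
  exact: layer_le.
exact: layer_approx.
Qed.

Lemma measurable_superlevel (D : set R) (h : R -> \bar R) (s : \bar R) :
  measurable D -> measurable_fun D h -> measurable (D `&` [set x | s < h x]).
Proof. by move=> mD mh; exact: emeasurable_fun_o_infty. Qed.

Lemma measurable_indicI (D B : set R) :
  measurable D -> measurable (D `&` B) -> measurable_fun D (\1_B : R -> R).
Proof.
move=> mD mB; apply: (eq_measurable_fun (\1_(D `&` B) : R -> R)).
  move=> x; rewrite inE => Dx; rewrite !indicE; congr ((_ : bool)%:R)%R.
  by apply/idP/idP; rewrite !inE => //; case.
exact: measurable_indic.
Qed.

Lemma measurable_steps (D : set R) (L : nat) (eta : nat -> R)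
    (B : nat -> set R) : measurable D ->
  (forall j, (j < L)%N -> measurable (D `&` B j)) ->
  measurable_fun D (fun x => \sum_(j < L) eta j * \1_(B j) x)%R.
Proof.
move=> mD; elim: L => [|L IH] mB.
  by under eq_fun do rewrite big_ord0; exact: measurable_cst.
under eq_fun do rewrite big_ord_recr/=.
apply: measurable_funD; first by apply: IH => j jL; apply: mB; lia.
by apply: measurable_funM => //; apply: measurable_indicI => //; exact: mB.
Qed.

Lemma integral_indic (D B : set R) (u : R -> R) :
  measurable D -> measurable (D `&` B) ->
  \int[m]_(x in D) (u x * \1_B x)%:E = \int[m]_(x in D `&` B) (u x)%:E.
Proof.
move=> mD mB; rewrite integral_mkcondr; apply: eq_integral => x _.
rewrite patchE indicE; case: ifPn => _; last by rewrite mulr0.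
by rewrite mulr1.
Qed.

Lemma integral_steps (D : set R) (u : R -> R) (L : nat) (eta : nat -> R)
    (B : nat -> set R) :
  measurable D -> measurable_fun D u -> (forall x, D x -> 0 <= u x)%R ->
  (forall j, 0 <= eta j)%R ->
  (forall j, (j < L)%N -> measurable (D `&` B j)) ->
  \int[m]_(x in D) (u x * \sum_(j < L) eta j * \1_(B j) x)%:E =
  \sum_(j < L) (eta j)%:E * \int[m]_(x in D `&` B j) (u x)%:E.
Proof.
move=> mD mu u0 e0; elim: L => [|L IH] mB.
  rewrite big_ord0; under eq_integral do rewrite big_ord0 mulr0.
  by rewrite integral0.
have mBL : measurable (D `&` B L) by exact: mB.
have mB' j : (j < L)%N -> measurable (D `&` B j) by move=> jL; apply: mB; lia.
under eq_integral do rewrite big_ord_recr/= mulrDr EFinD.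
have s0 x : D x -> (0 <= \sum_(j < L) eta j * \1_(B j) x)%R.
  by move=> Dx; apply: sumr_ge0 => j _; rewrite mulr_ge0.
have mi := measurable_indicI mD mBL.
rewrite ge0_integralD//.
- rewrite big_ord_recr/= IH//; congr (_ + _).
  under eq_integral do rewrite mulrCA EFinM.
  rewrite ge0_integralZl//.
  + by rewrite integral_indic.
  + by apply/measurable_EFinP; exact: measurable_funM.
  + by move=> x Dx; rewrite lee_fin mulr_ge0// u0.
  + by rewrite lee_fin.
- by move=> x Dx; rewrite lee_fin mulr_ge0// ?u0// s0.
- apply/measurable_EFinP; apply: measurable_funM => //.
  exact: measurable_steps.
- by move=> x Dx; rewrite lee_fin mulr_ge0// ?u0// mulr_ge0.
- apply/measurable_EFinP; apply: measurable_funM => //.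
  exact: measurable_funM.
Qed.

Lemma layerE (h : R -> \bar R) n x : layer h n x =
  (\sum_(j < n * 2 ^ n) 2 ^- n *
    \1_[set y | ((j.+1%:R * 2 ^- n)%:E < h y)%E] x)%R.
Proof.
rewrite /layer /dyadic mulr_sumr; apply: eq_bigr => j _; congr *%R.
by rewrite indicE; congr ((_ : bool)%:R)%R; apply/idP/idP; rewrite inE.
Qed.

Lemma layer_measurable (D : set R) h n : measurable D -> measurable_fun D h ->
  measurable_fun D (layer h n).
Proof.
move=> mD mh; rewrite (_ : layer h n = fun x => layer h n x)//.
under eq_fun do rewrite layerE.
apply: (@measurable_steps _ _ (fun=> 2 ^- n)%R
  (fun j => [set y | (j.+1%:R * 2 ^- n)%:E < h y])) => // j _.
exact: measurable_superlevel.
Qed.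

Lemma integral_layer (D : set R) (u : R -> R) (h : R -> \bar R) n :
  measurable D -> measurable_fun D u -> measurable_fun D h ->
  (forall x, D x -> 0 <= u x)%R ->
  \int[m]_(x in D) (u x * layer h n x)%:E =
  \sum_(j < n * 2 ^ n) (2 ^- n)%:E *
    \int[m]_(x in D `&` [set x | (j.+1%:R * 2 ^- n)%:E < h x]) (u x)%:E.
Proof.
move=> mD mu mh u0.
under eq_integral do rewrite layerE.
rewrite (@integral_steps _ _ _ (fun=> 2 ^- n)%R
  (fun j => [set y | (j.+1%:R * 2 ^- n)%:E < h y]))// => j _.
exact: measurable_superlevel.
Qed.

(* Both integrals are limits of dyadic sums over the superlevel sets. *)
Lemma le_integral_layers (D D' : set R) (u u' : R -> R) (h h' : R -> \bar R) :
  measurable D -> measurable_fun D u -> measurable_fun D h ->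
  measurable D' -> measurable_fun D' u' -> measurable_fun D' h' ->
  (forall x, D x -> 0 <= u x)%R -> (forall x, D' x -> 0 <= u' x)%R ->
  (forall x, D x -> 0 <= h x) -> (forall x, D' x -> 0 <= h' x) ->
  (forall s : R, (0 < s)%R ->
    \int[m]_(x in D `&` [set x | s%:E < h x]) (u x)%:E <=
    \int[m]_(x in D' `&` [set x | s%:E < h' x]) (u' x)%:E) ->
  \int[m]_(x in D) ((u x)%:E * h x) <= \int[m]_(x in D') ((u' x)%:E * h' x).
Proof.
move=> mD mu mh mD' mu' mh' u0 u'0 h0 h'0 le.
have mul n : measurable_fun D (fun x => (u x * layer h n x)%:E).
  apply/measurable_EFinP; apply: measurable_funM => //.
  exact: layer_measurable.
have cv : \int[m]_(x in D) (u x * layer h n x)%:E @[n --> \oo] -->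
    \int[m]_(x in D) ((u x)%:E * h x).
  rewrite (_ : \int[m]_(x in D) ((u x)%:E * h x) =
      \int[m]_(x in D) limn (fun n => (u x * layer h n x)%:E)); last first.
    apply: eq_integral => x; rewrite inE => Dx; apply/esym/cvg_lim => //.
    under eq_fun do rewrite EFinM.
    by apply: cvgeZl => //; exact/layer_cvg/h0.
  apply: cvg_monotone_convergence => //.
    by move=> n x Dx; rewrite lee_fin mulr_ge0 ?u0// layer_ge0.
  move=> x Dx; apply/nondecreasing_seqP => n.
  by rewrite lee_fin ler_wpM2l ?u0// layer_nd.
apply: cvge_to_le cv _; apply: nearW => n.
apply: (@le_trans _ _ (\int[m]_(x in D') (u' x * layer h' n x)%:E)); last first.
  apply: ge0_le_integral => //.
  - by move=> x Dx; rewrite lee_fin mulr_ge0 ?u'0// layer_ge0.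
  - apply/measurable_EFinP; apply: measurable_funM => //.
    exact: layer_measurable.
  - by apply: emeasurable_funM => //; exact/measurable_EFinP.
  - move=> x Dx; rewrite EFinM lee_wpmul2l ?lee_fin ?u'0//.
    by rewrite layer_le// h'0.
rewrite !integral_layer//; apply: lee_sum => j _.
rewrite lee_wpmul2l ?lee_fin ?invr_ge0 ?exprn_ge0// le// mulr_gt0//.
Qed.

End layers.

(** * Rearrangements *)

Section rearrangement.
Variable R : realType.
Local Notation m := (@lebesgue_measure R).
Implicit Types (c : \bar R) (mu : set R -> \bar R) (f g : R -> R).

(** A bare set function is used so that m and [weighted w], which is controlled only inside the
    interval, are treated alike. Continuity from below is stated as preservation of upper bounds,
    the form in which it is applied. *)
Definition measure_on c mu :=
  [/\ forall A, measurable A -> A `<=` oint c -> 0 <= mu A,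
      (forall A B, measurable A -> measurable B -> A `<=` B ->
        B `<=` oint c -> mu A <= mu B) &
      (forall (A : nat -> set R) t, (forall n, measurable (A n)) ->
        (forall n, A n `<=` oint c) -> nondecreasing_seq A ->
        (forall n, mu (A n) <= t) -> mu (\bigcup_n A n) <= t)].

Lemma measure_on_lebesgue c : measure_on c m.
Proof.
split => [A mA _|A B mA mB AB _|A t mA _ ndA mt].
- exact: measure_ge0.
- by apply: le_measure => //; rewrite inE.
- have cv : (m \o A) n @[n --> \oo] --> m (\bigcup_n A n).
    apply: nondecreasing_cvg_mu => //.
    exact: (bigcup_measurable (fun k _ => mA k)).
  by apply: cvge_to_le cv _; apply: nearW => n /=.
Qed.

Lemma measure_on_weighted c (w : R -> R) : measurable_fun (oint c) w ->
  (forall x, oint c x -> 0 <= w x)%R -> measure_on c (weighted w).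
Proof.
move=> mw w0; rewrite /weighted; split => [A mA Ac|A B mA mB AB Bc|A t mA Ac ndA mt].
- by apply: integral_ge0 => x Ax; rewrite lee_fin w0//; exact: Ac.
- apply: ge0_integral_sub => //.
    by apply/measurable_EFinP; exact: (measurable_funS (oint_measurable c) Bc mw).
  by move=> x Bx; rewrite lee_fin w0//; exact: Bc.
- have cv : \int[m]_(x in A n) (w x)%:E @[n --> \oo] -->
      \int[m]_(x in \bigcup_n A n) (w x)%:E.
    apply: ge0_nondecreasing_set_cvg_integral => //.
    + by move=> n; apply/measurable_EFinP; exact: (measurable_funS (oint_measurable c) (Ac n) mw).
    + by move=> n x Anx; rewrite lee_fin w0//; exact: Ac Anx.
  by apply: cvge_to_le cv _; exact: nearW.
Qed.

Definition superlevel c f (s : R) : set R := oint c `&` [set x | (s < `|f x|)%R].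

Lemma superlevel_measurable c f s : L0 c f -> measurable (superlevel c f s).
Proof.
move=> mf; have : measurable_fun (oint c) (fun x => `|f x|%:E).
  by apply/measurable_EFinP; exact: measurableT_comp.
move=> /(@measurable_superlevel R (oint c) _ s%:E (oint_measurable c)).
by congr measurable; apply/seteqP; split => x -[cx] /=; rewrite lte_fin.
Qed.

Lemma superlevel_sub c f s : superlevel c f s `<=` oint c.
Proof. by move=> x []. Qed.

Lemma le_superlevel c f s t : (s <= t)%R -> superlevel c f t `<=` superlevel c f s.
Proof. by move=> st x [cx tf]; split => //; exact: le_lt_trans tf. Qed.

Lemma dist_ni mu c f s t : measure_on c mu -> L0 c f -> (s <= t)%R ->
  dist mu c f t <= dist mu c f s.
Proof.
move=> [_ mono _] mf st.
by apply: mono; [exact: superlevel_measurable|exact: superlevel_measurable|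
  exact: le_superlevel|exact: superlevel_sub].
Qed.

Lemma dist_ge0 mu c f s : measure_on c mu -> L0 c f -> 0 <= dist mu c f s.
Proof.
move=> [ge0 _ _] mf; apply: ge0; first exact: superlevel_measurable.
exact: superlevel_sub.
Qed.

(** The superlevel set at [s] is the increasing union of those at s + 1/(n+1). *)
Lemma dist_rightcont mu c f s t : measure_on c mu -> L0 c f ->
  (forall s', (s < s')%R -> dist mu c f s' <= t) -> dist mu c f s <= t.
Proof.
move=> [_ _ cont] mf le.
pose A n := superlevel c f (s + n.+1%:R^-1).
have -> : dist mu c f s = mu (\bigcup_n A n).
  congr mu; apply/seteqP; split => x.
    move=> [cx /= sf]; exists (Num.truncn (`|f x| - s)^-1)%R => //; split => //=.
    rewrite -ltrBrDl -[ltRHS]invrK ltf_pV2 ?posrE ?invr_gt0 ?subr_gt0//.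
    exact: truncnS_gt.
  by move=> [n _]; apply: le_superlevel; rewrite lerDl.
apply: cont => n.
- exact: superlevel_measurable.
- exact: superlevel_sub.
- move=> p np; rewrite subsetEset; apply: le_superlevel.
  by rewrite lerD2l lef_pV2 ?posrE// ler_nat.
- by apply: le; rewrite ltrDl.
Qed.

Lemma rearr_ge0 mu c f t : 0 <= rearr mu c f t.
Proof.
by apply: le_ereal_inf_tmp => _ [s [s0 _] <-]; rewrite lee_fin ltW.
Qed.

(** A Galois connection; one direction is the right continuity of the distribution function. Since
    the infimum ranges over positive levels, level 0 is reached by letting [e] decrease to 0. *)
Lemma rearr_gt mu c f s t : measure_on c mu -> L0 c f -> (0 <= s)%R ->
  (s%:E < rearr mu c f t) = (t%:E < dist mu c f s).
Proof.
move=> hmu mf s0; apply/idP/idP; rewrite ltNge; last first.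
  rewrite ltNge; apply: contra => rs; apply: dist_rightcont => // s' ss'.
  have : rearr mu c f t < s'%:E by apply: le_lt_trans rs _; rewrite lte_fin.
  move=> /ereal_inf_lt[_ [s'' [s''0 ds''] <-]]; rewrite lte_fin => s''s'.
  by apply: le_trans ds''; apply: dist_ni => //; exact: ltW.
rewrite ltNge; apply: contra => ds.
have [s1|s1] := ltP 0%R s; first by apply: ereal_inf_lbound; exists s.
have {s0 s1}s0 : s = 0%R by apply/eqP; rewrite eq_le s1.
apply/lee_addgt0Pr => e e0; rewrite s0 add0e.
apply: ereal_inf_lbound; exists e => //; split => //; apply: le_trans ds.
by apply: dist_ni => //; rewrite s0 ltW.
Qed.

Lemma rearr_superlevel mu c c' f s : measure_on c mu -> L0 c f -> (0 <= s)%R ->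
  oint c' `&` [set t | s%:E < rearr mu c f t] =
  oint (Order.min c' (dist mu c f s)).
Proof.
move=> hmu mf s0; rewrite -ointI; apply/seteqP; split => t.
  by move=> [[t0 tc]] /=; rewrite rearr_gt.
by move=> [ct [_ td]]; split => //=; rewrite rearr_gt.
Qed.

Lemma rearr_measurable mu c c' f : measure_on c mu -> L0 c f ->
  measurable_fun (oint c') (rearr mu c f).
Proof.
move=> hmu mf; apply: (measurability (@ErealGenOInfty.G R)).
  exact: ErealGenOInfty.measurableE.
move=> /= _ [_ [r ->] <-].
have [r0|r0] := leP 0%R r.
  have := oint_measurable (Order.min c' (dist mu c f r)).
  rewrite -rearr_superlevel//; congr measurable.
  by apply/seteqP; split => x [cx xr]; split => //; move: xr; rewrite /= in_itv/= andbT.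
have := oint_measurable c'; congr measurable.
apply/seteqP; split => x; last by case.
move=> cx; split => //; rewrite /= in_itv/= andbT.
by rewrite (lt_le_trans _ (rearr_ge0 _ _ _ _)).
Qed.

Lemma rearr_ni mu c f s t : (s <= t)%R -> rearr mu c f t <= rearr mu c f s.
Proof.
move=> st; apply: ereal_inf_le_tmp => _ [r [r0 dr] <-]; exists r => //; split => //.
by apply: le_trans dr _; rewrite lee_fin.
Qed.

Lemma eq_rearr mu mu' c c' f g :
  (forall s, (0 < s)%R -> dist mu c f s = dist mu' c' g s) ->
  rearr mu c f = rearr mu' c' g.
Proof.
move=> fg; apply/funext => t; congr ereal_inf; apply/seteqP; split.
  by move=> _ [s [s0 ds] <-]; exists s => //; split => //; rewrite -fg.
by move=> _ [s [s0 ds] <-]; exists s => //; split => //; rewrite fg.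
Qed.

End rearrangement.

Section almost_everywhere.
Variable R : realType.
Local Notation m := (@lebesgue_measure R).

Lemma ae_imp (P Q : R -> Prop) : (forall x, P x -> Q x) ->
  {ae m, forall x, P x} -> {ae m, forall x, Q x}.
Proof. exact: (@filterS _ _ (ae_filter_ringOfSetsType m)). Qed.

Lemma ae_all (P : R -> Prop) : (forall x, P x) -> {ae m, forall x, P x}.
Proof. exact: (@aeW _ _ _ m). Qed.

End almost_everywhere.

(** * Hardy-Littlewood inequality and rearrangements of decreasing functions *)

Section density.
Variable R : realType.
Local Notation m := (@lebesgue_measure R).
Implicit Types (c : \bar R) (mu : set R -> \bar R) (f g u : R -> R).

Definition has_density c mu u :=
  [/\ measurable_fun (oint c) u, (forall x, oint c x -> 0 <= u x)%R &
    forall A, measurable A -> A `<=` oint c ->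
      mu A = \int[m]_(x in A) (u x)%:E].

Lemma has_density_lebesgue c : has_density c m (fun=> 1%R).
Proof.
split => // A mA _; rewrite integral_cst// mul1e//.
Qed.

Lemma has_density_weighted c u : measurable_fun (oint c) u ->
  (forall x, oint c x -> 0 <= u x)%R -> has_density c (weighted u) u.
Proof. by []. Qed.

Lemma density_measure_on c mu u : has_density c mu u -> measure_on c mu.
Proof.
move=> [mu_ u0 E]; have [ge0 mono cont] := measure_on_weighted mu_ u0.
split => [A mA Ac|A B mA mB AB Bc|A t mA Ac ndA mt].
- by rewrite E// ge0.
- have Ac := subset_trans AB Bc.
  by rewrite !E//; exact: mono.
- rewrite E; [|exact: bigcup_measurable|exact: bigcup_sub].
  by apply: cont => // n; rewrite /weighted -E.
Qed.

(** Hardy-Littlewood by layers: the part of [A] where |f| > s has measure at most the minimum of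
    [mu A] and [dist mu c f s], which is the length of the corresponding superlevel set of the
    rearrangement in (0, mu A). *)
Lemma le_integral_rearr c mu u f A : has_density c mu u -> L0 c f ->
  measurable A -> A `<=` oint c ->
  \int[m]_(x in A) (`|f x| * u x)%:E <=
  \int[m]_(t in oint (mu A)) rearr mu c f t.
Proof.
move=> hd mf mA Ac; have hm := density_measure_on hd.
have [mu_ u0 E] := hd; have [mu0 mono _] := hm.
have muA0 : 0 <= mu A by exact: mu0.
have mfA : measurable_fun A (fun x => `|f x|%:E).
  apply/measurable_EFinP; apply: measurableT_comp => //.
  exact: (measurable_funS (oint_measurable c) Ac mf).
have muA : measurable_fun A u by exact: (measurable_funS (oint_measurable c) Ac mu_).
under eq_integral do rewrite mulrC EFinM.
under [leRHS]eq_integral do rewrite -[rearr _ _ _ _]mul1e.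
apply: (@le_integral_layers _ _ _ u (fun=> 1%R)) => //.
- exact: rearr_measurable.
- by move=> x Ax; exact/u0/Ac.
- by move=> t _; exact: rearr_ge0.
- move=> s s0.
  rewrite rearr_superlevel ?(ltW s0)//.
  have -> : A `&` [set x | s%:E < `|f x|%:E] = A `&` superlevel c f s.
    apply/seteqP; split => x [Ax]; first by rewrite /= lte_fin => xf; split => //; split => //; exact: Ac.
    by move=> [_ xf]; split => //; rewrite /= lte_fin.
  have ms := superlevel_measurable s mf.
  have d0 : 0 <= dist mu c f s by exact: dist_ge0.
  rewrite [leRHS]integral_cst//= mul1e lebesgue_oint; last by rewrite le_min muA0.
  have mAs : measurable (A `&` superlevel c f s) by exact: measurableI.
  have Asc : A `&` superlevel c f s `<=` oint c by move=> x [/Ac].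
  rewrite -(E _ mAs Asc).
  rewrite le_min; apply/andP; split.
    by apply: mono.
  by apply: mono => //; apply: superlevel_sub.
Qed.

Lemma ae_eq_dist c mu u f g s : has_density c mu u -> L0 c f -> L0 c g ->
  {ae m, forall x, oint c x -> `|f x|%R = `|g x|%R} ->
  dist mu c f s = dist mu c g s.
Proof.
move=> [mu_ u0 E] mf mg fg; have mfs := superlevel_measurable s mf.
have mgs := superlevel_measurable s mg.
rewrite /dist !E//; try exact: superlevel_sub.
rewrite -(@integral_indic R (oint c) [set x | s < `|f x|]%R)//.
rewrite -(@integral_indic R (oint c) [set x | s < `|g x|]%R)//.
apply: ge0_ae_eq_integral => //.
- apply/measurable_EFinP; apply: measurable_funM => //.
  exact: measurable_indicI.
- apply/measurable_EFinP; apply: measurable_funM => //.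
  exact: measurable_indicI.
- by move=> x cx; rewrite lee_fin mulr_ge0// u0.
- by move=> x cx; rewrite lee_fin mulr_ge0// u0.
- apply: ae_imp fg => x fgx cx; rewrite !indicE; congr (_ * (_ : bool)%:R)%:E.
  by apply/idP/idP; rewrite !inE /= fgx.
Qed.

Lemma ae_eq_rearr c mu u f g : has_density c mu u -> L0 c f -> L0 c g ->
  {ae m, forall x, oint c x -> `|f x|%R = `|g x|%R} ->
  rearr mu c f = rearr mu c g.
Proof.
by move=> hd mf mg fg; apply: eq_rearr => s _; exact: (ae_eq_dist s hd mf mg fg).
Qed.

(** If the rearrangement falls below g(t), a rational q strictly between the two values forces t =
    [dist m c g q]. The exceptional points are therefore countable. *)
Lemma ae_rearr_noninc c g : L0 c g -> (forall x, oint c x -> 0 <= g x)%R ->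
  (forall x y, oint c x -> oint c y -> x <= y -> g y <= g x)%R ->
  {ae m, forall t, oint c t -> rearr m c g t = (g t)%:E}.
Proof.
move=> mg g0 gd; have hm := measure_on_lebesgue c.
pose N := \bigcup_(q : rat) [set t : R | t%:E = dist m c g (ratr q)].
have N0 : m.-negligible N.
  have cN : countable N.
    apply: bigcup_countable => // q _.
    apply: finite_set_countable; apply: (@sub_finite_set _ _ [set fine (dist m c g (ratr q))]) => //.
    by move=> t /= <-.
  exists N; split => //; first exact: countable_measurable.
  exact: countable_lebesgue_measure0.
apply: negligibleS N0 => t /=; apply: contra_notP => Nt ct.
have tle s : (0 <= s)%R -> (s < g t)%R -> t%:E <= dist m c g s.
  move=> s0 st; have t0 := ltW ct.1.
  rewrite -(@lebesgue_oint R t%:E) ?lee_fin//.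
  have [_ mono _] := hm.
  apply: (mono (oint t%:E) (superlevel c g s)) => //.
  - exact: superlevel_measurable.
  - move=> x [x0 xt]; have cx : oint c x by split => //; exact: lt_trans ct.2.
    split => //=; rewrite ger0_norm ?g0// (lt_le_trans st)// gd//.
    by rewrite ltW.
  - by move=> x [].
have gtle s : (0 <= s)%R -> (g t <= s)%R -> dist m c g s <= t%:E.
  move=> s0 st; have t0 := ltW ct.1.
  rewrite -(@lebesgue_oint R t%:E) ?lee_fin//.
  have [_ mono _] := hm; apply: le_measure; rewrite ?inE//.
    exact: superlevel_measurable.
  move=> x [cx /=]; rewrite ger0_norm ?g0// => sx; split; first exact: cx.1.
  rewrite lte_fin ltNge; apply/negP => tx.
  by have := gd _ _ ct cx tx; rewrite leNgt (le_lt_trans st).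
apply/eqP; rewrite eq_le; apply/andP; split; rewrite leNgt; apply/negP.
  by rewrite rearr_gt ?g0// ltNge gtle// g0.
move=> rg; have rf : rearr m c g t \is a fin_num.
  by rewrite ge0_fin_numE ?rearr_ge0// (lt_trans rg)// ltry.
move: rg; rewrite -(fineK rf) lte_fin => /rat_in_itvoo[q]; rewrite in_itv/= => /andP[rq qg].
have q0 : (0 <= ratr q :> R)%R.
  by rewrite (le_trans _ (ltW rq))// fine_ge0// rearr_ge0.
apply: Nt; exists q => //=; apply/eqP; rewrite eq_le tle//=.
rewrite leNgt -rearr_gt// -leNgt -(fineK rf) lee_fin ltW//.
Qed.

End density.

(** * Finite-dimensional Hahn-Banach theorem *)

Section hahn_banach.
Variables (R : realType).

(** Homogeneity is asked as an inequality only; using it for t and for 1/t recovers equality. *)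
Definition sublinear (T : lmodType R) (q : T -> R) :=
  (forall u v, q (u + v) <= q u + q v)%R /\
  (forall (t : R) u, 0 < t -> q (t *: u) <= t * q u)%R.

Lemma sublinear0 (T : lmodType R) (q : T -> R) : sublinear q -> q 0%R = 0%R.
Proof.
move=> [_ hom]; have := hom 2%R 0%R; rewrite scaler0 => /(_ (ltr0Sn R 1)) H.
have := hom 2^-1%R 0%R; rewrite scaler0 invr_gt0 => /(_ (ltr0Sn R 1)) H'.
lra.
Qed.

(* [q' v] is the infimum of [q (v + t u) - t K] over [t >= 0]. *)
Lemma sublinear_step (T : lmodType R) (q : T -> R) (u : T) (K : R) :
  sublinear q -> (K <= q u)%R ->
  exists q', [/\ sublinear q', (forall v, q' v <= q v)%R & (q' (- u) <= - K)%R].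
Proof.
move=> sq Ku; have [sub hom] := sq; have q0 := sublinear0 sq.
pose S v := [set (q (v + t *: u) - t * K)%R | t in [set t : R | (0 <= t)%R]].
have hom' (t : R) v : (0 <= t)%R -> (q (t *: v) <= t * q v)%R.
  rewrite le_eqVlt => /predU1P[<-|]; last exact: hom.
  by rewrite scale0r q0 mul0r.
have hom'' (t : R) v : (0 <= t)%R -> (t * q v <= q (t *: v))%R.
  rewrite le_eqVlt => /predU1P[<-|t0]; first by rewrite scale0r q0 mul0r.
  have := hom (t^-1)%R (t *: v)%R; rewrite invr_gt0 => /(_ t0).
  by rewrite scalerA mulVf ?gt_eqF// scale1r ler_pdivlMl.
have lbS v : lbound (S v) (- q (- v))%R.
  move=> _ [t /= t0 <-].
  have := sub (v + t *: u)%R (- v)%R; rewrite addrAC subrr add0r => H.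
  have := hom'' t u t0; have : (t * K <= t * q u)%R by rewrite ler_wpM2l.
  lra.
have S0 v : S v !=set0 by exists (q (v + 0 *: u) - 0 * K)%R; exists 0%R => /=.
have infS v : has_inf (S v) by split => //; exists (- q (- v))%R.
exists (fun v => inf (S v)); split.
- split.
    move=> v v'; rewrite -lerBlDr; apply: lb_le_inf => // _ [t /= t0 <-].
    rewrite lerBlDr [leRHS]addrC -lerBlDr; apply: lb_le_inf => // _ [t' /= t'0 <-].
    rewrite lerBlDr; apply: (@le_trans _ _ (q (v + v' + (t + t') *: u) - (t + t') * K)%R).
      by apply: ge_inf; [exact: (infS _).2|exists (t + t')%R => //=; rewrite addr_ge0].
    have := sub (v + t *: u)%R (v' + t' *: u)%R.
    rewrite addrACA -scalerDl; lra.
  move=> t v t0; rewrite -ler_pdivrMl//; apply: lb_le_inf => // _ [t' /= t'0 <-].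
  rewrite ler_pdivrMl//; apply: (@le_trans _ _ (q (t *: v + (t * t') *: u) - (t * t') * K)%R).
    by apply: ge_inf; [exact: (infS _).2|exists (t * t')%R => //=; rewrite mulr_ge0// ltW].
  rewrite -scalerA -scalerDr mulrBr mulrA lerD2r; exact: hom.
- move=> v; apply: ge_inf; first exact: (infS _).2.
  by exists 0%R => //=; rewrite scale0r addr0 mul0r subr0.
- apply: ge_inf; first exact: (infS _).2.
  by exists 1%R => //=; rewrite scale1r addNr q0 mul1r sub0r.
Qed.

(** Once q2(-e) <= -q2(e) for every basis vector e, the sublinear [q2] is linear, with coefficients
    q2(e). *)
Lemma finite_hahn_banach (L : nat) (q : 'rV[R]_L -> R) (u : 'rV[R]_L) :
  sublinear q -> exists eta : 'I_L -> R,
    (forall v : 'rV[R]_L, \sum_j eta j * v ord0 j <= q v)%R /\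
    (q u <= \sum_j eta j * u ord0 j)%R.
Proof.
move=> sq; have [q1 [sq1 q1q q1u]] := sublinear_step sq (lexx (q u)).
(* One application per basis vector. Inequalities q(-e) <= -q(e) gained earlier survive, since
   lowering q decreases the left side and increases the right one. *)
have [q2 [sq2 q2q1 q2e]] : exists q2 : 'rV[R]_L -> R, [/\ sublinear q2,
    (forall v, q2 v <= q1 v)%R &
    forall j : 'I_L, j \in enum 'I_L ->
      (q2 (- delta_mx ord0 j) <= - q2 (delta_mx ord0 j))%R].
  elim: (enum 'I_L) => [|j s [q2 [sq2 q2q1 q2e]]]; first by exists q1.
  have [q3 [sq3 q3q2 q3e]] := sublinear_step sq2 (lexx (q2 (delta_mx ord0 j))).
  exists q3; split => // [v|i]; first exact: le_trans (q2q1 _).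
  rewrite inE => /predU1P[->|ins].
    by rewrite (le_trans q3e)// lerN2.
  by rewrite (le_trans (q3q2 _))// (le_trans (q2e _ ins))// lerN2.
pose eta j := q2 (delta_mx ord0 j); exists eta.
have [sub2 hom2] := sq2; have q20 := sublinear0 sq2.
have le2 v : (q2 v <= \sum_j eta j * v ord0 j)%R.
  have {1}-> : v = (\sum_j v ord0 j *: delta_mx ord0 j)%R.
    by rewrite {1}(row_sum_delta v).
  elim/big_ind2 : _ => [|x x' y y' xx yy|j _]; first by rewrite q20.
    by rewrite (le_trans (sub2 _ _))// lerD.
  have [v0|v0|<-] := ltgtP 0%R (v ord0 j).
  - by rewrite (le_trans (hom2 _ _ v0))// mulrC.
  - have -> : (v ord0 j *: delta_mx ord0 j = (- v ord0 j) *: - delta_mx ord0 j :> 'rV[R]_L)%R.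
      by rewrite scalerN scaleNr opprK.
    rewrite (le_trans (hom2 _ _ _)) ?oppr_gt0//.
    rewrite -[leRHS]mulrNN mulrC ler_wpM2r ?oppr_ge0 ?(ltW v0)//.
    by apply: q2e; rewrite mem_enum.
  - by rewrite scale0r mulr0 q20.
split => [v|].
  apply: (@le_trans _ _ (q2 v)); last by rewrite (le_trans (q2q1 _)).
  have := le2 (- v)%R; have := sub2 v (- v)%R; rewrite subrr q20.
  have -> : (\sum_j eta j * (- v)%R ord0 j = - \sum_j eta j * v ord0 j)%R.
    by rewrite -sumrN; apply: eq_bigr => j _; rewrite mxE mulrN.
  lra.
have := le_trans (q2q1 _) q1u; have := sub2 u (- u)%R; rewrite subrr q20.
have := le2 u; lra.
Qed.

End hahn_banach.

(** * Maximum points of a piecewise affine minus a concave function *)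

Section argmax.
Variable R : realType.
Implicit Types (F G W w : R -> R) (x y z c d : R) (a : \bar R).
Local Open Scope ring_scope.

Definition odom a : set R := [set x | x = 0 \/ oint a x].

Lemma odom_ge0 a x : odom a x -> 0 <= x.
Proof. by move=> [->//|[/ltW]]. Qed.

Lemma odom_oint a x y : odom a y -> 0 <= x -> x < y -> oint a y.
Proof. by move=> [->|//] x0 xy; have := le_lt_trans x0 xy; rewrite ltxx. Qed.

Lemma odom_le a x y : odom a y -> 0 <= x -> x <= y -> odom a x.
Proof.
rewrite le_eqVlt => -[->|[y0 ya]] /predU1P[<-|x0] xy; try by left.
  by have := lt_le_trans x0 xy; rewrite ltxx.
by right; split => //; rewrite (le_lt_trans _ ya)// lee_fin.
Qed.

(** Concavity by supporting lines: w(x) is a supergradient of [W] at each interior point. *)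
Definition concave_slope a W w := forall x y,
  0 <= x -> 0 <= y -> odom a y -> oint a x -> W y - W x <= (y - x) * w x.

(** This is the primitive of [d] times the sum of the indicators of the intervals (0, xs j), as (0,
    y) meets (0, xs j) in length min(y, xs j). *)
Definition steps_int (d : R) (q : nat) (xs : nat -> R) (y : R) : R :=
  d * \sum_(j < q) Num.min y (xs j).

(** No point lies strictly between y and y', so each summand has slope 1 or 0 there, and [i] counts
    those of slope 1. *)
Lemma sum_minB (q i : nat) (xs : nat -> R) y y' : (i <= q)%N -> y <= y' ->
  (forall j, (j < i)%N -> y' <= xs j) ->
  (forall j, (i <= j < q)%N -> xs j <= y) ->
  \sum_(j < q) Num.min y' (xs j) - \sum_(j < q) Num.min y (xs j) =
  i%:R * (y' - y).
Proof.
move=> iq yy' lt_i ge_i; rewrite -sumrB.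
rewrite (eq_bigr (fun j : 'I_q => if (j < i)%N then y' - y else 0)); last first.
  move=> j _; case: ifPn => ji.
    by rewrite !min_l ?lt_i// (le_trans yy')// lt_i.
  have xj : xs j <= y by apply: ge_i; rewrite leqNgt ji/=.
  by rewrite !min_r ?subrr// (le_trans xj).
by rewrite -big_mkcond/= -(big_ord_widen _ (fun=> y' - y) iq) sumr_const card_ord mulr_natl.
Qed.

Definition step_pt (q : nat) (xs : nat -> R) x :=
  x = 0 \/ exists2 j, (j < q)%N & x = xs j.

(* Between consecutive points the step integral is affine while [W] is concave,
   so the difference is dominated by its value at one of the two points. *)
Lemma steps_int_neighbour a d q (xs : nat -> R) W w c y :
  0 < d -> 0 < c -> concave_slope a W w ->
  (forall j, 0 <= xs j) -> (forall i j, (i <= j)%N -> xs j <= xs i) ->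
  (forall j, (j < q)%N -> odom a (xs j)) ->
  (forall x, oint a x -> 0 <= w x) -> odom a y ->
  let G x := steps_int d q xs x - c * W x in
  (exists j, [/\ (j < q)%N, y < xs j & G y <= G (xs j)]) \/
  (exists p, [/\ step_pt q xs p, p <= y, G y <= G p &
    p < y -> 0 < w y -> G y < G p]).
Proof.
move=> d0 c0 cW xs0 xsni xsa w0 ya G; have y0 := odom_ge0 ya.
(* [i] counts the points beyond [y]; between the neighbours [l] and [xs i.-1] the step integral has
   slope d i. *)
have : exists i, (q <= i)%N || (xs i <= y) by exists q; rewrite leqnn.
move=> /ex_minnP[i Pi mini].
have iq : (i <= q)%N by apply: mini; rewrite leqnn.
have lt_i j : (j < i)%N -> y < xs j.
  move=> ji; rewrite ltNge; apply: contraL ji => xy; rewrite -leqNgt.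
  by apply: mini; rewrite xy orbT.
pose l := if (i < q)%N then xs i else 0.
have l0 : 0 <= l by rewrite /l; case: ifP.
have ly : l <= y.
  by rewrite /l; case: ifPn => // iq'; move: Pi; rewrite leqNgt iq'.
have Pl : step_pt q xs l by rewrite /l; case: ifPn => ?; [right; exists i|left].
have ge_l j : (i <= j < q)%N -> xs j <= l.
  by move=> /andP[ij jq]; rewrite /l (leq_ltn_trans ij jq) xsni.
have [->|ly'] := eqVneq y l; first by right; exists l; split => //; rewrite ltxx.
have {}ly' : l < y by rewrite lt_def ly' ly.
have oy : oint a y by exact: odom_oint ly'.
have la : odom a l by exact: odom_le ly.
have Fl : steps_int d q xs y - steps_int d q xs l = d * i%:R * (y - l).
  rewrite -mulrBr (@sum_minB _ i) ?mulrA//; first by move=> j /lt_i /ltW.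
have wl := cW y l y0 l0 la oy.
(* Comparing d i with the supergradient c w(y) decides the direction: the difference increases
   strictly towards the left neighbour, or does not decrease towards the right one. Without a right
   neighbour d i = 0, hence w(y) = 0, and moving left still loses nothing. *)
have [sw|sw] := ltP (d * i%:R) (c * w y).
  right; exists l.
  have : G y < G l.
    have : c * (W l - W y) <= c * ((l - y) * w y) by rewrite ler_pM2l.
    have : d * i%:R * (y - l) < c * w y * (y - l) by rewrite ltr_pM2r// subr_gt0.
    rewrite /G; lra.
  by move=> lt; split => //; exact: ltW.
have [i0|i0] := posnP i.
  right; exists l.
  have wy : w y = 0.
    apply/eqP; rewrite eq_le w0// andbT -(pmulr_rle0 _ c0).
    by rewrite (le_trans sw)// i0 mulr0.
  split => //; last by rewrite wy ltxx.
  have : c * (W l - W y) <= c * ((l - y) * w y) by rewrite ler_pM2l.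
  rewrite wy; move: Fl; rewrite i0 /G; lra.
left; exists i.-1; have i1 : (i.-1 < i)%N by lia.
have i1q : (i.-1 < q)%N by lia.
have yr := lt_i _ i1; split => //.
have Fr : steps_int d q xs (xs i.-1) - steps_int d q xs y = d * i%:R * (xs i.-1 - y).
  rewrite -mulrBr (@sum_minB _ i) ?mulrA ?ltW//.
    by move=> j ji; apply: xsni; lia.
  by move=> j /ge_l /le_trans; apply.
have wr := cW y (xs i.-1) y0 (xs0 _) (xsa _ i1q) oy.
have : c * (W (xs i.-1) - W y) <= c * ((xs i.-1 - y) * w y) by rewrite ler_pM2l.
have : c * w y * (xs i.-1 - y) <= d * i%:R * (xs i.-1 - y).
  by rewrite ler_pM2r// subr_gt0.
rewrite /G; lra.
Qed.

(** Ties go to the right, as the largest maximum point is wanted. *)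
Lemma seq_argmax G (s : seq R) : s != [::] -> exists2 p, p \in s &
  forall y, y \in s -> G y < G p \/ (G y = G p /\ y <= p).
Proof.
elim: s => // x [|z s] IH _.
  by exists x; rewrite ?inE// => y; rewrite inE => /eqP ->; right.
have [//|p ps pP] := IH.
have [lt|gt|eq] := ltgtP (G x) (G p).
- exists p; first by rewrite inE ps orbT.
  move=> y; rewrite inE => /predU1P[->|/pP//]; by left.
- exists x; first by rewrite mem_head.
  move=> y; rewrite inE => /predU1P[->|/pP[H|[H1 H2]]]; [by right|left|left].
    exact: lt_trans gt.
  by rewrite H1.
- have [px|xp] := leP p x.
    exists x; first by rewrite mem_head.
    move=> y; rewrite inE => /predU1P[->|/pP[H|[H1 H2]]]; [by right|left|right].
      by rewrite eq.
    by rewrite eq H1 (le_trans H2).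
  exists p; first by rewrite inE ps orbT.
  move=> y; rewrite inE => /predU1P[->|/pP//]; right; rewrite eq; split => //.
  exact: ltW.
Qed.

Definition is_top a G t := odom a t /\
  forall y, odom a y -> G y <= G t /\ (t < y -> G y < G t).

(** Every point is dominated by some break point, so a search among finitely many of them suffices.
    Positivity of [w] gives the strict inequality to the right of the chosen one. *)
Lemma steps_top a d q (xs : nat -> R) W w c :
  0 < d -> 0 < c -> concave_slope a W w ->
  (forall j, 0 <= xs j) -> (forall i j, (i <= j)%N -> xs j <= xs i) ->
  (forall j, (j < q)%N -> odom a (xs j)) ->
  (forall x, oint a x -> 0 < w x) ->
  exists2 t, step_pt q xs t & is_top a (fun x => steps_int d q xs x - c * W x) t.
Proof.
move=> d0 c0 cW xs0 xsni xsa w0; pose G x := steps_int d q xs x - c * W x.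
have [//|p ps pP] := @seq_argmax G (0 :: [seq xs j | j <- iota 0 q]).
have mem_pt x : step_pt q xs x -> x \in 0 :: [seq xs j | j <- iota 0 q].
  move=> [->|[j jq ->]]; first by rewrite mem_head.
  by rewrite inE map_f ?orbT// mem_iota.
have pt_p : step_pt q xs p.
  move: ps; rewrite inE => /predU1P[->|/mapP[j]]; first by left.
  by rewrite mem_iota => jq ->; right; exists j.
exists p => //; split.
  by move: pt_p => [->|[j jq ->]]; [left|exact: xsa].
have pmax x : step_pt q xs x -> G x <= G p /\ (p < x -> G x < G p).
  move=> /mem_pt/pP[lt|[-> xp]]; first by rewrite ltW.
  by rewrite lexx ltNge xp.
move=> y ya.
have w0' x : oint a x -> 0 <= w x by move=> /w0/ltW.
have [[j [jq yx Gy]]|[l [Pl ly Gy Gy']]] :=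
  steps_int_neighbour d0 c0 cW xs0 xsni xsa w0' ya.
  have [Gj1 Gj2] := pmax (xs j) (or_intror (ex_intro2 _ _ j jq erefl)).
  split; first exact: le_trans Gj1.
  move=> py; apply: le_lt_trans Gy _; apply: Gj2; exact: lt_trans yx.
have [Gl1 Gl2] := pmax l Pl.
split; first exact: le_trans Gl1.
move=> py; move: ly; rewrite le_eqVlt => /predU1P[E|ly].
  by rewrite -E; apply: Gl2; rewrite E.
apply: lt_le_trans (Gy' ly _) Gl1; apply: w0; apply: odom_oint ly => //.
by case: Pl => [->//|[j _ ->]].
Qed.

(** If t < t', adding the two optimality inequalities, one of them strict, contradicts the sign of
    (c' - c)(W t' - W t). *)
Lemma top_le_c a F W c c' t t' :
  (forall x y, odom a x -> odom a y -> x <= y -> W x <= W y) -> c <= c' ->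
  is_top a (fun x => F x - c * W x) t -> is_top a (fun x => F x - c' * W x) t' ->
  t' <= t.
Proof.
move=> Wnd cc' [ta tP] [t'a t'P]; rewrite leNgt; apply/negP => tt'.
have [_ /(_ tt') H1] := tP _ t'a; have [H2 _] := t'P _ ta.
have : (c' - c) * (W t' - W t) >= 0.
  by rewrite mulr_ge0// subr_ge0// Wnd// ltW.
lra.
Qed.

(** The same comparison for a fixed slope: larger increments move the largest maximum point to the
    right. *)
Lemma top_le_F a F F' W c t t' :
  (forall x y, odom a x -> odom a y -> x <= y -> F y - F x <= F' y - F' x) ->
  is_top a (fun x => F x - c * W x) t -> is_top a (fun x => F' x - c * W x) t' ->
  t <= t'.
Proof.
move=> FF' [ta tP] [t'a t'P]; rewrite leNgt; apply/negP => tt'.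
have [H1 _] := tP _ t'a; have [_ /(_ tt') H2] := t'P _ ta.
have := FF' _ _ t'a ta (ltW tt'); lra.
Qed.

Section tops.
Variables (a : \bar R) (F W : R -> R) (d : R) (L : nat) (tau : nat -> R).
Hypotheses (d0 : 0 < d) (F0 : F 0 = 0) (W0 : W 0 = 0).
Hypothesis Wnd : forall x y, odom a x -> odom a y -> x <= y -> W x <= W y.
Hypothesis tauP : forall j, (j < L)%N ->
  is_top a (fun x => F x - d * j.+1%:R * W x) (tau j).
Hypothesis tauL : tau L.-1 = 0.
Hypothesis L0 : (0 < L)%N.
Hypothesis tau_ni : forall i j, (i <= j)%N -> tau j <= tau i.

Let odom0 : odom a 0. Proof. by left. Qed.

Let W_ge0 x : odom a x -> 0 <= W x.
Proof. by move=> ax; rewrite -W0; apply: Wnd => //; exact: odom_ge0 ax. Qed.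

Let tau_dom j : (j < L)%N -> odom a (tau j).
Proof. by move=> /tauP[]. Qed.

Let min_dom x j : (j < L)%N -> odom a x -> odom a (Num.min x (tau j)).
Proof. by move=> jL ax; rewrite /Num.min; case: ifP => // _; exact: tau_dom. Qed.

(** Downward induction on the level. Up to [tau i] the passage from level i+1 to level i gains the
    term d W(x) on both sides; beyond [tau i] the left side is at most its value at [tau i], while
    the right side only grows. At the last level the maximum is 0. The remaining d W(x) is the mesh
    error. *)
Lemma tops_majorize x : odom a x ->
  F x - d * W x <= d * \sum_(l < L) W (Num.min x (tau l)).
Proof.
suff H k : forall i, (i + k)%N = L.-1 -> forall x, odom a x ->
    F x - d * i.+1%:R * W x <= d * \sum_(i <= l < L) W (Num.min x (tau l)).
  move=> ax; have := H L.-1 0%N erefl x ax.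
  by rewrite big_mkord mulr1.
elim: k => [|k IH] i ik {}x ax.
  have iL : (i < L)%N by lia.
  have [_ /(_ x ax)[H _]] := tauP iL.
  have ti : tau i = 0 by rewrite -tauL; congr tau; lia.
  move: H; rewrite ti F0 W0 mulr0 subr0 => H.
  apply: le_trans H _; rewrite mulr_ge0 ?(ltW d0)// big_nat_cond sumr_ge0// => l.
  by rewrite andbT => /andP[_ lL]; apply/W_ge0/min_dom.
have iL : (i < L)%N by lia.
have small y : odom a y -> y <= tau i ->
    F y - d * i.+1%:R * W y <= d * \sum_(i <= l < L) W (Num.min y (tau l)).
  move=> ay yt; have Hn : i.+2%:R = i.+1%:R + 1 :> R by rewrite natr1.
  have := IH i.+1; rewrite addSnnS => /(_ ik y ay).
  rewrite Hn (big_ltn iL) min_l// [X in _ -> _ <= X]mulrDr; lra.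
have [xt|tx] := leP x (tau i); first exact: small.
have [ta /(_ x ax)[H _]] := tauP iL.
apply: (le_trans H); apply: le_trans (small _ ta (lexx _)) _.
rewrite ler_pM2l// big_nat_cond [leRHS]big_nat_cond; apply: ler_sum => l.
rewrite andbT => /andP[_ lL]; apply: Wnd; [exact: min_dom|exact: min_dom|].
by rewrite le_min ge_min ltW// ge_min lexx orbT.
Qed.

(** Maximality at [tau i], tested against [tau i.+1], bounds the increment of F between consecutive
    maximum points from below by d (i+1) times that of W; these bounds telescope. *)
Lemma tops_touch j : (j < L)%N ->
  d * \sum_(i < L) W (Num.min (tau i) (tau j)) <= F (tau j).
Proof.
suff H k : forall i, (i + k)%N = L.-1 ->
    d * i.+1%:R * W (tau i) + d * \sum_(i.+1 <= l < L) W (tau l) <= F (tau i).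
  move=> jL; have := H (L.-1 - j)%N j; rewrite subnKC; last by lia.
  move=> /(_ erefl); apply: le_trans.
  rewrite -(big_mkord xpredT (fun i => W (Num.min (tau i) (tau j)))).
  rewrite (@big_cat_nat _ _ _ j.+1)//= mulrDr lerD//.
    rewrite big_mkord (eq_bigr (fun=> W (tau j))).
      by rewrite sumr_const card_ord -[X in _ * X]mulr_natl mulrA.
    by move=> i _; rewrite min_r// tau_ni// -ltnS.
  rewrite ler_pM2l// big_nat_cond [leRHS]big_nat_cond; apply: ler_sum => l.
  by rewrite andbT => /andP[jl _]; rewrite min_l// tau_ni// ltnW.
elim: k => [|k IH] i ik; have iL : (i < L)%N by lia.
  have [_ /(_ 0 odom0)[H _]] := tauP iL.
  rewrite big_geq; last by lia.
  move: H; rewrite F0 W0; lra.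
have i1L : (i.+1 < L)%N by lia.
have := IH i.+1; rewrite addSnnS => /(_ ik) {}IH.
have [_ /(_ _ (tau_dom i1L))[H _]] := tauP iL.
have Hn : i.+2%:R = i.+1%:R + 1 :> R by rewrite natr1.
rewrite (big_ltn i1L) [X in _ + X]mulrDr; move: IH H; rewrite Hn; lra.
Qed.

End tops.
End argmax.

(** * Primitives of decreasing functions *)

Section primitives.
Variable R : realType.
Local Notation m := (@lebesgue_measure R).

Lemma lebesgue_ointD (s x : R) : (0 <= s)%R -> (s <= x)%R ->
  m (oint x%:E `\` oint s%:E) = (x - s)%:E.
Proof.
move=> s0 sx; have x0 := le_trans s0 sx.
rewrite measureD//=; last by rewrite lebesgue_oint ?lee_fin// ltry.
rewrite ointI min_r ?lee_fin//.
by rewrite !lebesgue_oint ?lee_fin.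
Qed.

Lemma integral_ointD (c : \bar R) (r : R -> \bar R) (s x : R) :
  measurable_fun (oint c) r -> (forall x, oint c x -> 0 <= r x) ->
  (s <= x)%R -> x%:E <= c ->
  \int[m]_(t in oint x%:E) r t = \int[m]_(t in oint s%:E) r t +
    \int[m]_(t in oint x%:E `\` oint s%:E) r t.
Proof.
move=> mr r0 sx xc.
have sx' : oint s%:E `<=` oint x%:E by apply: oint_sub; rewrite lee_fin.
have xc' : oint x%:E `<=` oint c by exact: oint_sub.
rewrite -ge0_integral_setU//.
- by rewrite setDUK.
- exact: measurableD.
- rewrite setDUK//; exact: (measurable_funS (oint_measurable c) xc' mr).
- by rewrite setDUK// => t /xc' /r0.
- by apply/disj_setPS => t [? []].
Qed.

Lemma le_integral_slopel (c : \bar R) (r : R -> \bar R) (s x : R) :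
  measurable_fun (oint c) r -> (forall x, oint c x -> 0 <= r x) ->
  (forall x y, oint c x -> oint c y -> (x <= y)%R -> r y <= r x) ->
  (0 <= s)%R -> (s <= x)%R -> oint c x ->
  \int[m]_(t in oint s%:E) r t + (x - s)%:E * r x <= \int[m]_(t in oint x%:E) r t.
Proof.
move=> mr r0 rd s0 sx cx.
have xc : x%:E <= c by exact/ltW/cx.2.
rewrite (integral_ointD mr r0 sx xc) leeD2l//.
rewrite -lebesgue_ointD// muleC -integral_cst//; last exact: measurableD.
have sub : oint x%:E `\` oint s%:E `<=` oint c by move=> t [/(oint_sub xc)].
apply: ge0_le_integral => //.
- exact: measurableD.
- by move=> t _; exact: r0.
- exact: (measurable_funS (oint_measurable c) sub mr).
- move=> t [tx _]; apply: rd => //; first exact: (oint_sub xc).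
  by have := tx.2; rewrite lte_fin => /ltW.
Qed.

Lemma le_integral_sloper (c : \bar R) (r : R -> \bar R) (x y : R) :
  measurable_fun (oint c) r -> (forall x, oint c x -> 0 <= r x) ->
  (forall x y, oint c x -> oint c y -> (x <= y)%R -> r y <= r x) ->
  oint c x -> (x <= y)%R -> y%:E <= c ->
  \int[m]_(t in oint y%:E) r t <= \int[m]_(t in oint x%:E) r t + (y - x)%:E * r x.
Proof.
move=> mr r0 rd cx xy yc.
rewrite (integral_ointD mr r0 xy yc) leeD2l//.
rewrite -lebesgue_ointD// ?(ltW cx.1)// muleC -integral_cst//; last exact: measurableD.
have sub : oint y%:E `\` oint x%:E `<=` oint c by move=> t [/(oint_sub yc)].
apply: ge0_le_integral => //.
- exact: measurableD.
- by move=> t /sub /r0.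
- exact: (measurable_funS (oint_measurable c) sub mr).
- move=> t ty; apply: rd => //; first exact: sub.
  case: ty => ty; apply: contra_notT; rewrite -ltNge => tx.
  by split; [exact: ty.1|rewrite lte_fin].
Qed.

(** The integrand is at least r(x) to the left of x and at most r(x) to the right, so r(x) is the
    slope of a supporting line. It is finite because r >= r(x) on (0, x), where the integral is
    finite. *)
Lemma concave_slope_primitive (c : \bar R) (r : R -> \bar R) :
  measurable_fun (oint c) r -> (forall x, oint c x -> 0 <= r x) ->
  (forall x y, oint c x -> oint c y -> (x <= y)%R -> r y <= r x) ->
  (forall x, oint c x -> \int[m]_(t in oint x%:E) r t < +oo) ->
  concave_slope c (fun x => fine (\int[m]_(t in oint x%:E) r t)) (fine \o r).
Proof.
move=> mr r0 rd rfin x y x0 y0 cy cx.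
have I0 s : s%:E <= c -> 0 <= \int[m]_(t in oint s%:E) r t.
  by move=> sc; apply: integral_ge0 => t /(oint_sub sc) /r0.
have Ix : \int[m]_(t in oint x%:E) r t \is a fin_num.
  by rewrite ge0_fin_numE ?rfin// I0// ltW// cx.2.
have yc : y%:E <= c.
  by case: cy => [->|[_ /ltW//]]; rewrite (le_trans _ (ltW cx.2))// lee_fin.
have Iy : \int[m]_(t in oint y%:E) r t \is a fin_num.
  rewrite ge0_fin_numE ?I0//; case: cy => [->|/rfin//].
  by rewrite (_ : oint 0 = set0) ?integral_set0// -subset0 => t [/lt_trans H /H]; rewrite ltxx.
have xc' : x%:E <= c by exact/ltW/cx.2.
have rx : r x \is a fin_num.
  rewrite ge0_fin_numE ?r0// ltNge leye_eq; apply/negP => /eqP rxy.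
  have := le_integral_slopel mr r0 rd (lexx 0%R) (ltW cx.1) cx.
  rewrite rxy subr0 gt0_muley ?lte_fin ?cx.1//.
  rewrite addey; last by rewrite gt_eqF// (lt_le_trans (ltNyr 0%R))// I0// (le_trans _ xc')// lee_fin ltW// cx.1.
  by rewrite leye_eq => /eqP E; rewrite E in Ix.
have [xy|yx] := leP x y.
  have := le_integral_sloper mr r0 rd cx xy yc.
  rewrite -(fineK Ix) -(fineK Iy) -(fineK rx) -EFinM -EFinD lee_fin /=; lra.
have := le_integral_slopel mr r0 rd y0 (ltW yx) cx.
rewrite -(fineK Ix) -(fineK Iy) -(fineK rx) -EFinM -EFinD lee_fin /=; lra.
Qed.

End primitives.

(** * Step functions on nested families of sets *)

Section nested_steps.
Variable R : realType.
Local Notation m := (@lebesgue_measure R).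

Definition steps (L : nat) (eta : nat -> R) (B : nat -> set R) (x : R) : R :=
  (\sum_(j < L) eta j * \1_(B j) x)%R.

Definition nested (c : \bar R) (B : nat -> set R) :=
  (forall i j, (i <= j)%N -> B j `<=` B i) /\ (forall j, B j `<=` oint c).

Lemma steps_ge0 L eta B x : (forall j, 0 <= eta j)%R -> (0 <= steps L eta B x)%R.
Proof. by move=> e0; apply: sumr_ge0 => j _; rewrite mulr_ge0. Qed.

Lemma sum_ordE (L J : nat) (eta : nat -> R) : (J <= L)%N ->
  (\sum_(i < J) eta i = \sum_(i < L) if (i < J)%N then eta i else 0)%R.
Proof. by move=> JL; rewrite (big_ord_widen _ eta JL) big_mkcond. Qed.

Lemma steps_ge_prefix L (eta : nat -> R) c B J x : (forall j, 0 <= eta j)%R ->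
  nested c B -> (J < L)%N -> B J x ->
  (\sum_(i < J.+1) eta i <= steps L eta B x)%R.
Proof.
move=> e0 [ni _] JL BJx; rewrite (sum_ordE _ JL); apply: ler_sum => i _.
case: ifPn => iJ; last by rewrite mulr_ge0.
by rewrite indicE mem_set ?mulr1//; apply: ni BJx.
Qed.

Lemma steps_le_prefix L (eta : nat -> R) c B J x : (forall j, 0 <= eta j)%R ->
  nested c B -> (J <= L)%N -> (forall j, (J <= j < L)%N -> ~ B j x) ->
  (steps L eta B x <= \sum_(i < J) eta i)%R.
Proof.
move=> e0 [ni _] JL BJx; rewrite (sum_ordE _ JL); apply: ler_sum => i _.
case: ifPn => iJ; first by rewrite indicE ler_piMr// lern1 leq_b1.
rewrite indicE memNset ?mulr0//; apply: BJx.
by rewrite leqNgt iJ/=.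
Qed.

(** [J] is the first index at which the partial sums of [eta] exceed [s]. It is chosen before the
    family, so that step functions with the same coefficients on different families have matching
    superlevel sets; all equimeasurability below rests on this. *)
Lemma superlevel_steps L (eta : nat -> R) (s : R) : (0 <= s)%R ->
  (forall j, 0 <= eta j)%R ->
  (exists2 J, (J < L)%N & forall c B, nested c B ->
      superlevel c (steps L eta B) s = B J) \/
  (forall c B, nested c B -> superlevel c (steps L eta B) s = set0).
Proof.
move=> s0 e0.
have normE B x : `|steps L eta B x|%R = steps L eta B x by rewrite ger0_norm// steps_ge0.
have [ex|nex] := pselect (exists j, (j < L)%N && (s < \sum_(i < j.+1) eta i)%R).
  left; have [J /andP[JL sJ] minJ] := ex_minnP ex.
  exists J => // c B nB; have [ni Bc] := nB; apply/seteqP; split => x.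
    move=> [cx /=]; rewrite normE => sx; apply: contrapT => nBx.
    move: sx; rewrite ltNge => /negP; apply.
    apply: (le_trans (@steps_le_prefix _ _ c _ J _ e0 nB (ltnW JL) _)).
      by move=> j /andP[Jj _]; apply: contra_not nBx; exact: ni.
    case: J JL minJ {sJ nBx} => [_ _|J JL minJ]; first by rewrite big_ord0.
    rewrite leNgt; apply/negP => sJ; have := minJ J.
    by rewrite sJ (ltnW JL) ltnn => /(_ isT).
  move=> BJx; split; first exact: Bc BJx.
  by rewrite /= normE (lt_le_trans sJ)// (steps_ge_prefix e0 nB).
right => c B nB; rewrite -subset0 => x [cx /=]; rewrite normE.
rewrite ltNge => /negP; apply.
apply: (le_trans (@steps_le_prefix _ _ c _ L _ e0 nB (leqnn L) _)).
  by move=> j; lia.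
case: L {normE} nex => [_|L nex]; first by rewrite big_ord0.
by rewrite leNgt; apply/negP => sL; apply: nex; exists L; rewrite ltnSn.
Qed.

Lemma eq_dist_steps mu mu' c c' L (eta : nat -> R) B B' (s : R) : (0 <= s)%R ->
  (forall j, 0 <= eta j)%R -> nested c B -> nested c' B' ->
  mu set0 = mu' set0 -> (forall j, (j < L)%N -> mu (B j) = mu' (B' j)) ->
  dist mu c (steps L eta B) s = dist mu' c' (steps L eta B') s.
Proof.
move=> s0 e0 nB nB' mu0 muB.
have dE (nu : set R -> \bar R) d f : dist nu d f s = nu (superlevel d f s) by [].
rewrite !dE; have [[J JL H]|H] := superlevel_steps L s0 e0.
  by rewrite !H// muB.
by rewrite !H.
Qed.

Lemma nested_oint c (z : nat -> R) : (forall i j, (i <= j)%N -> z j <= z i)%R ->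
  (forall j, (z j)%:E <= c) -> nested c (fun j => oint (z j)%:E).
Proof.
move=> zni zc; split => [i j ij|j]; apply: oint_sub => //.
by rewrite lee_fin zni.
Qed.

Lemma steps_oint_ni L (eta : nat -> R) (z : nat -> R) x y :
  (forall j, 0 <= eta j)%R -> (0 < x)%R -> (x <= y)%R ->
  (steps L eta (fun j => oint (z j)%:E) y <=
   steps L eta (fun j => oint (z j)%:E) x)%R.
Proof.
move=> e0 x0 xy; apply: ler_sum => j _; rewrite ler_wpM2l// !indicE.
have [yz|] := boolP (y \in oint (z j)%:E) => //.
move: yz; rewrite inE => -[_ yz]; rewrite mem_set//; split => //.
by rewrite (le_lt_trans _ yz)// lee_fin.
Qed.

Lemma steps_measurable (D : set R) L (eta : nat -> R) B : measurable D ->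
  (forall j, (j < L)%N -> measurable (B j)) ->
  measurable_fun D (steps L eta B).
Proof.
by move=> mD mB; apply: measurable_steps => // j jL; apply: measurableI => //; exact: mB.
Qed.

Lemma integral_steps_oint (x d : R) L (z : nat -> R) : (0 <= x)%R -> (0 <= d)%R ->
  (forall j, 0 <= z j)%R ->
  \int[m]_(t in oint x%:E) (steps L (fun=> d) (fun j => oint (z j)%:E) t)%:E =
  (steps_int d L z x)%:E.
Proof.
move=> x0 d0 z0; under eq_integral do rewrite -[steps _ _ _ _]mul1r.
rewrite (@integral_steps _ _ (fun=> 1%R) L (fun=> d) (fun j => oint (z j)%:E))//; last first.
  by move=> j _; exact: measurableI.
rewrite /steps_int mulr_sumr -sumEFin; apply: eq_bigr => j _.
rewrite ointI [X in _ * X]integral_cst//= mul1e lebesgue_oint; last by rewrite le_min !lee_fin x0 z0.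
by rewrite -EFin_min EFinM.
Qed.

End nested_steps.

(** * Norming functionals given by decreasing step functions *)

Section fully_symmetric_spaces.
Variables (R : realType) (b : \bar R) (E : fspace R).
Local Notation m := (@lebesgue_measure R).
Hypothesis E_fs : fully_symmetric b E.
Hypothesis E_supp : has_support b E.

Let E_bfs : banach_function_space b E := fs_bfs E_fs.

Lemma indic_oint_in (z : R) : oint b z -> carrier E \1_(oint z%:E).
Proof.
move=> bz; apply: E_supp => //.
- by apply: oint_sub; exact/ltW/bz.2.
- by rewrite lebesgue_oint ?ltry// lee_fin ltW// bz.1.
Qed.

Lemma fnorm_indic_gt0 (z : R) : oint b z -> (0 < fnorm E \1_(oint z%:E))%R.
Proof.
move=> bz; have Ez := indic_oint_in bz.
rewrite lt_def (bfs_norm_ge0 E_bfs Ez) andbT; apply/eqP => n0.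
have [N [mN N0 subN]] := bfs_norm_eq0 E_bfs Ez n0.
have : m (oint z%:E) <= m N.
  apply: le_measure; rewrite ?inE// => x xz; apply: subN => /=.
  move=> /(_ (oint_sub (ltW bz.2) xz)); rewrite indicE mem_set//.
  by apply/eqP; rewrite oner_eq0.
rewrite lebesgue_oint ?lee_fin ?(ltW bz.1)//.
have -> : m N = 0 := N0.
by rewrite leNgt lte_fin bz.1.
Qed.

Lemma norm_in (g : R -> R) : carrier E g ->
  carrier E (fun x => `|g x|)%R /\ fnorm E (fun x => `|g x|)%R = fnorm E g.
Proof.
move=> Eg; have mg := bfs_L0 E_bfs Eg.
have Eg' : carrier E (fun x => `|g x|)%R.
  apply: (bfs_solid E_bfs _ Eg); first by apply: measurableT_comp mg.
  by apply: ae_all => x _; rewrite normr_id.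
split => //; apply/eqP; rewrite eq_le; apply/andP; split.
  by apply: (bfs_norm_mono E_bfs) => //; apply: ae_all => x _; rewrite normr_id.
by apply: (bfs_norm_mono E_bfs) => //; apply: ae_all => x _; rewrite normr_id.
Qed.

(* If the integral were infinite, every function would be submajorized by [g],
   and then all multiples of an indicator would have bounded norms. *)
Lemma integral_rearr_fin (g : R -> R) (x : R) : carrier E g -> oint b x ->
  \int[m]_(t in oint x%:E) rearr m b g t < +oo.
Proof.
move=> Eg bx; rewrite ltNge leye_eq; apply/negP => /eqP xoo.
have mg := bfs_L0 E_bfs Eg; have hm := measure_on_lebesgue b.
have mr := @rearr_measurable R m b b _ hm mg.
have r0 y : oint b y -> 0 <= rearr m b g y by move=> _; exact: rearr_ge0.
have rd y z : oint b y -> oint b z -> (y <= z)%R -> rearr m b g z <= rearr m b g y.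
  by move=> _ _; exact: rearr_ni.
have oo y : oint b y -> \int[m]_(t in oint y%:E) rearr m b g t = +oo.
  move=> yb; have [yx|xy] := leP y x; last first.
    apply/eqP; rewrite -leye_eq -xoo; apply: ge0_integral_sub => //.
    - by apply: measurable_funS mr => //; apply/oint_sub/ltW/yb.2.
    - by apply: oint_sub; rewrite lee_fin ltW.
    - by move=> t _; exact: rearr_ge0.
  have [//|ry] := eqVneq (\int[m]_(t in oint y%:E) rearr m b g t) +oo.
  have Iy : \int[m]_(t in oint y%:E) rearr m b g t < +oo by rewrite ltey.
  have := le_integral_slopel mr r0 rd (lexx 0%R) (ltW yb.1) yb.
  rewrite subr0 => H.
  have ryf : rearr m b g y < +oo.
    rewrite ltNge leye_eq; apply/negP => /eqP E1; move: H.
    rewrite E1 gt0_muley ?lte_fin ?yb.1// addey ?leye_eq ?(negbTE ry)//.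
    by rewrite gt_eqF// (lt_le_trans (ltNyr 0%R))// integral_ge0// => t _; exact: rearr_ge0.
  have := le_integral_sloper mr r0 rd yb yx (ltW bx.2).
  rewrite xoo leye_eq => /eqP E2.
  have := Iy; rewrite ltey => Iy'.
  suff : \int[m]_(t in oint y%:E) rearr m b g t + (x - y)%:E * rearr m b g y < +oo.
    by rewrite E2.
  by rewrite lte_add_pinfty// lte_mul_pinfty// lee_fin subr_ge0.
have le f : L0 b f -> (fnorm E f <= fnorm E g)%R.
  move=> mf; apply: (fs_submaj E_fs mf Eg _).2 => y yb.
  by rewrite oo// leey.
have n0 := fnorm_indic_gt0 bx; have Ex := indic_oint_in bx.
pose k := ((fnorm E g + 1) / fnorm E \1_(oint x%:E))%R.
have g0 := bfs_norm_ge0 E_bfs Eg.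
have k0 : (0 <= k)%R by rewrite divr_ge0// ?ltW// ltr_wpDl.
have mk : L0 b (fun t => k * \1_(oint x%:E) t)%R.
  by apply: measurable_funM => //; exact: measurable_indic.
have := le _ mk.
rewrite (bfs_normZ E_bfs _ Ex) ger0_norm// divfK ?gt_eqF//; lra.
Qed.

Lemma integral_norm_le_rearr (g : R -> R) (x : R) : L0 b g -> (0 <= x)%R -> x%:E <= b ->
  \int[m]_(t in oint x%:E) `|g t|%:E <=
  \int[m]_(t in oint x%:E) rearr m b g t.
Proof.
move=> mg x0 xb.
have := le_integral_rearr (has_density_lebesgue b) mg (oint_measurable x%:E) (oint_sub xb).
by rewrite lebesgue_oint ?lee_fin//; under eq_integral do rewrite mulr1.
Qed.

Lemma integral_norm_fin (g : R -> R) (x : R) : carrier E g -> oint b x ->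
  \int[m]_(t in oint x%:E) `|g t|%:E < +oo.
Proof.
move=> Eg bx; apply: le_lt_trans (integral_rearr_fin Eg bx).
apply: integral_norm_le_rearr; [exact: bfs_L0 Eg|exact/ltW/bx.1|exact/ltW/bx.2].
Qed.

Section norming.
Variables (d : R) (L : nat) (z : nat -> R) (Z : R).
Hypotheses (d0 : (0 < d)%R) (bZ : oint b Z).
Hypotheses (z0 : forall j, (0 <= z j)%R) (zZ : forall j, (z j <= Z)%R).
Hypothesis zni : forall i j, (i <= j)%N -> (z j <= z i)%R.

Let phi := steps L (fun=> d) (fun j => oint (z j)%:E).

Let phi_ge0 t : (0 <= phi t)%R.
Proof. by apply: steps_ge0 => _; exact: ltW. Qed.

Lemma steps_in : carrier E phi.
Proof.
rewrite /phi /steps; elim: L => [|K IH].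
  under eq_fun do rewrite big_ord0; exact: (bfs_0 E_bfs).
under eq_fun do rewrite big_ord_recr/=.
apply: (bfs_D E_bfs) => //; apply: (bfs_Z E_bfs).
have := z0 K; rewrite le_eqVlt => /predU1P[<-|zK].
  apply: (bfs_solid E_bfs _ (bfs_0 E_bfs)).
    exact: measurable_indic.
  apply: ae_all => x _; rewrite indicE memNset ?normr0//.
  by move=> [/lt_trans H /H]; rewrite ltxx.
apply: indic_oint_in; split => //.
by rewrite (le_lt_trans _ bZ.2)// lee_fin.
Qed.

Lemma ae_rearr_steps :
  {ae m, forall t, oint b t -> rearr m b phi t = (phi t)%:E}.
Proof.
apply: ae_rearr_noninc.
- exact: bfs_L0 steps_in.
- by [].
- by move=> x y [x0 _] _ xy; apply: steps_oint_ni => // j; exact: ltW.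
Qed.

(** The primitive U of the rearrangement of [u] is concave, so by [steps_int_neighbour] the step
    integral minus U is dominated by its values at break points. There U is bounded below by the
    integral of |u|. *)
Lemma steps_submaj u : carrier E u ->
  (forall j, (j < L)%N -> (steps_int d L z (z j))%:E <=
     \int[m]_(t in oint (z j)%:E) `|u t|%:E) -> submaj b phi u.
Proof.
move=> Eu le x bx; have mu := bfs_L0 E_bfs Eu.
have hm := measure_on_lebesgue b.
have mr := @rearr_measurable R m b b _ hm mu.
have xb := ltW bx.2.
have -> : \int[m]_(t in oint x%:E) rearr m b phi t = (steps_int d L z x)%:E.
  rewrite -integral_steps_oint ?(ltW bx.1) ?(ltW d0)//.
  apply: ge0_ae_eq_integral => //.
  - apply: measurable_funS (oint_sub xb) (@rearr_measurable R m b b _ hm _) => //.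
    exact: bfs_L0 steps_in.
  - by apply/measurable_EFinP; exact: steps_measurable.
  - by move=> t _; exact: rearr_ge0.
  - by move=> t _; rewrite lee_fin.
  - apply: ae_imp ae_rearr_steps => t H xt; apply: H.
    exact: oint_sub xt.
pose U y := fine (\int[m]_(t in oint y%:E) rearr m b u t).
have UE y : oint b y -> (U y)%:E = \int[m]_(t in oint y%:E) rearr m b u t.
  move=> yb; rewrite fineK// ge0_fin_numE ?integral_rearr_fin//.
  by apply: integral_ge0 => t _; exact: rearr_ge0.
have U0 : U 0%R = 0%R.
  by rewrite /U (_ : oint 0 = set0) ?integral_set0// -subset0 => t [/lt_trans H /H]; rewrite ltxx.
have cU : concave_slope b U (fine \o rearr m b u).
  apply: concave_slope_primitive => //.
  - by move=> y _; exact: rearr_ge0.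
  - by move=> y y' _ _; exact: rearr_ni.
  - by move=> y; exact: integral_rearr_fin.
rewrite -UE// lee_fin.
have pts p : step_pt L z p -> (steps_int d L z p <= U p)%R.
  have s0 : (steps_int d L z 0 <= U 0)%R.
    rewrite U0 /steps_int big1 ?mulr0// => j _.
    by rewrite min_l.
  move=> [->//|[j jL ->]]; have := z0 j; rewrite le_eqVlt => /predU1P[<-//|zj].
  have bzj : oint b (z j) by split => //; rewrite (le_lt_trans _ bZ.2)// lee_fin.
  rewrite -lee_fin UE// (le_trans (le _ jL))//.
  by apply: integral_norm_le_rearr => //; exact/ltW/bzj.2.
have zdom j : (j < L)%N -> odom b (z j).
  by move=> _; apply: odom_le (z0 _) (zZ _); right.
have w0 y : oint b y -> (0 <= (fine \o rearr m b u) y)%R.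
  by move=> _; apply: fine_ge0; exact: rearr_ge0.
have [[j [jL _]]|[p [/pts Pp _]]] :=
  steps_int_neighbour d0 ltr01 cU z0 zni zdom w0 (or_intror bx).
  by have := pts _ (or_intror (ex_intro2 _ _ j jL erefl)); lra.
by move=> H _; lra.
Qed.

(** Integrals are only bounded below, which makes [q] monotone. Coordinates with z j = 0 are left
    free, since no integral over an empty interval is positive. *)
Let pos_part_set (V : 'rV[R]_L) : set (R -> R) :=
  [set u | [/\ carrier E u, (forall x, 0 <= u x)%R &
    forall j : 'I_L, (0 < z j)%R ->
      (V ord0 j)%:E <= \int[m]_(x in oint (z j)%:E) (u x)%:E]].

Let q (V : 'rV[R]_L) : R := inf [set fnorm E u | u in pos_part_set V].

Let fnorm0 : fnorm E (fun=> 0%R) = 0%R.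
Proof.
have := bfs_normZ E_bfs 0%R (bfs_0 E_bfs).
by under eq_fun do rewrite mul0r; rewrite normr0 mul0r.
Qed.

Let oint_z (j : nat) : (0 < z j)%R -> oint b (z j).
Proof. by move=> zj; split => //; rewrite (le_lt_trans _ bZ.2)// lee_fin. Qed.

Let q_le V u : pos_part_set V u -> (q V <= fnorm E u)%R.
Proof.
move=> Vu; apply: ge_inf; last by exists u.
by exists 0%R => _ [v [Ev _ _] <-]; exact: (bfs_norm_ge0 E_bfs).
Qed.

(** The multiple t of the indicator of (0, Z) has integral t z_j over (0, z j), and t is large
    enough for all coordinates with z j > 0 at once. *)
Let q_nonempty V : [set fnorm E u | u in pos_part_set V] !=set0.
Proof.
pose t := (\sum_(j < L) `|V ord0 j| / z j)%R.
have t0 : (0 <= t)%R by apply: sumr_ge0 => j _; rewrite divr_ge0.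
exists (fnorm E (fun x => t * \1_(oint Z%:E) x)%R).
exists (fun x => t * \1_(oint Z%:E) x)%R => //; split.
- by apply: (bfs_Z E_bfs); exact: indic_oint_in.
- by move=> x; rewrite mulr_ge0.
- move=> j zj.
  rewrite (@integral_indic R _ _ (fun=> t))//; last exact: measurableI.
  rewrite ointI min_l ?lee_fin// [leRHS]integral_cst//= lebesgue_oint ?lee_fin//.
  rewrite -ler_pdivrMr// /t (bigD1 j)//= -[leLHS]addr0 lerD//.
    by rewrite ler_pM2r ?invr_gt0// ler_norm.
  by apply: sumr_ge0 => i _; rewrite divr_ge0.
Qed.

Let le_q V (k : R) : (forall u, pos_part_set V u -> k <= fnorm E u)%R -> (k <= q V)%R.
Proof. by move=> H; apply: lb_le_inf => // _ [u Vu <-]; exact: H. Qed.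

Let measurable_pos V u (j : nat) : pos_part_set V u -> (0 < z j)%R ->
  measurable_fun (oint (z j)%:E) (fun x => (u x)%:E).
Proof.
move=> [Eu _ _] zj; apply/measurable_EFinP.
apply: (measurable_funS (oint_measurable b) _ (bfs_L0 E_bfs Eu)).
by apply: oint_sub; exact/ltW/(oint_z zj).2.
Qed.

Let q_sublinear : sublinear q.
Proof.
split.
  move=> V V'; rewrite -lerBlDr; apply: le_q => u Vu.
  rewrite lerBlDr [leRHS]addrC -lerBlDr; apply: le_q => u' Vu'.
  have [Eu u0 uV] := Vu; have [Eu' u'0 u'V] := Vu'.
  rewrite lerBlDr [leRHS]addrC; apply: le_trans (bfs_normD E_bfs Eu Eu').
  apply: q_le; split; first exact: (bfs_D E_bfs).
    by move=> x; rewrite addr_ge0.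
  move=> j zj; under eq_integral do rewrite EFinD.
  rewrite ge0_integralD//.
  - by rewrite mxE EFinD leeD// ?uV// u'V.
  - by move=> x _; rewrite lee_fin.
  - exact: measurable_pos Vu _.
  - by move=> x _; rewrite lee_fin.
  - exact: measurable_pos Vu' _.
move=> t V t0; rewrite -ler_pdivrMl//; apply: le_q => u Vu.
have [Eu u0 uV] := Vu.
have nE : (t * fnorm E u = fnorm E (fun x => t * u x))%R.
  by rewrite (bfs_normZ E_bfs _ Eu) gtr0_norm.
rewrite ler_pdivrMl// nE.
apply: q_le; split; first exact: (bfs_Z E_bfs).
  by move=> x; rewrite mulr_ge0// ltW.
move=> j zj; under eq_integral do rewrite EFinM.
rewrite ge0_integralZl//.
- by rewrite mxE EFinM lee_pmul2l// uV.
- exact: measurable_pos Vu _.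
- by move=> x _; rewrite lee_fin.
- by rewrite lee_fin ltW.
Qed.

(* Hahn-Banach for the seminorm [q] on the vectors of integrals over the
   intervals [(0, z j)]: since [q] is monotone, the coefficients are
   nonnegative, so that the functional is given by a decreasing function. *)
Lemma norming_functional : exists eta : nat -> R, [/\ (forall j, 0 <= eta j)%R,
  (forall g, carrier E g -> \sum_(j < L) (eta j)%:E *
     \int[m]_(t in oint (z j)%:E) `|g t|%:E <= (fnorm E g)%:E) &
  (fnorm E phi <= \sum_(j < L) eta j * steps_int d L z (z j))%R].
Proof.
pose V := (\row_j steps_int d L z (z j))%R : 'rV[R]_L.
have [eta [eta_q q_eta]] := finite_hahn_banach V q_sublinear.
pose e j := if insub j is Some i then eta i else 0%R.
have eE (i : 'I_L) : e i = eta i by rewrite /e valK.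
(* The zero function competes for the negative of a basis vector, so [q] is at most 0 there. *)
have eta0 i : (0 <= eta i)%R.
  have := eta_q (- delta_mx ord0 i)%R.
  rewrite (bigD1 i)//= big1 ?addr0; last first.
    by move=> j ji; rewrite !mxE eqxx (negbTE ji) oppr0 mulr0.
  rewrite !mxE !eqxx mulrN1 lerNl => H; apply: le_trans H.
  rewrite oppr_ge0 -fnorm0; apply: q_le; split; first exact: (bfs_0 E_bfs).
    by [].
  move=> j _; rewrite integral0 !mxE lee_fin.
  by rewrite eqxx; case: (j == i); rewrite ?oppr0// oppr_le0.
exists e; split.
- by move=> j; rewrite /e; case: insub.
- move=> g Eg; have [Eg' <-] := norm_in Eg.
  pose v := (\row_j fine (\int[m]_(t in oint (z j)%:E) `|g t|%:E))%R : 'rV[R]_L.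
  have vE (j : 'I_L) : \int[m]_(t in oint (z j)%:E) `|g t|%:E = (v ord0 j)%:E.
    rewrite mxE fineK// ge0_fin_numE; last by apply: integral_ge0 => t _; rewrite lee_fin.
    have := z0 j; rewrite le_eqVlt => /predU1P[<-|/oint_z].
      by rewrite (_ : oint 0 = set0) ?integral_set0// -subset0 => t [/lt_trans H /H]; rewrite ltxx.
    exact: integral_norm_fin.
  under eq_bigr do rewrite vE eE -EFinM.
  rewrite sumEFin lee_fin (le_trans (eta_q _))//.
  by apply: q_le; split => // j zj; rewrite -vE.
- under eq_bigr do rewrite eE.
  have -> : (\sum_(j < L) eta j * steps_int d L z (z j) =
      \sum_j eta j * V ord0 j)%R by apply: eq_bigr => j _; rewrite mxE.
  (* Every competitor for [V] submajorizes [phi] by [steps_submaj], and full symmetry then bounds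
     the norm of [phi] by [q V]. *)
  apply: le_trans q_eta; apply: le_q => u [Eu u0 uV].
  apply: (fs_submaj E_fs _ Eu _).2; first exact: bfs_L0 steps_in.
  apply: steps_submaj => // j jL.
  under eq_integral do rewrite ger0_norm//.
  have := z0 j; rewrite le_eqVlt => /predU1P[<-|zj].
    rewrite /steps_int big1 ?mulr0; last by move=> i _; rewrite min_l.
    by apply: integral_ge0 => t _; rewrite lee_fin.
  by have := uV (Ordinal jL) zj; rewrite mxE.
Qed.

End norming.
End fully_symmetric_spaces.

(** * Koethe duals *)

Section pointwise_limits.
Variable R : realType.
Local Notation m := (@lebesgue_measure R).

(** The sum of the absolute increments is integrable, hence finite a.e., and the sequence is its own
    telescoping series. *)
Lemma ae_cvg_of_summable (D : set R) (u : nat -> R -> R) (C : R) :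
  measurable D -> (forall n, measurable_fun D (u n)) ->
  (forall n, \sum_(k < n) \int[m]_(x in D) `|u k.+1 x - u k x|%:E <= C%:E) ->
  {ae m, forall x, D x -> cvgn (fun n => u n x)}.
Proof.
move=> mD mu uC.
pose v k x := `|u k.+1 x - u k x|%:E.
have mv k : measurable_fun D (v k).
  apply/measurable_EFinP; apply: measurableT_comp => //.
  exact: measurable_funB.
have v0 k x : D x -> 0 <= v k x by move=> _; rewrite lee_fin.
have s0 x : D x -> 0 <= \sum_(k <oo) v k x.
  by move=> Dx; apply: nneseries_ge0 => k _ _; exact: v0.
have ms : measurable_fun D (fun x => \sum_(k <oo) v k x).
  exact: (@ge0_emeasurable_sum _ _ _ D v xpredT (fun k x Dx _ => v0 k x Dx) (fun k _ => mv k)).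
have si : m.-integrable D (fun x => \sum_(k <oo) v k x).
  apply/integrableP; split => //.
  have -> : \int[m]_(x in D) `|\sum_(k <oo) v k x| =
      \int[m]_(x in D) \sum_(k <oo) v k x.
    by apply: eq_integral => x; rewrite inE => Dx; rewrite gee0_abs// s0.
  rewrite integral_nneseries//; apply: (@le_lt_trans _ _ C%:E); last by rewrite ltry.
  apply: lime_le.
    by apply: is_cvg_nneseries => k _ _; apply: integral_ge0 => x /v0.
  by apply: nearW => n; rewrite big_mkord; exact: uC.
have sfin : {ae m, forall x, D x -> \sum_(k <oo) v k x \is a fin_num}.
  exact: integrable_ae si.
apply: ae_imp sfin => x + Dx => /(_ Dx) sx.
have tc : cvgn (series (telescope (fun n => u n x))).
  apply: normed_cvg; apply: nondecreasing_is_cvgn.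
    by apply: nondecreasing_series => k _ _; exact: normr_ge0.
  exists (fine (\sum_(k <oo) v k x)) => _ [n _ <-].
  rewrite -lee_fin fineK// /series/= -sumEFin.
  rewrite [leRHS](_ : _ = \sum_(k <oo) `|telescope (u ^~ x) k|%:E)//.
  by apply: nneseries_lim_ge => k _ _; rewrite lee_fin.
have -> : (fun n => u n x) = (fun n => u 0%N x + series (telescope (u ^~ x)) n)%R.
  by apply/funext => n; rewrite -(eq_sum_telescope (u ^~ x)).
by apply: is_cvgD => //; exact: is_cvg_cst.
Qed.

Lemma cvgn_EFin (u : nat -> R) (l : R) : u n @[n --> \oo] --> l ->
  (u n)%:E @[n --> \oo] --> l%:E.
Proof. by move=> ul; apply/fine_cvgP; split; [exact: nearW|exact: ul]. Qed.

(** The upper limit is measurable whether or not the sequence converges; where it is infinite,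
    [fine] yields the default value 0. *)
Definition lim_fun (u : nat -> R -> R) (x : R) : R :=
  fine (limn_esup (fun n => (u n x)%:E)).

Lemma lim_fun_measurable (D : set R) u : measurable D ->
  (forall n, measurable_fun D (u n)) -> measurable_fun D (lim_fun u).
Proof.
move=> mD mu; apply: measurableT_comp => //.
by apply: measurable_fun_limn_esup => n; exact/measurable_EFinP.
Qed.

Lemma lim_fun_cvg u x : cvgn (fun n => u n x) -> u n x @[n --> \oo] --> lim_fun u x.
Proof.
move=> /cvg_ex[l ul]; have ule := cvgn_EFin ul.
by rewrite /lim_fun (cvg_limn_einf_sup ule).2.
Qed.

Lemma limn_einf_ge0 (u : nat -> \bar R) : (forall n, 0 <= u n) -> 0 <= limn_einf u.
Proof.
move=> u0; rewrite limn_einf_lim; apply: lime_ge; first exact: is_cvg_einfs.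
by apply: nearW => n; apply: le_ereal_inf_tmp => _ [k _ <-].
Qed.

(** Fatou's lemma. The bound is asked only eventually because Cauchy estimates hold only from some
    index on. *)
Lemma integral_le_of_ae_cvg (D : set R) (h : nat -> R -> R) (l : R -> R) (C : \bar R) :
  measurable D -> (forall n, measurable_fun D (h n)) -> measurable_fun D l ->
  {ae m, forall x, D x -> h n x @[n --> \oo] --> l x} ->
  (\forall n \near \oo, \int[m]_(x in D) `|h n x|%:E <= C) ->
  \int[m]_(x in D) `|l x|%:E <= C.
Proof.
move=> mD mh ml hl hC.
have mh' n : measurable_fun D (fun x => `|h n x|%:E).
  by apply/measurable_EFinP; exact: measurableT_comp.
have ml' : measurable_fun D (fun x => `|l x|%:E).
  by apply/measurable_EFinP; exact: measurableT_comp.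
have minf : measurable_fun D (fun x => limn_einf (fun n => `|h n x|%:E)).
  rewrite (_ : (fun _ => _) = (fun x => - limn_esup (fun n => - `|h n x|%:E))).
    apply: measurableT_comp => //; apply: measurable_fun_limn_esup => n.
    exact: measurableT_comp.
  by apply/funext => x; rewrite -limn_einfN; congr limn_einf; apply/funext => n; rewrite /comp oppeK.
rewrite (_ : \int[m]_(x in D) `|l x|%:E =
    \int[m]_(x in D) limn_einf (fun n => `|h n x|%:E)); last first.
  apply: ge0_ae_eq_integral => //.
  - by move=> x _; apply: limn_einf_ge0 => n; rewrite lee_fin.
  - apply: ae_imp hl => x H Dx; have {H}/cvg_norm H := H Dx.
    have H' : (fun n => `|h n x|%:E) @ \oo --> `|l x|%:E by exact: cvgn_EFin.
    by rewrite (cvg_limn_einf_sup H').1.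
have hfin : \int[m]_(x in D) limn_einf (fun n => `|h n x|%:E) <=
    limn_einf (fun n => \int[m]_(x in D) `|h n x|%:E).
  by apply: fatou => // n x _; rewrite lee_fin.
apply: (le_trans hfin); have [N _ NP] := hC.
rewrite limn_einf_lim; apply: lime_le; first exact: is_cvg_einfs.
apply: nearW => n; apply: ge_ereal_inf.
exists (\int[m]_(x in D) `|h (maxn n N) x|%:E); last exact/NP/leq_maxr.
by exists (maxn n N) => //=; rewrite leq_maxl.
Qed.

End pointwise_limits.

(** * The Koethe dual as a Banach function space with the Fatou property *)

Section koethe_dual.
Variables (R : realType) (c : \bar R) (F : fspace R).
Local Notation m := (@lebesgue_measure R).
Local Notation D := (kothe_dual c F).
Hypothesis F_L0 : carrier F `<=` L0 c.
Hypothesis c0 : 0 < c.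
(** A multiple is placed in the unit ball directly, because no homogeneity is assumed of the gauge
    of [F], which will be that of Lambda. *)
Hypothesis F_indic : forall x, oint c x -> exists t : R, [/\ (0 < t)%R,
  carrier F (fun y => t * \1_(oint x%:E) y)%R &
  (fnorm F (fun y => t * \1_(oint x%:E) y) <= 1)%R].
Hypothesis D_indic : forall x, oint c x -> carrier D \1_(oint x%:E).

Lemma kothe_gauge_le f (K : \bar R) : kothe_gauge c F f <= K <->
  forall g, carrier F g -> (fnorm F g <= 1)%R ->
    \int[m]_(x in oint c) `|f x * g x|%:E <= K.
Proof.
split => [fK g Fg g1|H].
  by apply: le_trans fK; apply: ereal_sup_ubound; exists g.
by apply: ge_ereal_sup => _ [g [Fg g1] <-]; exact: H.
Qed.

(** The unit ball is nonempty, so the supremum is not -oo. *)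
Lemma kothe_gauge_ge0 f : 0 <= kothe_gauge c F f.
Proof.
have [t [_ Ft t1]] := F_indic (oexh_oint 0 c0).
apply: (@le_trans _ _ (\int[m]_(x in oint c) `|f x * (t * \1_(oint (oexh c 0)%:E) x)|%:E)).
  by apply: integral_ge0 => x _; rewrite lee_fin.
by apply: ereal_sup_ubound; eexists; [split; [exact: Ft|exact: t1]|].
Qed.

Lemma kothe_fnormE f : carrier D f -> (fnorm D f)%:E = kothe_gauge c F f.
Proof. by move=> [_ fin]; rewrite fineK// ge0_fin_numE// kothe_gauge_ge0. Qed.

Lemma kothe_fnorm_ge0 f : (0 <= fnorm D f)%R.
Proof. by apply: fine_ge0; exact: kothe_gauge_ge0. Qed.

Lemma kothe_le f g : carrier D f -> carrier F g -> (fnorm F g <= 1)%R ->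
  \int[m]_(x in oint c) `|f x * g x|%:E <= (fnorm D f)%:E.
Proof. by move=> Df; rewrite kothe_fnormE//; exact: (kothe_gauge_le f _).1. Qed.

Lemma kothe_mem f (K : R) : L0 c f ->
  (forall g, carrier F g -> (fnorm F g <= 1)%R ->
    \int[m]_(x in oint c) `|f x * g x|%:E <= K%:E) ->
  carrier D f /\ (fnorm D f <= K)%R.
Proof.
move=> mf /kothe_gauge_le fK.
have Df : carrier D f by split => //; rewrite (le_lt_trans fK)// ltry.
by split => //; rewrite -lee_fin kothe_fnormE.
Qed.

Let prod_measurable f g : L0 c f -> carrier F g ->
  measurable_fun (oint c) (fun x => `|f x * g x|%:E).
Proof.
move=> mf /F_L0 mg; apply/measurable_EFinP; apply: measurableT_comp => //.
exact: measurable_funM.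
Qed.

Lemma kothe_mono f g (k : R) : (0 <= k)%R -> L0 c f -> carrier D g ->
  {ae m, forall x, oint c x -> (`|f x| <= k * `|g x|)%R} ->
  carrier D f /\ (fnorm D f <= k * fnorm D g)%R.
Proof.
move=> k0 mf Dg fg; apply: kothe_mem => // h Fh h1.
apply: (@le_trans _ _ (\int[m]_(x in oint c) (k%:E * `|g x * h x|%:E))).
  apply: ae_ge0_le_integral => //.
  - exact: (prod_measurable mf Fh).
  - by move=> x _; rewrite mule_ge0 ?lee_fin.
  - by apply: emeasurable_funM => //; exact: (prod_measurable Dg.1 Fh).
  - apply: ae_imp fg => x H cx; rewrite -EFinM lee_fin !normrM mulrA.
    by rewrite ler_wpM2r// H.
rewrite ge0_integralZl//.
- by rewrite EFinM lee_wpmul2l ?lee_fin// kothe_le.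
- exact: (prod_measurable Dg.1 Fh).
Qed.

Lemma kothe_D f g : carrier D f -> carrier D g ->
  carrier D (fun x => f x + g x)%R /\
  (fnorm D (fun x => f x + g x) <= fnorm D f + fnorm D g)%R.
Proof.
move=> Df Dg; apply: kothe_mem.
  by apply: measurable_funD; [exact: Df.1|exact: Dg.1].
move=> h Fh h1; rewrite EFinD.
apply: (@le_trans _ _ (\int[m]_(x in oint c) (`|f x * h x|%:E + `|g x * h x|%:E))).
  apply: ge0_le_integral => //.
  - have mfg : L0 c (fun x => f x + g x)%R by apply: measurable_funD; [exact: Df.1|exact: Dg.1].
    exact: (prod_measurable mfg Fh).
  - by apply: emeasurable_funD; [exact: (prod_measurable Df.1 Fh)|exact: (prod_measurable Dg.1 Fh)].
  - by move=> x _; rewrite -EFinD lee_fin mulrDl ler_normD.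
rewrite ge0_integralD//.
- by rewrite leeD// kothe_le.
- exact: (prod_measurable Df.1 Fh).
- exact: (prod_measurable Dg.1 Fh).
Qed.

Lemma kothe_Z (k : R) f : carrier D f -> carrier D (fun x => k * f x)%R /\
  fnorm D (fun x => k * f x)%R = (`|k| * fnorm D f)%R.
Proof.
have H (k' : R) g : carrier D g -> carrier D (fun x => k' * g x)%R /\
    (fnorm D (fun x => k' * g x) <= `|k'| * fnorm D g)%R.
  move=> Dg; apply: kothe_mono => //.
    by apply: measurable_funM => //; exact: Dg.1.
  by apply: ae_all => x _; rewrite normrM.
move=> Df; have [Dk le] := H k f Df; split => //.
apply/eqP; rewrite eq_le le/=.
have [->|k0] := eqVneq k 0%R; first by rewrite normr0 mul0r kothe_fnorm_ge0.
have [_] := H k^-1%R _ Dk.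
under eq_fun do rewrite mulrA mulVf// mul1r.
by rewrite normfV ler_pdivlMl ?normr_gt0.
Qed.

Lemma kothe_ae_lim (f_ : nat -> R -> R) f (K : R) :
  (forall n, carrier D (f_ n)) -> L0 c f ->
  {ae m, forall x, oint c x -> f_ n x @[n --> \oo] --> f x} ->
  (\forall n \near \oo, (fnorm D (f_ n) <= K)%R) ->
  carrier D f /\ (fnorm D f <= K)%R.
Proof.
move=> Df mf ff fK; apply: kothe_mem => // g Fg g1.
apply: (@integral_le_of_ae_cvg _ _ (fun n x => f_ n x * g x)%R) => //.
- by move=> n; apply: measurable_funM; [exact: (Df n).1|exact: F_L0].
- by apply: measurable_funM => //; exact: F_L0.
- apply: ae_imp ff => x H cx; apply: cvgM; [exact: H|exact: cvg_cst].
- apply: filterS fK => n fnK; apply: (le_trans (kothe_le (Df n) Fg g1)).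
  by rewrite lee_fin.
Qed.

Lemma ae_oexh (P : R -> Prop) :
  (forall n, {ae m, forall x, oint (oexh c n)%:E x -> P x}) ->
  {ae m, forall x, oint c x -> P x}.
Proof.
move=> H; have : {ae m, forall x, forall n, oint (oexh c n)%:E x -> P x} by exact: ae_foralln.
apply: ae_imp => x Px cx; have [n xn] := oexh_lt cx.
by apply: (Px n); split; [exact: cx.1|rewrite lte_fin].
Qed.

(** Testing against the multiple of the indicator in the unit ball controls the L^1 norm on (0,
    x). *)
Lemma kothe_local (x : R) : oint c x -> exists2 C : R, (0 <= C)%R &
  forall f, carrier D f ->
    \int[m]_(y in oint x%:E) `|f y|%:E <= (C * fnorm D f)%:E.
Proof.
move=> cx; have [t [t0 Ft t1]] := F_indic cx.
exists t^-1%R; first by rewrite invr_ge0 ltW.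
move=> f Df; have := kothe_le Df Ft t1.
have -> : \int[m]_(y in oint c) `|f y * (t * \1_(oint x%:E) y)|%:E =
    t%:E * \int[m]_(y in oint x%:E) `|f y|%:E.
  have mf : measurable_fun (oint c) (fun y => `|f y|%R).
    by apply: measurableT_comp => //; exact: Df.1.
  transitivity (\int[m]_(y in oint c) ((t * `|f y|) * \1_(oint x%:E) y)%:E).
    apply: eq_integral => y _; congr EFin.
    rewrite !normrM (gtr0_norm t0) mulrCA mulrA; congr (_ * _)%R.
    by rewrite indicE ger0_norm.
  rewrite (@integral_indic R _ _ (fun y => t * `|f y|)%R)//; last exact: measurableI.
  rewrite ointIl ?ltW ?cx.2//.
  under eq_integral do rewrite EFinM.
  rewrite ge0_integralZl//.
  - apply/measurable_EFinP; apply: measurable_funS mf => //.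
    by apply: oint_sub; exact/ltW/cx.2.
  - by rewrite lee_fin ltW.
move=> H; rewrite EFinM.
by rewrite -lee_pdivrMl// ?invr_gt0// invrK.
Qed.

(** Riesz-Fischer: along a fast subsequence the local L^1 bounds give an a.e. limit, and lower
    semicontinuity of the dual norm, [kothe_ae_lim], turns the Cauchy condition into norm
    convergence. *)
Lemma kothe_complete (f_ : nat -> R -> R) : (forall n, carrier D (f_ n)) ->
  (forall e : R, (0 < e)%R -> exists N : nat, forall p q : nat,
    (N <= p)%N -> (N <= q)%N -> (fnorm D (fun x => f_ p x - f_ q x) < e)%R) ->
  exists2 f, carrier D f &
    fnorm D (fun x => f_ n x - f x)%R @[n --> \oo] --> (0%R : R).
Proof.
move=> Df cauchy.
have [N NP] : {N : nat -> nat & forall k p q, (N k <= p)%N -> (N k <= q)%N ->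
    (fnorm D (fun x => f_ p x - f_ q x) < 2 ^- k)%R}.
  apply: (@choice _ _ (fun k n => forall p q, (n <= p)%N -> (n <= q)%N ->
    (fnorm D (fun x => f_ p x - f_ q x) < 2 ^- k)%R)) => k.
  by apply: cauchy; rewrite invr_gt0 exprn_gt0.
(* Summing makes [n l] at least [N k] for every k <= l, although [N] itself need not increase. *)
pose n k := (\sum_(i < k.+1) N i)%N.
have nd k l : (k <= l)%N -> (N k <= n l)%N.
  move=> kl; rewrite /n (bigD1 (Ordinal (_ : (k < l.+1)%N)))//=.
  exact: leq_addr.
have D_B p q : carrier D (fun x => f_ p x - f_ q x)%R.
  have := (kothe_D (Df p) (kothe_Z (-1) (Df q)).1).1.
  by under eq_fun do rewrite mulN1r.
pose u k := f_ (n k).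
have mu x k : oint c x -> measurable_fun (oint x%:E) (u k).
  move=> cx; apply: (measurable_funS (oint_measurable c) _ (Df _).1).
  exact/oint_sub/ltW/cx.2.
have cvu : {ae m, forall x, oint c x -> cvgn (fun k => u k x)}.
  apply: ae_oexh => i; have ci := oexh_oint i c0.
  have [C C0 HC] := kothe_local ci.
  (* The factor 2 bounds the partial sums of 2^-k. *)
  apply: (@ae_cvg_of_summable _ _ u (C * 2)%R) => //.
    by move=> k; exact: mu.
  move=> l; apply: (@le_trans _ _ (\sum_(k < l) (C * 2 ^- k)%:E)).
    apply: lee_sum => k _; apply: (le_trans (HC _ (D_B _ _))).
    rewrite lee_fin ler_wpM2l// ltW// NP//; exact: nd.
  rewrite sumEFin lee_fin -mulr_sumr ler_wpM2l//.
  suff -> : (\sum_(k < l) 2 ^- k = 2 - 2 * 2 ^- l :> R)%R.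
    by rewrite lerBlDr lerDl mulr_ge0// invr_ge0 exprn_ge0.
  elim: l => [|l IH]; first by rewrite big_ord0 expr0 invr1; lra.
  rewrite big_ord_recr/= IH exprS invfM; lra.
pose f := lim_fun u.
have mf : L0 c f by apply: lim_fun_measurable => // k; exact: (Df _).1.
have uf : {ae m, forall x, oint c x -> u k x @[k --> \oo] --> f x}.
  by apply: ae_imp cvu => x H cx; apply: lim_fun_cvg; exact: H.
have close k p : (N k <= p)%N -> carrier D (fun x => f_ p x - f x)%R /\
    (fnorm D (fun x => f_ p x - f x) <= 2 ^- k)%R.
  move=> kp; apply: (@kothe_ae_lim (fun l x => f_ p x - u l x)%R).
  - by move=> l; exact: D_B.
  - by apply: measurable_funB => //; exact: (Df _).1.
  - apply: ae_imp uf => x H cx; apply: cvgB; [exact: cvg_cst|exact: H].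
  - exists k => // l /= kl; apply: ltW; apply: NP => //; exact: nd.
have Dff : carrier D f.
  have [H _] := close 0%N (N 0%N) (leqnn _).
  have := (kothe_D (Df (N 0%N)) (kothe_Z (-1) H).1).1.
  by under eq_fun do rewrite mulN1r opprB addrC subrK.
exists f => //; apply/cvgrPdist_lt => e e0.
have [k kP] := expr2V_small e0.
exists (N k) => // p /= kp; rewrite sub0r normrN ger0_norm ?kothe_fnorm_ge0//.
by rewrite (le_lt_trans (close k p kp).2)// kP.
Qed.

Lemma kothe_bfs : banach_function_space c D.
Proof.
have D0 : carrier D (fun=> 0%R).
  apply: (@kothe_mem (fun=> 0%R) 0%R _ _).1; first exact: measurable_cst.
  move=> g _ _; rewrite integral0_eq// => x _.
  by rewrite mul0r normr0.
split.
- by move=> f [].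
- exact: D0.
- by move=> f g Df Dg; exact: (kothe_D Df Dg).1.
- by move=> k f Df; exact: (kothe_Z k Df).1.
- move=> f g mf Dg fg; apply: (@kothe_mono f g 1 ler01 mf Dg _).1.
  by apply: ae_imp fg => x H cx; rewrite mul1r H.
- move=> A mA Ac H.
  have HA n : {ae m, forall x, A x -> \1_(oint (oexh c n)%:E) x = 0%R :> R}.
    by apply: H; apply: D_indic; exact: oexh_oint.
  have : {ae m, forall x, ~ A x}.
    have : {ae m, forall x, forall n, A x -> \1_(oint (oexh c n)%:E) x = 0%R :> R}.
      exact: ae_foralln.
    apply: ae_imp => x Hx Ax; have [n xn] := oexh_lt (Ac _ Ax).
    have := Hx n Ax; rewrite indicE mem_set; first by move/eqP; rewrite oner_eq0.
    by split; [exact: (Ac _ Ax).1|rewrite lte_fin].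
  move=> [N [mN N0 AN]]; apply/eqP; rewrite eq_le measure_ge0 andbT.
  have mAN : m A <= m N.
    by apply: le_measure; rewrite ?inE// => x Ax; apply: AN => /=; apply.
  apply: le_trans mAN _; by have -> : m N = 0 := N0.
- by move=> f _; exact: kothe_fnorm_ge0.
- move=> f Df f0; apply: ae_oexh => n.
  have [C C0 HC] := kothe_local (oexh_oint n c0).
  have mf : measurable_fun (oint (oexh c n)%:E) (EFin \o f).
    apply/measurable_EFinP; apply: (measurable_funS (oint_measurable c) _ Df.1).
    exact/oint_sub/ltW/(oexh_oint n c0).2.
  have : \int[m]_(x in oint (oexh c n)%:E) `|(EFin \o f) x| = 0.
    apply/eqP; rewrite eq_le integral_ge0// andbT.
    by have := HC f Df; rewrite f0 mulr0.
  move=> int0.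
  have H : {ae m, forall x, oint (oexh c n)%:E x -> (f x)%:E = 0}.
    suff : ae_eq (@lebesgue_measure R) (oint (oexh c n)%:E) (EFin \o f) (cst 0) by [].
    by apply/ae_eq_integral_abs.
  by apply: ae_imp H => x H cx; have [] := H cx.
- by move=> f g Df Dg; exact: (kothe_D Df Dg).2.
- by move=> k f Df; exact: (kothe_Z k Df).2.
- move=> f g Df Dg fg; have := @kothe_mono f g 1 ler01 Df.1 Dg.
  rewrite mul1r => H; apply: (H _).2.
  by apply: ae_imp fg => x Hx cx; rewrite mul1r Hx.
- exact: kothe_complete.
Qed.

Lemma kothe_fatou : fatou_property c D.
Proof.
split; first exact: kothe_bfs.
move=> f_ f Df mf ff [C fC].
have mono (g h : R -> R) : carrier D g -> carrier D h ->
    {ae m, forall x, oint c x -> (`|g x| <= `|h x|)%R} -> (fnorm D g <= fnorm D h)%R.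
  by move=> Dg Dh; exact: (bfs_norm_mono kothe_bfs).
have nd : nondecreasing_seq (fun n => fnorm D (f_ n)).
  move=> n p np; apply: mono => //; apply: ae_imp ff => x H cx.
  by have [f0 fnd _] := H cx; rewrite !ger0_norm// fnd.
have ub : has_ubound (range (fun n => fnorm D (f_ n))) by exists C => _ [n _ <-].
have cv := nondecreasing_cvgn nd ub.
have ff' : {ae m, forall x, oint c x -> f_ n x @[n --> \oo] --> f x}.
  by apply: ae_imp ff => x H cx; have [_ _] := H cx.
have [Df_ fle] : carrier D f /\ (fnorm D f <= sup (range (fun n => fnorm D (f_ n))))%R.
  apply: (kothe_ae_lim Df mf ff'); apply: nearW => n.
  by apply: ub_le_sup => //; exists n.
split => //.
suff -> : fnorm D f = sup (range (fun n => fnorm D (f_ n))) by [].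
apply/eqP; rewrite eq_le fle/=; apply: ge_sup; first by exists (fnorm D (f_ 0%N)); exists 0%N.
move=> _ [n _ <-]; apply: mono => //; apply: ae_imp ff => x H cx.
have [f0 fnd fx] := H cx.
have le : (f_ n x <= f x)%R.
  rewrite -(cvg_lim _ fx)//; apply: nondecreasing_cvgn_le => //.
  by apply/cvg_ex; exists (f x).
by rewrite !ger0_norm// (le_trans (f0 n)).
Qed.

End koethe_dual.

(** * Weights and transfer of norms *)

Section ae_invariance.
Variable R : realType.
Local Notation m := (@lebesgue_measure R).

(** All that the transfer of norms asks of the target space. It covers both E, as a Banach function
    space, and E', as a bare Koethe dual. *)
Definition ae_invariant (c : \bar R) (F : fspace R) := forall f g,
  L0 c f -> carrier F g ->
  {ae m, forall x, oint c x -> `|f x|%R = `|g x|%R} ->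
  carrier F f /\ fnorm F f = fnorm F g.

Lemma bfs_ae_invariant c F : banach_function_space c F -> ae_invariant c F.
Proof.
move=> bfs f g mf Fg fg.
have le : {ae m, forall x, oint c x -> (`|f x| <= `|g x|)%R}.
  by apply: ae_imp fg => x H cx; rewrite H.
have ge : {ae m, forall x, oint c x -> (`|g x| <= `|f x|)%R}.
  by apply: ae_imp fg => x H cx; rewrite H.
have Ff := bfs_solid bfs mf Fg le.
split => //; apply/eqP; rewrite eq_le.
by rewrite (bfs_norm_mono bfs Ff Fg le) (bfs_norm_mono bfs Fg Ff ge).
Qed.

Lemma kothe_ae_invariant c F : carrier F `<=` L0 c ->
  ae_invariant c (kothe_dual c F).
Proof.
move=> FL f g mf [mg gfin] fg.
suff E : kothe_gauge c F f = kothe_gauge c F g.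
  by split; [split => //; rewrite E|rewrite /= E].
congr ereal_sup; apply/seteqP; split => _ [h [Fh h1] <-]; exists h => //.
  apply: ge0_ae_eq_integral => //.
  - by apply/measurable_EFinP; apply: measurableT_comp => //; apply: measurable_funM => //; exact: FL.
  - by apply/measurable_EFinP; apply: measurableT_comp => //; apply: measurable_funM => //; exact: FL.
  - by apply: ae_imp fg => x H cx; rewrite !normrM H.
apply: ge0_ae_eq_integral => //.
- by apply/measurable_EFinP; apply: measurableT_comp => //; apply: measurable_funM => //; exact: FL.
- by apply/measurable_EFinP; apply: measurableT_comp => //; apply: measurable_funM => //; exact: FL.
- by apply: ae_imp fg => x H cx; rewrite !normrM H.
Qed.

(** Preimages of rays are intervals. *)
Lemma noninc_measurable (c : \bar R) (f : R -> R) :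
  (forall x y, oint c x -> oint c y -> x <= y -> f y <= f x)%R ->
  measurable_fun (oint c) f.
Proof.
move=> fd; apply: (measurability (@RGenCInfty.G R)) => [|/= _ [_] [r] -> <-].
  exact: RGenCInfty.measurableE.
apply: is_interval_measurable => s t /= [[s0 sc]].
rewrite /= in_itv/= andbT => rs [[t0 tc]]; rewrite /= in_itv/= andbT => rt u /andP[su ut].
have cu : oint c u.
  split; first exact: lt_le_trans su.
  by apply: le_lt_trans tc; rewrite lee_fin.
by split => //; rewrite /= in_itv/= andbT (le_trans rt)// fd.
Qed.

Lemma has_density_mono c mu u A B : has_density c mu u ->
  measurable A -> measurable B -> A `<=` oint c -> B `<=` oint c ->
  {ae m, forall x, A x -> B x} -> mu A <= mu B.
Proof.
move=> [mu_ u0 E] mA mB Ac Bc AB; rewrite !E//.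
have mcA : measurable (oint c `&` A) by exact: measurableI.
have mcB : measurable (oint c `&` B) by exact: measurableI.
have IE S : measurable (oint c `&` S) -> S `<=` oint c ->
    \int[m]_(x in S) (u x)%:E = \int[m]_(x in oint c) (u x * \1_S x)%:E.
  by move=> mS Sc; rewrite integral_indic// setIidr.
rewrite !IE//; apply: ae_ge0_le_integral => //.
- by move=> x cx; rewrite lee_fin mulr_ge0// u0.
- by apply/measurable_EFinP; apply: measurable_funM => //; exact: measurable_indicI.
- by move=> x cx; rewrite lee_fin mulr_ge0// u0.
- by apply/measurable_EFinP; apply: measurable_funM => //; exact: measurable_indicI.
- apply: ae_imp AB => x H cx; rewrite lee_fin ler_wpM2l ?u0// !indicE ler_nat.
  by have [/set_mem/H Bx|//] := boolP (x \in A); rewrite mem_set.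
Qed.

End ae_invariance.

(** * Transfer of norms between (0, a) with the measure w dm and (0, b) *)

Section weighted_spaces.
Variables (R : realType) (a b : \bar R) (w : R -> R).
Local Notation m := (@lebesgue_measure R).
Hypothesis a_gt0 : 0 < a.
Hypothesis w_gt0 : forall x, oint a x -> (0 < w x)%R.
Hypothesis w_decr : forall x y, oint a x -> oint a y -> (x <= y)%R -> (w y <= w x)%R.
Hypothesis W_fin : forall t, oint a t -> \int[m]_(x in oint t%:E) (w x)%:E < +oo.
Hypothesis b_def : b = \int[m]_(x in oint a) (w x)%:E.

Local Notation mw := (weighted w).

Lemma weight_measurable : measurable_fun (oint a) w.
Proof. exact: noninc_measurable. Qed.

Lemma weight_density : has_density a mw w.
Proof.
apply: has_density_weighted; first exact: weight_measurable.
by move=> x /w_gt0/ltW.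
Qed.

Lemma weight_measure_on : measure_on a mw.
Proof. exact: density_measure_on weight_density. Qed.

Lemma weighted_total : mw (oint a) = b.
Proof. by rewrite b_def. Qed.

Lemma weighted_le_b A : measurable A -> A `<=` oint a -> mw A <= b.
Proof.
by move=> mA Aa; rewrite -weighted_total; have [_ mono _] := weight_measure_on; exact: mono.
Qed.

Definition prim (t : R) : R := fine (mw (oint t%:E)).

Lemma oint0 : oint (0%R)%:E = set0 :> set R.
Proof. by rewrite -subset0 => t [/lt_trans H /H]; rewrite ltxx. Qed.

Lemma weighted_set0 : mw set0 = 0.
Proof. by rewrite /weighted integral_set0. Qed.

Lemma prim0 : prim 0 = 0%R.
Proof. by rewrite /prim oint0 weighted_set0. Qed.

Lemma weighted_oint_fin t : odom a t -> mw (oint t%:E) \is a fin_num.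
Proof.
move=> [->|ta]; first by rewrite oint0 weighted_set0.
rewrite ge0_fin_numE; first exact: W_fin.
by apply: integral_ge0 => x xt; rewrite lee_fin ltW// w_gt0//; exact: oint_sub (ltW ta.2) _ xt.
Qed.

Lemma primE t : odom a t -> (prim t)%:E = mw (oint t%:E).
Proof. by move=> ta; rewrite fineK// weighted_oint_fin. Qed.

Lemma prim_slope : concave_slope a prim w.
Proof.
apply: (@concave_slope_primitive R a (EFin \o w)).
- by apply/measurable_EFinP; exact: weight_measurable.
- by move=> x /w_gt0/ltW; rewrite lee_fin.
- by move=> x y ax ay xy; rewrite lee_fin w_decr.
- exact: W_fin.
Qed.

Lemma prim_lt x y : odom a x -> odom a y -> (x < y)%R -> (prim x < prim y)%R.
Proof.
move=> ax ay xy; have ay' := odom_oint ay (odom_ge0 ax) xy.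
have := prim_slope (ltW ay'.1) (odom_ge0 ax) ax ay'.
have : (0 < (y - x) * w y)%R by rewrite mulr_gt0 ?subr_gt0// w_gt0.
lra.
Qed.

Lemma prim_le x y : odom a x -> odom a y -> (x <= y)%R -> (prim x <= prim y)%R.
Proof.
by move=> ax ay; rewrite le_eqVlt => /predU1P[->//|/(prim_lt ax ay)/ltW].
Qed.

Lemma prim_ge0 x : odom a x -> (0 <= prim x)%R.
Proof. by move=> ax; rewrite -prim0 prim_le//; [left|exact: odom_ge0 ax]. Qed.

(** Strict because W still increases beyond [x] inside (0, a). *)
Lemma prim_lt_b x : odom a x -> (prim x)%:E < b.
Proof.
move=> ax; have [y [ay xy]] : exists y, oint a y /\ (x < y)%R.
  case: ax => [->|/oexh_lt[n xn]].
    by have H := oexh_oint 0 a_gt0; exists (oexh a 0); split => //; exact: H.1.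
  by exists (oexh a n); split => //; exact: oexh_oint.
have ay' : odom a y by right.
apply: (@lt_le_trans _ _ (prim y)%:E); first by rewrite lte_fin prim_lt.
by rewrite primE// weighted_le_b//; apply: oint_sub; exact/ltW/ay.2.
Qed.

Lemma prim_oint x : oint a x -> oint b (prim x).
Proof.
move=> ax; split; last by apply: prim_lt_b; right.
by rewrite -prim0 prim_lt//; [left|right|case: ax].
Qed.

Lemma b_gt0 : 0 < b.
Proof. by apply: le_lt_trans (prim_lt_b (or_introl erefl)); rewrite prim0. Qed.

Lemma rearr_fine_L0 (mu : set R -> \bar R) c c' f : measure_on c mu -> L0 c f ->
  L0 c' (fine \o rearr mu c f).
Proof.
by move=> hmu mf; apply: measurableT_comp => //; exact: (rearr_measurable hmu mf).
Qed.

Section transfer.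
Variables (F : fspace R) (k phi : R -> R).
Hypothesis F_inv : ae_invariant b F.
Hypotheses (Fphi : carrier F phi) (mphi : L0 b phi).
Hypothesis phi0 : forall y, oint b y -> (0 <= phi y)%R.
Hypothesis phi_ni : forall x y, oint b x -> oint b y -> (x <= y)%R -> (phi y <= phi x)%R.
Hypothesis mk : L0 a k.
Hypothesis k0 : forall y, oint a y -> (0 <= k y)%R.
Hypothesis k_ni : forall x y, oint a x -> oint a y -> (x <= y)%R -> (k y <= k x)%R.
Hypothesis dist_k : forall s, (0 < s)%R -> dist mw a k s = dist m b phi s.

(** Equality of distributions makes the weighted rearrangement of [k] that of [phi], which is [phi]
    itself a.e. In the applications [k] is [phi] composed with W. *)
Lemma sp_w_transfer p : L0 a p ->
  {ae m, forall x, oint a x -> p x = k x} ->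
  [/\ L0 a p, emem b F (rearr mw a p) & fnorm (sp_w a b w F) p = fnorm F phi].
Proof.
move=> mp pk.
have E : rearr mw a p = rearr m b phi.
  rewrite -(eq_rearr dist_k); apply: (ae_eq_rearr weight_density) => //.
  by apply: ae_imp pk => x H ax; rewrite H.
have aeE := ae_rearr_noninc mphi phi0 phi_ni.
have [F1 F2] : carrier F (fine \o rearr m b phi) /\
    fnorm F (fine \o rearr m b phi) = fnorm F phi.
  apply: F_inv => //; first exact: (@rearr_fine_L0 m b b phi (measure_on_lebesgue b) mphi).
  by apply: ae_imp aeE => x H bx; rewrite /= H.
split => //; last by rewrite /= E.
rewrite E; split => //.
by apply: ae_imp aeE => x H bx; rewrite H.
Qed.

Lemma Lambda_transfer h : L0 a h ->
  (forall s, (0 < s)%R -> dist m a h s = dist m a k s) ->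
  carrier (Lambda a b w F) h /\ fnorm (Lambda a b w F) h = fnorm F phi.
Proof.
move=> mh dh; have E := eq_rearr dh.
have aeE := ae_rearr_noninc mk k0 k_ni.
have mr := @rearr_fine_L0 m a a h (measure_on_lebesgue a) mh.
have [] := @sp_w_transfer (fine \o rearr m a h) mr _.
  by apply: ae_imp aeE => x H ax; rewrite /= E H.
move=> _ e1 e2; split => //; split => //; split; last by split.
by apply: ae_imp aeE => x H ax; rewrite E H.
Qed.

(** As a product of decreasing functions, g agrees a.e. with its rearrangement, and division by [w]
    gives back [k]. *)
Lemma M_transfer : let g x := (w x * k x)%R in
  [/\ carrier (Mspace a b w F) g, fnorm (Mspace a b w F) g = fnorm F phi &
    {ae m, forall x, oint a x -> rearr m a g x = (g x)%:E}].
Proof.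
move=> g; have mg : L0 a g by apply: measurable_funM => //; exact: weight_measurable.
have g0 x : oint a x -> (0 <= g x)%R by move=> ax; rewrite mulr_ge0 ?k0// ltW// w_gt0.
have aeE : {ae m, forall x, oint a x -> rearr m a g x = (g x)%:E}.
  apply: ae_rearr_noninc => // x y ax ay xy.
  by rewrite ler_pM ?k0 ?w_decr ?k_ni// ltW// w_gt0.
have pE : {ae m, forall x, oint a x -> rearr m a g x * ((w x)^-1)%:E = (k x)%:E}.
  apply: ae_imp aeE => x H ax; rewrite H// -EFinM /g mulrAC mulfV ?mul1r//.
  by rewrite gt_eqF// w_gt0.
have mp : L0 a (fine \o (fun t => rearr m a g t * ((w t)^-1)%:E)).
  apply: measurableT_comp => //; apply: emeasurable_funM.
    exact: (rearr_measurable (measure_on_lebesgue a) mg).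
  apply/measurable_EFinP.
  (* The reciprocal of [w] increases, so measurability is obtained for its negative. *)
  have : measurable_fun (oint a) (fun x => - (w x)^-1)%R.
    apply: noninc_measurable => x y ax ay xy.
    by rewrite lerN2 lef_pV2 ?posrE ?w_gt0// w_decr.
  by move=> /measurable_funN; apply: eq_measurable_fun => x _ /=; rewrite opprK.
have [] := sp_w_transfer mp _.
  by apply: ae_imp pE => x H ax; rewrite /= H.
move=> _ e1 e2; split => //; split => //; split; last by split.
by apply: ae_imp pE => x H ax; rewrite H.
Qed.

End transfer.
End weighted_spaces.

(** * The inclusion of Q_{E,w} in the dual *)

Section easy_inclusion.
Variables (R : realType) (a b : \bar R) (w : R -> R) (E : fspace R).
Local Notation m := (@lebesgue_measure R).
Hypothesis a_gt0 : 0 < a.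
Hypothesis w_gt0 : forall x, oint a x -> (0 < w x)%R.
Hypothesis w_decr : forall x y, oint a x -> oint a y -> (x <= y)%R -> (w y <= w x)%R.
Hypothesis W_fin : forall t, oint a t -> \int[m]_(x in oint t%:E) (w x)%:E < +oo.
Hypothesis b_def : b = \int[m]_(x in oint a) (w x)%:E.
Hypothesis E_fs : fully_symmetric b E.
Hypothesis E_supp : has_support b E.

Local Notation mw := (weighted w).
Let b0 : 0 < b := b_gt0 a_gt0 w_gt0 w_decr W_fin b_def.
Let wd : has_density a mw w := weight_density w_gt0 w_decr.
Let E_bfs : banach_function_space b E := fs_bfs E_fs.

Lemma E_indic x : oint b x -> exists t : R, [/\ (0 < t)%R,
  carrier E (fun y => t * \1_(oint x%:E) y)%R &
  (fnorm E (fun y => t * \1_(oint x%:E) y) <= 1)%R].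
Proof.
move=> bx; have Ex := indic_oint_in E_supp bx.
have n0 := fnorm_indic_gt0 E_fs E_supp bx.
exists (fnorm E \1_(oint x%:E))^-1%R; split; first by rewrite invr_gt0.
  exact: (bfs_Z E_bfs).
by rewrite (bfs_normZ E_bfs _ Ex) normfV gtr0_norm// mulVf// gt_eqF.
Qed.

(** Normalizing by the norm plus [e] also covers functions of norm 0. *)
Lemma hoelder (phi eta : R -> R) : carrier E phi -> carrier (kothe_dual b E) eta ->
  (fnorm (kothe_dual b E) eta <= 1)%R ->
  \int[m]_(x in oint b) `|eta x * phi x|%:E <= (fnorm E phi)%:E.
Proof.
move=> Ephi Eeta eta1; have mphi := bfs_L0 E_bfs Ephi; have meta := Eeta.1.
have phi0 := bfs_norm_ge0 E_bfs Ephi.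
apply/lee_addgt0Pr => e e0; set k := (fnorm E phi + e)%R.
have k0 : (0 < k)%R by rewrite /k ltr_wpDl.
have H := @kothe_le R b E b0 E_indic eta (fun x => k^-1 * phi x)%R Eeta (bfs_Z E_bfs _ Ephi).
have n1 : (fnorm E (fun x => k^-1 * phi x) <= 1)%R.
  by rewrite (bfs_normZ E_bfs _ Ephi) normfV gtr0_norm// ler_pdivrMl// mulr1 /k lerDl ltW.
have {}H := H n1.
have mp : measurable_fun (oint b) (fun x => `|eta x * (k^-1 * phi x)|%:E).
  apply/measurable_EFinP; apply: measurableT_comp => //; apply: measurable_funM => //.
  exact: measurable_funM.
have -> : \int[m]_(x in oint b) `|eta x * phi x|%:E =
    k%:E * \int[m]_(x in oint b) `|eta x * (k^-1 * phi x)|%:E.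
  rewrite -ge0_integralZl//; last by rewrite lee_fin ltW.
  apply: eq_integral => x _; rewrite -EFinM; congr EFin.
  by rewrite !normrM normfV (gtr0_norm k0) [RHS]mulrCA mulVKf ?gt_eqF//.
rewrite -EFinD -/k -[leRHS]mule1 lee_wpmul2l ?lee_fin ?(ltW k0)//.
by apply: (le_trans H); rewrite lee_fin.
Qed.

(** [submaj] speaks of interior points only, whereas a superlevel set may have measure a; the
    endpoint is reached by exhaustion. *)
Lemma submaj_full (f g : R -> R) (c : \bar R) : L0 a f -> L0 a g -> submaj a f g ->
  0 <= c -> c <= a ->
  \int[m]_(t in oint c) rearr m a f t <= \int[m]_(t in oint c) rearr m a g t.
Proof.
move=> mf mg fg; rewrite le_eqVlt => /predU1P[<-|c0] ca.
  by rewrite oint0 !integral_set0.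
have hm := measure_on_lebesgue a.
have mr (h : R -> R) (d : \bar R) : L0 a h -> measurable_fun (oint d) (rearr m a h).
  by move=> mh; exact: (rearr_measurable hm mh).
have nd : nondecreasing_seq (fun n => oint (oexh c n)%:E : set R).
  move=> n p np; rewrite subsetEset; apply: oint_sub.
  by rewrite lee_fin oexh_nd.
have cv : \int[m]_(t in oint (oexh c n)%:E) rearr m a f t @[n --> \oo] -->
    \int[m]_(t in \bigcup_n oint (oexh c n)%:E) rearr m a f t.
  apply: ge0_nondecreasing_set_cvg_integral => //.
  - by move=> n; exact: mr.
  - by move=> n x _; exact: rearr_ge0.
rewrite bigcup_oexh// in cv.
apply: cvge_to_le cv _; apply: nearW => n.
have cn := oexh_oint n c0.
apply: le_trans (fg _ _) _; first exact: (oint_sub ca).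
apply: ge0_integral_sub => //; first exact: mr.
  by apply: oint_sub; exact/ltW/cn.2.
by move=> x _; exact: rearr_ge0.
Qed.

Lemma integral_prod_le_Mnorm (f g h : R -> R) : L0 a f ->
  carrier (Mspace a b w E) g -> submaj a f g ->
  carrier (Lambda a b w (kothe_dual b E)) h ->
  (fnorm (Lambda a b w (kothe_dual b E)) h <= 1)%R ->
  \int[m]_(x in oint a) `|f x * h x|%:E <= (fnorm (Mspace a b w E) g)%:E.
Proof.
move=> mf [mg [gfin [mp [pfin Ephi]]]] fg [mh [hfin [mh1 [h1fin Eeta]]]] h1.
set p := fine \o (fun t => rearr m a g t * ((w t)^-1)%:E) in mp pfin Ephi.
set phi := fine \o rearr mw a p in Ephi.
set h1' := fine \o rearr m a h in mh1 h1fin Eeta.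
set eta := fine \o rearr mw a h1' in Eeta.
have hm := measure_on_lebesgue a.
have hmw : measure_on a mw := density_measure_on wd.
have mphi : L0 b phi := bfs_L0 E_bfs Ephi.
have meta : L0 b eta := Eeta.1.
apply: le_trans (hoelder Ephi Eeta h1).
have mre : measurable_fun (oint b) (rearr mw a h1') by exact: (rearr_measurable hmw mh1).
apply: (@le_trans _ _ (\int[m]_(x in oint b) (`|phi x|%:E * rearr mw a h1' x))); last first.
  rewrite le_eqVlt; apply/orP; left; apply/eqP; apply: ge0_ae_eq_integral => //.
  - by apply: emeasurable_funM => //; apply/measurable_EFinP; exact: measurableT_comp.
  - apply/measurable_EFinP; apply: measurableT_comp => //; exact: measurable_funM.
  - by move=> x _; rewrite mule_ge0// ?lee_fin// rearr_ge0.
  - apply: ae_imp h1fin => x H bx; have {}H := H bx.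
    rewrite normrM EFinM muleC; congr (_ * _).
    by rewrite /eta /= ger0_norm ?fine_ge0 ?rearr_ge0// fineK.
under eq_integral do rewrite normrM EFinM.
have mfn : measurable_fun (oint a) (fun x => `|f x|%R) by exact: measurableT_comp.
have mhn : measurable_fun (oint a) (fun x => `|h x|%:E).
  by apply/measurable_EFinP; exact: measurableT_comp.
have mphin : measurable_fun (oint b) (fun x => `|phi x|%R) by exact: measurableT_comp.
(* Both integrals are cut into layers of the second factor: superlevel sets of |h| on the left,
   initial intervals of (0, b) on the right. *)
apply: (@le_integral_layers R (oint a) (oint b) (fun x => `|f x|%R) (fun x => `|phi x|%R)) => //.
  by move=> x _; exact: rearr_ge0.
move=> s s0; rewrite rearr_superlevel ?(ltW s0)//.
have mA := superlevel_measurable s mh.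
have -> : oint a `&` [set x | s%:E < `|h x|%:E] = superlevel a h s.
  by apply/seteqP; split => x [ax] /=; rewrite lte_fin.
set A := superlevel a h s in mA *; have Aa : A `<=` oint a := @superlevel_sub _ _ _ _.
have mA0 : 0 <= m A by exact: measure_ge0.
have mAa : m A <= a.
  rewrite -[leRHS](lebesgue_oint (ltW a_gt0)).
  by apply: le_measure; rewrite ?inE.
have HL : \int[m]_(x in A) `|f x|%:E <= \int[m]_(t in oint (m A)) rearr m a f t.
  have := le_integral_rearr (has_density_lebesgue a) mf mA Aa.
  by under eq_integral do rewrite mulr1.
apply: (le_trans HL).
apply: (le_trans (submaj_full mf mg fg mA0 mAa)).
set D := oint (m A); have mD : measurable D by exact: oint_measurable.
have Da : D `<=` oint a by exact: oint_sub.
have mrg : measurable_fun D (rearr m a g) by exact: (rearr_measurable hm mg).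
have mpD : measurable_fun D p by exact: (measurable_funS (oint_measurable a) Da mp).
have mwD : measurable_fun D w.
  exact: (measurable_funS (oint_measurable a) Da (weight_measurable w_decr)).
(* [p] is the rearrangement of [g] divided by [w]; multiplying back gives an integral of |p| with
   respect to w dm. *)
have -> : \int[m]_(t in D) rearr m a g t = \int[m]_(t in D) (`|p t| * w t)%:E.
  apply: ge0_ae_eq_integral => //.
  - apply/measurable_EFinP; apply: measurable_funM => //; exact: measurableT_comp.
  - by move=> x _; exact: rearr_ge0.
  - by move=> x /Da ax; rewrite lee_fin mulr_ge0// ltW// w_gt0.
  - apply: ae_imp gfin => x H Dx; have ax := Da _ Dx; have {}H := H ax.
    have wx := w_gt0 ax; have wx0 : w x != 0%R by rewrite gt_eqF.
    have rE : rearr m a g x = (rearr m a g x * ((w x)^-1)%:E) * (w x)%:E.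
      by rewrite -muleA -EFinM mulVf// mule1.
    rewrite [LHS]rE EFinM; congr (_ * _).
    rewrite -(fineK H) /p /= ger0_norm// fine_ge0// mule_ge0 ?rearr_ge0//.
    by rewrite lee_fin invr_ge0 ltW.
apply: (le_trans (le_integral_rearr wd mp mD Da)).
have mwD0 : 0 <= mw D by have [ge0 _ _] := hmw; exact: ge0.
have Db : mw D <= b by exact: (weighted_le_b w_gt0 w_decr b_def mD Da).
have mwS0 : 0 <= dist mw a h1' s by exact: dist_ge0.
(* (0, m A) lies a.e. in the set where the rearrangement of [h] exceeds [s], so its weighted measure
   is at most that of this set. *)
have DS : mw D <= dist mw a h1' s.
  apply: (has_density_mono wd) => //.
  - exact: superlevel_measurable.
  - apply: ae_imp hfin => x H Dx; have ax := Da _ Dx; have {}H := H ax.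
    split => //=; rewrite /h1' /= ger0_norm ?fine_ge0 ?rearr_ge0//.
    by rewrite -lte_fin fineK// rearr_gt ?(ltW s0)//; exact: Dx.2.
have sub : oint (mw D) `<=` oint (Order.min b (dist mw a h1' s)).
  by apply: oint_sub; rewrite le_min Db.
have subb : oint (mw D) `<=` oint b by exact: oint_sub.
have -> : \int[m]_(t in oint (mw D)) rearr mw a p t =
    \int[m]_(t in oint (mw D)) `|phi t|%:E.
  apply: ge0_ae_eq_integral => //.
  - exact: (rearr_measurable hmw mp).
  - by apply/measurable_EFinP; exact: (measurable_funS (oint_measurable b) subb mphin).
  - by move=> t _; exact: rearr_ge0.
  - apply: ae_imp pfin => x H Dx; have {}H := H (subb _ Dx).
    by rewrite /phi /= ger0_norm ?fine_ge0 ?rearr_ge0// fineK.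
apply: ge0_integral_sub => //.
apply/measurable_EFinP; apply: (measurable_funS (oint_measurable b) _ mphin).
by apply: oint_sub; rewrite ge_min lexx.
Qed.

End easy_inclusion.

(** * The level function *)

Section dyadic_steps.
Variable R : realType.
Local Notation m := (@lebesgue_measure R).

(** For decreasing [Z], a discretization from below of the decreasing function whose superlevel set
    at height s is (0, Z s), cut off at height [N]. *)
Definition dsteps (N n : nat) (Z : R -> R) : R -> R :=
  steps (N * 2 ^ n) (fun=> 2 ^- n)%R (fun j => oint (Z (j.+1%:R * 2 ^- n)%R)%:E).

Lemma dstepsE N n Z y : (0 < y)%R ->
  dsteps N n Z y = dyadic N n (fun s => (y < Z s)%R%:R).
Proof.
move=> y0; rewrite /dsteps /steps /dyadic mulr_sumr; apply: eq_bigr => j _.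
congr *%R; rewrite indicE; congr ((_ : bool)%:R)%R.
apply/idP/idP; rewrite inE; first by case; rewrite lte_fin.
by move=> yZ; split => //; rewrite lte_fin.
Qed.

Lemma dsteps_nd N N' n (Z Z' : R -> R) y : (0 < y)%R -> (N <= N')%N ->
  (forall s, 0 < s -> Z s <= Z' s)%R ->
  (forall s t, 0 < s -> s <= t -> Z' t <= Z' s)%R ->
  (dsteps N n Z y <= dsteps N' n.+1 Z' y)%R.
Proof.
move=> y0 NN ZZ' Zni; rewrite !dstepsE//; apply: dyadic_le => //.
  move=> s s0; rewrite ler_nat; case: (ltP y (Z s)) => // yZ.
  by rewrite (lt_le_trans yZ (ZZ' _ s0)).
move=> s t s0 st; rewrite ler_nat; case: (ltP y (Z' t)) => // yZ.
by rewrite (lt_le_trans yZ)// Zni.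
Qed.

Lemma dsteps_ge0 N n Z y : (0 <= dsteps N n Z y)%R.
Proof. by apply: steps_ge0 => _; rewrite invr_ge0 exprn_ge0. Qed.

Definition dsteps_int (n : nat) (Z : R -> R) : R -> R :=
  steps_int (2 ^- n)%R (n * 2 ^ n) (fun j => Z (j.+1%:R * 2 ^- n)%R).

Lemma dsteps_intB n Z s t : (dsteps_int n Z t - dsteps_int n Z s =
  dyadic n n (fun u => Num.min t (Z u) - Num.min s (Z u)))%R.
Proof. by rewrite /dsteps_int /steps_int /dyadic -mulrBr sumrB. Qed.

(** Increments are compared, as [top_le_F] requires; the growth of min(., p) from s to t increases
    with p. *)
Lemma dsteps_int_nd n (Z Z' : R -> R) (s t : R) : (s <= t)%R ->
  (forall u, 0 < u -> Z u <= Z' u)%R ->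
  (forall u v, 0 < u -> u <= v -> Z' v <= Z' u)%R ->
  (dsteps_int n Z t - dsteps_int n Z s <=
   dsteps_int n.+1 Z' t - dsteps_int n.+1 Z' s)%R.
Proof.
move=> st ZZ' Zni.
have minB (p p' : R) : (p <= p' ->
    Num.min t p - Num.min s p <= Num.min t p' - Num.min s p')%R.
  move=> pp'; rewrite /Num.min.
  by case: (ltP t p); case: (ltP s p); case: (ltP t p'); case: (ltP s p'); lra.
rewrite !dsteps_intB; apply: dyadic_le => // [u|u u0|u v u0 uv].
- rewrite subr_ge0 /Num.min.
  by case: (ltP t (Z' u)); case: (ltP s (Z' u)); lra.
- exact/minB/ZZ'.
- exact/minB/Zni.
Qed.

End dyadic_steps.

Section level_function.
Variables (R : realType) (a b : \bar R) (w : R -> R) (E : fspace R).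
Local Notation m := (@lebesgue_measure R).
Hypothesis a_gt0 : 0 < a.
Hypothesis w_gt0 : forall x, oint a x -> (0 < w x)%R.
Hypothesis w_decr : forall x y, oint a x -> oint a y -> (x <= y)%R -> (w y <= w x)%R.
Hypothesis W_fin : forall t, oint a t -> \int[m]_(x in oint t%:E) (w x)%:E < +oo.
Hypothesis b_def : b = \int[m]_(x in oint a) (w x)%:E.
Hypothesis E_fs : fully_symmetric b E.
Hypothesis E_supp : has_support b E.
Hypothesis E_fatou : fatou_property b E.
Variables (f : R -> R) (K : R).
Hypothesis mf : L0 a f.
Hypothesis fK : forall h, carrier (Lambda a b w (kothe_dual b E)) h ->
  (fnorm (Lambda a b w (kothe_dual b E)) h <= 1)%R ->
  \int[m]_(x in oint a) `|f x * h x|%:E <= K%:E.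

Local Notation mw := (weighted w).
Local Notation W := (prim w).
Local Notation ya := (oexh a).
Let b0 : 0 < b := b_gt0 a_gt0 w_gt0 w_decr W_fin b_def.
Let wd : has_density a mw w := weight_density w_gt0 w_decr.
Let E_bfs : banach_function_space b E := fs_bfs E_fs.

(** The cut at [ya n] makes all measures finite and keeps them inside (0, a). *)
Definition trunc_level (n : nat) (s : R) : set R :=
  superlevel a f s `&` oint (ya n)%:E.

Local Notation A := trunc_level.

Let mA n s : measurable (A n s).
Proof. by apply: measurableI => //; exact: superlevel_measurable. Qed.

Let A_sub n s : A n s `<=` oint (ya n)%:E. Proof. by move=> x []. Qed.

Let A_suba n s : A n s `<=` oint a. Proof. by move=> x [[]]. Qed.

Let A_ni n s t : (s <= t)%R -> A n t `<=` A n s.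
Proof. by move=> st x [xs xn]; split => //; exact: le_superlevel xs. Qed.

Let ya_oint n : oint a (ya n) := oexh_oint n a_gt0.

Definition level_measure (n : nat) (s : R) : R := fine (m (A n s)).

Local Notation X := level_measure.

Let A_le n s : m (A n s) <= (ya n)%:E.
Proof.
rewrite -[leRHS]lebesgue_oint ?lee_fin ?(ltW (ya_oint n).1)//.
by apply: le_measure; rewrite ?inE; [exact: mA|exact: oint_measurable|exact: A_sub].
Qed.

Let XE n s : (X n s)%:E = m (A n s).
Proof.
rewrite fineK// ge0_fin_numE; last exact: measure_ge0.
by rewrite (le_lt_trans (A_le n s))// ltry.
Qed.

Let X_ge0 n s : (0 <= X n s)%R.
Proof. by apply: fine_ge0; exact: measure_ge0. Qed.

Let X_le n s : (X n s <= ya n)%R.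
Proof. by rewrite -lee_fin XE. Qed.

Let X_ni n s t : (s <= t)%R -> (X n t <= X n s)%R.
Proof.
move=> st; rewrite -lee_fin !XE.
by apply: le_measure; rewrite ?inE; [exact: mA|exact: mA|exact: A_ni].
Qed.

Let X_nd n s : (X n s <= X n.+1 s)%R.
Proof.
rewrite -lee_fin !XE; apply: le_measure; rewrite ?inE; [exact: mA|exact: mA|].
move=> x [xs xn]; split => //; apply: oint_sub xn.
by rewrite lee_fin oexh_nd.
Qed.

Let X_dom n s : odom a (X n s).
Proof. by apply: (@odom_le _ _ _ (ya n)) => //; right. Qed.

(** Primitive of a dyadic lower approximation, capped at height [n], to the rearrangement of [f]
    restricted to (0, ya n). *)
Definition trunc_prim (n : nat) : R -> R := dsteps_int n (X n).

Local Notation F := trunc_prim.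

Let pow_gt0 n : (0 < 2 ^- n :> R)%R.
Proof. by rewrite invr_gt0 exprn_gt0. Qed.

Let grid_le n i j : (i <= j)%N -> (i.+1%:R * 2 ^- n <= j.+1%:R * 2 ^- n :> R)%R.
Proof. by move=> ij; rewrite ler_pM2r// ler_nat. Qed.

Let grid_gt0 n j : (0 < j.+1%:R * 2 ^- n :> R)%R.
Proof. by rewrite mulr_gt0. Qed.

Let F0 n : F n 0%R = 0%R.
Proof. by rewrite /F /dsteps_int /steps_int big1 ?mulr0// => j _; rewrite min_l. Qed.

Let tau_exists : exists tau : nat -> R -> R, forall n c, (0 < c)%R ->
  step_pt (n * 2 ^ n) (fun j => X n (j.+1%:R * 2 ^- n)%R) (tau n c) /\
  is_top a (fun x => F n x - c * W x)%R (tau n c).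
Proof.
have H (nc : nat * R) : exists t, (0 < nc.2)%R ->
  step_pt (nc.1 * 2 ^ nc.1) (fun j => X nc.1 (j.+1%:R * 2 ^- nc.1)%R) t /\
  is_top a (fun x => F nc.1 x - nc.2 * W x)%R t.
  case: nc => n c /=; have [c0|c0] := ltP 0%R c; last by exists 0%R.
  have [t t1 t2] := @steps_top R a (2 ^- n)%R (n * 2 ^ n)
    (fun j => X n (j.+1%:R * 2 ^- n)%R) W w c (pow_gt0 n) c0
    (prim_slope w_gt0 w_decr W_fin) (fun j => X_ge0 n _)
    (fun i j ij => X_ni n (grid_le n ij)) (fun j _ => X_dom n _) w_gt0.
  by exists t.
have [t tP] := choice H.
by exists (fun n c => t (n, c)) => n c; exact: (tP (n, c)).
Qed.

Let tau := sval (cid tau_exists).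
Let tauP : forall n c, (0 < c)%R ->
  step_pt (n * 2 ^ n) (fun j => X n (j.+1%:R * 2 ^- n)%R) (tau n c) /\
  is_top a (fun x => F n x - c * W x)%R (tau n c) := svalP (cid tau_exists).

Let tau_ge0 n c : (0 < c)%R -> (0 <= tau n c)%R.
Proof. by move=> /(tauP n)[_ [/odom_ge0]]. Qed.

Let tau_le n c : (0 < c)%R -> (tau n c <= ya n)%R.
Proof.
move=> /(tauP n)[[->|[j _ ->]] _]; [exact/ltW/(ya_oint n).1|exact: X_le].
Qed.

Let tau_dom n c : (0 < c)%R -> odom a (tau n c).
Proof. by move=> /(tauP n)[_ []]. Qed.

Let tau_ni n s t : (0 < s)%R -> (s <= t)%R -> (tau n t <= tau n s)%R.
Proof.
move=> s0 st; have [_ t1] := tauP n s0; have [_ t2] := tauP n (lt_le_trans s0 st).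
by apply: top_le_c st t1 t2 => x y; exact: prim_le.
Qed.

Let tau_nd n s : (0 < s)%R -> (tau n s <= tau n.+1 s)%R.
Proof.
move=> s0; have [_ t1] := tauP n s0; have [_ t2] := tauP n.+1 s0.
apply: top_le_F t1 t2 => x y ax ay xy; apply: dsteps_int_nd => //.
by move=> u v _; exact: X_ni.
Qed.

(* Increasing in [n], and large enough for [0] to be the largest maximum point of
   [F n - c W] when [c >= grid_bound n]. *)
Definition grid_bound (n : nat) : nat :=
  (n + \sum_(i < n.+1) (Num.truncn (i%:R / w (ya i))).+1)%N.

Local Notation N := grid_bound.

Let N_nd n : (N n <= N n.+1)%N.
Proof. by rewrite /N [in leqRHS]big_ord_recr/=; lia. Qed.

Let N_gt0 n : (0 < N n)%N.
Proof. by rewrite /N big_ord_recr/= addnS ltn_addl// addnS. Qed.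

Let N_gt n : (n%:R < (N n)%:R * w (ya n))%R.
Proof.
have wy := w_gt0 (ya_oint n); rewrite -ltr_pdivrMr//.
apply: lt_le_trans (truncnS_gt _) _; by rewrite ler_nat /N big_ord_recr/= addnA leq_addl.
Qed.

Let F_le n x : (0 <= x)%R -> (F n x <= n%:R * Num.min x (ya n))%R.
Proof.
move=> x0; rewrite /F /dsteps_int /steps_int.
apply: (@le_trans _ _ (2 ^- n * \sum_(j < n * 2 ^ n) Num.min x (ya n))%R).
  rewrite ler_pM2l//; apply: ler_sum => j _.
  by rewrite le_min ge_min lexx/= ge_min X_le orbT.
rewrite sumr_const card_ord -[X in (_ * X)%R]mulr_natl mulrA natrM natrX.
by rewrite mulrCA mulVf ?mulr1// expf_neq0.
Qed.

(** The slope of F n is at most n, so for 0 < t <= ya n one has F n t <= n t < N w(ya n) t <= N w(t)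
    t <= N W(t): every such t does worse than 0. *)
Let tau_N n : tau n (N n)%:R = 0%R.
Proof.
have N0 : (0 < (N n)%:R :> R)%R by rewrite ltr0n.
have [_ [ta tP]] := tauP n N0.
have [H _] := tP 0%R (or_introl erefl).
apply/eqP; rewrite eq_le tau_ge0// andbT leNgt; apply/negP => t0.
move: H; rewrite F0 prim0 mulr0 subr0 leNgt => /negP; apply.
set t := tau n _ in t0 ta *.
have t1 : (t <= ya n)%R by exact: tau_le.
have := F_le n (ltW t0); rewrite min_l// => H.
have yd : odom a (ya n) by right.
have := prim_slope w_gt0 w_decr W_fin (ltW t0) (lexx 0%R) (or_introl erefl) (odom_oint ta (lexx _) t0).
rewrite prim0 => H'.
have H2 : (n%:R * t < (N n)%:R * w (ya n) * t)%R by rewrite ltr_pM2r// N_gt.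
have H3 : ((N n)%:R * w (ya n) * t <= (N n)%:R * w t * t)%R.
  rewrite ler_pM2r// ler_pM2l// w_decr//; exact: odom_oint ta (lexx _) t0.
have : ((N n)%:R * (w t * t) <= (N n)%:R * W t)%R by rewrite ler_pM2l//; move: H'; rewrite !sub0r mulNr lerN2 mulrC.
lra.
Qed.

Local Notation q n := (n * 2 ^ n)%N.
Local Notation L n := (N n * 2 ^ n)%N.
Local Notation grid n j := (j.+1%:R * 2 ^- n)%R.

Let minX n s t : m (A n s `&` A n t) = (Num.min (X n s) (X n t))%:E.
Proof.
wlog st : s t / (s <= t)%R => [H|].
  by have [st|/ltW ts] := leP s t; [exact: H|rewrite setIC minC; exact: H].
by rewrite setIidr ?min_r ?XE//; [exact: X_ni|exact: A_ni].
Qed.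

Let trunc_steps_le n x : oint a x ->
  (steps (q n) (fun=> 2 ^- n) (fun j => A n (grid n j)) x <= `|f x|)%R.
Proof.
move=> ax; have -> : steps (q n) (fun=> 2 ^- n)%R (fun j => A n (grid n j)) x =
    dyadic n n (fun s => `[< A n s x >]%:R).
  by rewrite /steps /dyadic mulr_sumr; apply: eq_bigr => j _; congr *%R.
apply: dyadic_nat_le => // t ft; apply/asboolPn => -[[_ /=]].
by rewrite ltNge (ltW ft).
Qed.

(** Level sets are nested, so their intersections have measure min(X_i, X_j). The dyadic lower sum
    of |f| thus integrates over the j-th level set to exactly F(X_j). *)
Let trunc_prim_le n j :
  (F n (X n (grid n j)))%:E <= \int[m]_(x in A n (grid n j)) `|f x|%:E.
Proof.
pose S := steps (q n) (fun=> 2 ^- n)%R (fun j => A n (grid n j)).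
have mS : measurable_fun (A n (grid n j)) S by exact: steps_measurable.
apply: (@le_trans _ _ (\int[m]_(x in A n (grid n j)) (S x)%:E)); last first.
  apply: ge0_le_integral => //.
  - exact: mA.
  - by move=> x _; rewrite lee_fin steps_ge0// => _; exact: ltW.
  - exact/measurable_EFinP.
  - apply/measurable_EFinP; apply: measurableT_comp => //.
    exact: (measurable_funS (oint_measurable a) (@A_suba _ _) mf).
  - by move=> x /A_suba ax; rewrite lee_fin trunc_steps_le.
under eq_integral do rewrite -[S _]mul1r.
have mc : measurable_fun (A n (grid n j)) (fun=> 1%R : R) by [].
rewrite (integral_steps (mA n _) mc (fun _ _ => ler01) (fun _ => ltW (pow_gt0 n))
  (fun i _ => measurableI _ _ (mA n (grid n j)) (mA n (grid n i)))).
rewrite /F /dsteps_int /steps_int mulr_sumr -sumEFin.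
apply: lee_sum => i _; rewrite integral_cst//=; last by apply: measurableI; exact: mA.
by rewrite mul1e minX EFinM.
Qed.

(** For a break point t this is a level set of measure t, or empty when t = 0. Taking a union,
    instead of choosing an index, makes the sets increase with t. *)
Let B n t : set R := \bigcup_(j in [set j | (j < q n)%N /\ (X n (grid n j) <= t)%R])
  A n (grid n j).

Let B_pt n t : step_pt (q n) (fun j => X n (grid n j)) t ->
  (B n t = set0 /\ t = 0%R) \/
  exists i, B n t = A n (grid n i) /\ X n (grid n i) = t.
Proof.
move=> pt; have [ex|nex] := pselect (exists i, (i < q n)%N && (X n (grid n i) <= t)%R).
  right; have [i /andP[iq Xi] mini] := ex_minnP ex.
  have Bi : B n t = A n (grid n i).
    apply/seteqP; split => x; last by move=> Ax; exists i.
    move=> [j [jq Xj] Ax]; apply: A_ni Ax; apply: grid_le; apply: mini.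
    by rewrite jq.
  exists i; split => //; apply/eqP; rewrite eq_le Xi/=.
  case: pt => [->|[j jq tj]]; first exact: X_ge0.
  by rewrite tj X_ni// grid_le// mini// jq tj lexx.
left; split.
  rewrite -subset0 => x [j [jq Xj] _]; apply: nex; exists j; by rewrite jq.
case: pt => // -[j jq tj]; exfalso; apply: nex; exists j.
by rewrite jq tj lexx.
Qed.

Let T n j := tau n (grid n j).

Let T_pt n j : step_pt (q n) (fun j => X n (grid n j)) (T n j).
Proof. exact: (tauP n (grid_gt0 n j)).1. Qed.

Let T_ni n i j : (i <= j)%N -> (T n j <= T n i)%R.
Proof. by move=> ij; apply: tau_ni => //; exact: grid_le. Qed.

Let T_dom n j : odom a (T n j).
Proof. exact: tau_dom. Qed.

Let T_ge0 n j : (0 <= T n j)%R.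
Proof. exact: tau_ge0. Qed.

Let mB n j : measurable (B n (T n j)).
Proof. by have [[-> _]|[i [-> _]]] := B_pt (T_pt n j). Qed.

Let m_B n j : m (B n (T n j)) = (T n j)%:E.
Proof.
have [[-> ->]|[i [-> <-]]] := B_pt (T_pt n j); first by rewrite measure0.
by rewrite XE.
Qed.

Let F_le_B n j : (F n (T n j))%:E <= \int[m]_(x in B n (T n j)) `|f x|%:E.
Proof.
have [[-> ->]|[i [-> <-]]] := B_pt (T_pt n j); last exact: trunc_prim_le.
by rewrite integral_set0 F0.
Qed.

Let nested_B n : nested a (fun j => B n (T n j)).
Proof.
split => [i j ij x [l [lq Xl] Ax]|j x [l _]]; last exact: A_suba.
by exists l => //; split => //; rewrite (le_trans Xl)// T_ni.
Qed.

Let nested_T n : nested a (fun j => oint (T n j)%:E).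
Proof.
apply: nested_oint => [i j|j]; first exact: T_ni.
by rewrite (le_trans _ (ltW (ya_oint n).2))// lee_fin tau_le.
Qed.

Let Z n j := W (T n j).

Let Z_ge0 n j : (0 <= Z n j)%R.
Proof. exact: (prim_ge0 w_gt0 w_decr W_fin (T_dom n j)). Qed.

Let Z_ni n i j : (i <= j)%N -> (Z n j <= Z n i)%R.
Proof. by move=> ij; apply: (prim_le w_gt0 w_decr W_fin) => //; exact: T_ni. Qed.

Let Z_le n j : (Z n j <= W (ya n))%R.
Proof.
have yd : odom a (ya n) by right.
by apply: (prim_le w_gt0 w_decr W_fin) => //; exact: tau_le.
Qed.

Let Wya n : oint b (W (ya n)).
Proof. exact: (prim_oint a_gt0 w_gt0 w_decr W_fin b_def). Qed.

Let nested_Z n : nested b (fun j => oint (Z n j)%:E).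
Proof.
apply: nested_oint => [i j|j]; first exact: Z_ni.
by rewrite (le_trans _ (ltW (Wya n).2))// lee_fin.
Qed.

Let T_top n j : is_top a (fun x => F n x - 2 ^- n * j.+1%:R * W x)%R (T n j).
Proof. by have [_] := tauP n (grid_gt0 n j); rewrite /T [(j.+1%:R * _)%R]mulrC. Qed.

Let L_gt0 n : (0 < L n)%N.
Proof. by rewrite muln_gt0 N_gt0 expn_gt0. Qed.

Let T_last n : T n (L n).-1 = 0%R.
Proof.
rewrite /T prednK//; have -> : ((L n)%:R * 2 ^- n = (N n)%:R :> R)%R.
  by rewrite natrM natrX mulfK// expf_neq0.
exact: tau_N.
Qed.

Let mw_T n j : mw (oint (T n j)%:E) = m (oint (Z n j)%:E).
Proof. by rewrite lebesgue_oint ?lee_fin// /Z (primE w_gt0 W_fin). Qed.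

(* The dual function [sum eta_j 1_(0, Z j)] of norm at most 1 is pulled back
   first to the decreasing function [sum eta_j 1_(0, T j)] on (0, a) and then to
   a function equimeasurable with it and arranged along the level sets of f. *)
Let dual_step n (eta : nat -> R) : (forall j, 0 <= eta j)%R ->
  (forall g, carrier E g -> \sum_(j < L n) (eta j)%:E *
     \int[m]_(t in oint (Z n j)%:E) `|g t|%:E <= (fnorm E g)%:E) ->
  (\sum_(j < L n) eta j * F n (T n j) <= K)%R.
Proof.
move=> e0 etaP.
pose etaf := steps (L n) eta (fun j => oint (Z n j)%:E).
pose k := steps (L n) eta (fun j => oint (T n j)%:E).
pose h := steps (L n) eta (fun j => B n (T n j)).
have metaf : L0 b etaf by apply: steps_measurable.
have mk : L0 a k by apply: steps_measurable.
have mh : L0 a h by apply: steps_measurable.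
have metan (g : R -> R) : carrier E g ->
    \int[m]_(x in oint b) `|etaf x * g x|%:E =
    \sum_(j < L n) (eta j)%:E * \int[m]_(t in oint (Z n j)%:E) `|g t|%:E.
  move=> Eg; have mg := bfs_L0 E_bfs Eg.
  transitivity (\int[m]_(x in oint b) (`|g x| * etaf x)%:E).
    apply: eq_integral => x _; rewrite normrM mulrC.
    by rewrite [X in (_ * X)%R]ger0_norm// steps_ge0.
  rewrite (@integral_steps _ _ (fun x => `|g x|%R) (L n) eta (fun j => oint (Z n j)%:E))//.
  - apply: eq_bigr => j _; rewrite ointIl//.
    by rewrite (le_trans _ (ltW (Wya n).2))// lee_fin.
  - exact: measurableT_comp.
  - by move=> j _; exact: measurableI.
have [Deta eta1] : carrier (kothe_dual b E) etaf /\
    (fnorm (kothe_dual b E) etaf <= 1)%R.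
  apply: (kothe_mem b0 (E_indic E_fs E_supp)) => // g Eg g1.
  by rewrite metan// (le_trans (etaP g Eg))// lee_fin.
have [Lh hn] : carrier (Lambda a b w (kothe_dual b E)) h /\
    fnorm (Lambda a b w (kothe_dual b E)) h = fnorm (kothe_dual b E) etaf.
  apply: (@Lambda_transfer R a b w w_gt0 w_decr _ k etaf) => //.
  - exact: (kothe_ae_invariant (bfs_L0 E_bfs)).
  - by move=> y _; exact: steps_ge0.
  - by move=> x y [x0 _] _ xy; exact: steps_oint_ni.
  - by move=> y _; exact: steps_ge0.
  - by move=> x y [x0 _] _ xy; exact: steps_oint_ni.
  - move=> s s0; apply: eq_dist_steps => //; first exact: ltW.
    by rewrite weighted_set0 measure0.
  - move=> s s0; apply: eq_dist_steps => //; first exact: ltW.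
    by move=> j _; rewrite m_B lebesgue_oint// lee_fin.
have := fK Lh; rewrite hn => /(_ eta1); rewrite -lee_fin; apply: le_trans.
have -> : \int[m]_(x in oint a) `|f x * h x|%:E =
    \sum_(j < L n) (eta j)%:E * \int[m]_(x in B n (T n j)) `|f x|%:E.
  transitivity (\int[m]_(x in oint a) (`|f x| * h x)%:E).
    by apply: eq_integral => x _; rewrite normrM [X in (_ * X)%R]ger0_norm// steps_ge0.
  rewrite (@integral_steps _ _ (fun x => `|f x|%R) (L n) eta (fun j => B n (T n j)))//.
  - by apply: eq_bigr => j _; rewrite setIidr//; exact: (nested_B n).2.
  - exact: measurableT_comp.
  - by move=> j _; exact: measurableI.
rewrite -sumEFin; apply: lee_sum => j _.
by rewrite EFinM lee_wpmul2l ?lee_fin// F_le_B.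
Qed.

Let phi n := dsteps (N n) n (fun s => W (tau n s)).

Let phi_in n : carrier E (phi n).
Proof.
exact: (@steps_in R b E E_fs E_supp (2 ^- n)%R (L n) (Z n) (W (ya n)) (Wya n)
  (Z_ge0 n) (Z_le n)).
Qed.

(** As W increases, the primitive of [phi n] at Z_j is 2^-n times the sum of W(min(T_i, T_j)), which
    [tops_touch] bounds by F(T_j). Hence the norming functional can be tested on [f] through
    [dual_step]. *)
Let phi_norm n : (fnorm E (phi n) <= K)%R.
Proof.
have [eta [e0 etaP etan]] := @norming_functional R b E E_fs E_supp (2 ^- n)%R (L n)
  (Z n) (W (ya n)) (pow_gt0 n) (Wya n) (Z_ge0 n) (Z_le n) (@Z_ni n).
apply: (le_trans etan); apply: le_trans (dual_step e0 etaP).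
apply: ler_sum => j _; rewrite ler_wpM2l//.
have := @tops_touch R a (F n) W (2 ^- n)%R (L n) (T n) (pow_gt0 n) (F0 n) (prim0 w)
  (fun j _ => T_top n j) (L_gt0 n) (@T_ni n) j (ltn_ord j).
apply: le_trans; rewrite /steps_int ler_pM2l//; apply: ler_sum => i _.
rewrite /Z minC le_eqVlt; apply/orP; left; apply/eqP.
have mono x y : odom a x -> odom a y -> Num.min (W x) (W y) = W (Num.min x y).
  move=> ax ay; have [xy|yx] := leP x y; first by rewrite min_l// (prim_le w_gt0 w_decr W_fin).
  by rewrite min_r// (prim_le w_gt0 w_decr W_fin)// ltW.
by rewrite mono.
Qed.

Let phi_ge0 n y : (0 <= phi n y)%R.
Proof. exact: dsteps_ge0. Qed.

Let W_tau_le n s t : (0 < s)%R -> (s <= t)%R -> (W (tau n t) <= W (tau n s))%R.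
Proof.
move=> s0 st; apply: (prim_le w_gt0 w_decr W_fin); last exact: tau_ni.
  by apply: tau_dom; exact: lt_le_trans st.
exact: tau_dom.
Qed.

Let phi_nd n y : (0 < y)%R -> (phi n y <= phi n.+1 y)%R.
Proof.
move=> y0; apply: dsteps_nd => //; last exact: W_tau_le.
move=> s s0; apply: (prim_le w_gt0 w_decr W_fin); [exact: tau_dom|exact: tau_dom|].
exact: tau_nd.
Qed.

Let phi_ni n x y : (0 < x)%R -> (x <= y)%R -> (phi n y <= phi n x)%R.
Proof. by move=> x0 xy; apply: steps_oint_ni => // j; exact: ltW. Qed.

(** On (0, y) the decreasing [phi n] is at least phi n(y), so its norm controls this value. The
    bound is uniform in [n] and makes the supremum [level_density] finite. *)
Let phi_bound n y : oint b y -> (phi n y <= K / fnorm E \1_(oint y%:E))%R.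
Proof.
move=> yb; have n0 := fnorm_indic_gt0 E_fs E_supp yb.
have Ey := indic_oint_in E_supp yb.
rewrite ler_pdivlMr//; apply: le_trans (phi_norm n).
have := bfs_normZ E_bfs (phi n y) Ey; rewrite ger0_norm// => <-.
apply: (bfs_norm_mono E_bfs) => //; first exact: (bfs_Z E_bfs).
apply: ae_all => x [x0 _]; rewrite indicE; have [xy|_] := boolP (x \in oint y%:E).
  rewrite mulr1 !ger0_norm//; apply: phi_ni => //.
  by move: xy; rewrite inE => -[_]; rewrite lte_fin => /ltW.
by rewrite mulr0 normr0.
Qed.

Definition level_density (y : R) : R := sup (range (fun n => phi n y)).

Local Notation Phi := level_density.

Let phi_cvg y : oint b y -> phi n y @[n --> \oo] --> Phi y.
Proof.
move=> yb; apply: nondecreasing_cvgn.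
  by apply/nondecreasing_seqP => n; apply: phi_nd; case: yb.
by exists (K / fnorm E \1_(oint y%:E))%R => _ [n _ <-]; exact: phi_bound.
Qed.

Let phi_le n y : oint b y -> (phi n y <= Phi y)%R.
Proof.
move=> yb; apply: ub_le_sup; last by exists n.
by exists (K / fnorm E \1_(oint y%:E))%R => _ [i _ <-]; exact: phi_bound.
Qed.

Let Phi_le y r : oint b y -> (forall n, phi n y <= r)%R -> (Phi y <= r)%R.
Proof.
move=> yb H; apply: ge_sup; first by exists (phi 0 y); exists 0%N.
by move=> _ [n _ <-].
Qed.

Let Phi_ge0 y : oint b y -> (0 <= Phi y)%R.
Proof. by move=> yb; apply: le_trans (phi_le 0 yb). Qed.

Let Phi_ni x y : oint b x -> oint b y -> (x <= y)%R -> (Phi y <= Phi x)%R.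
Proof.
move=> bx yb xy; apply: Phi_le => // n; apply: le_trans (phi_le n bx).
by apply: phi_ni => //; case: bx.
Qed.

Let mPhi : L0 b Phi.
Proof. exact: noninc_measurable. Qed.

Let Phi_in : carrier E Phi /\ (fnorm E Phi <= K)%R.
Proof.
have [_ fat] := E_fatou.
have [] := fat phi Phi phi_in mPhi.
- apply: ae_all => y yb; split => //; last exact: phi_cvg.
  by apply/nondecreasing_seqP => n; apply: phi_nd; case: yb.
- by exists K.
move=> EPhi _ cv; split => //.
have := cvg_lim _ cv; move=> /(_ (@Rhausdorff R)) <-.
apply: limr_le; first by apply/cvg_ex; eexists; exact: cv.
exact: nearW.
Qed.

Let kn n := dsteps (N n) n (tau n).

(** W is strictly increasing, so x < tau exactly when W(x) < W(tau). *)
Let knE n x : oint a x -> kn n x = phi n (W x).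
Proof.
move=> ax; have Wx := prim_oint a_gt0 w_gt0 w_decr W_fin b_def ax.
rewrite /kn /phi !dstepsE; [|exact: Wx.1|exact: ax.1].
rewrite /dyadic; congr *%R; apply: eq_bigr => j _; congr ((_ : bool)%:R)%R.
have odx : odom a x by right.
have odt : odom a (tau n (grid n j)) := T_dom n j.
apply/idP/idP => [xt|]; first exact: (prim_lt w_gt0 w_decr W_fin).
rewrite !ltNge; apply: contra => tx.
exact: (prim_le w_gt0 w_decr W_fin).
Qed.

Let k x := Phi (W x).

Let kn_le n x : oint a x -> (kn n x <= k x)%R.
Proof.
move=> ax; rewrite knE//; apply: phi_le.
exact: (prim_oint a_gt0 w_gt0 w_decr W_fin b_def).
Qed.

Let k_ni x y : oint a x -> oint a y -> (x <= y)%R -> (k y <= k x)%R.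
Proof.
move=> ax ay xy; apply: Phi_ni.
- exact: (prim_oint a_gt0 w_gt0 w_decr W_fin b_def).
- exact: (prim_oint a_gt0 w_gt0 w_decr W_fin b_def).
- by apply: (prim_le w_gt0 w_decr W_fin) => //; right.
Qed.

Let k_ge0 x : oint a x -> (0 <= k x)%R.
Proof.
by move=> ax; apply/Phi_ge0/(prim_oint a_gt0 w_gt0 w_decr W_fin b_def).
Qed.

Let mk : L0 a k.
Proof. exact: noninc_measurable. Qed.

Let dist_sup (mu : set R -> \bar R) c (g_ : nat -> R -> R) (g : R -> R) s t :
  measure_on c mu -> (forall n, L0 c (g_ n)) ->
  (forall n x, oint c x -> 0 <= g_ n x)%R ->
  (forall n x, oint c x -> g_ n x <= g_ n.+1 x)%R ->
  (forall x r, oint c x -> (forall n, g_ n x <= r) -> g x <= r)%R ->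
  (forall n x, oint c x -> g_ n x <= g x)%R ->
  (forall n, dist mu c (g_ n) s <= t) -> dist mu c g s <= t.
Proof.
move=> [_ mono cont] mg g0 gnd gsup gle le.
have -> : dist mu c g s = mu (\bigcup_n superlevel c (g_ n) s).
  congr mu; apply/seteqP; split => x.
    move=> [cx /=]; rewrite ger0_norm ?(le_trans (g0 0%N _ cx)) ?gle// => sg.
    apply: contrapT => H; move: sg; rewrite ltNge => /negP; apply.
    apply: gsup => // n; rewrite leNgt; apply/negP => sn; apply: H.
    by exists n => //; split => //=; rewrite ger0_norm// g0.
  move=> [n _ [cx /=]]; rewrite ger0_norm ?g0// => sn; split => //=.
  by rewrite ger0_norm ?(lt_le_trans sn) ?gle// (le_trans (g0 n _ cx)) ?gle.
apply: cont => //.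
- by move=> n; exact: superlevel_measurable.
- by move=> n x [].
- apply/nondecreasing_seqP => n; rewrite subsetEset => x [cx /=].
  rewrite ger0_norm ?g0// => sn; split => //=; rewrite ger0_norm ?g0//.
  by rewrite (lt_le_trans sn) ?gnd.
Qed.

Let mphi n : L0 b (phi n).
Proof. exact: (bfs_L0 E_bfs (phi_in n)). Qed.

Let mkn n : L0 a (kn n).
Proof. by apply: steps_measurable. Qed.

Let le_dist (mu : set R -> \bar R) c (g h : R -> R) s : measure_on c mu ->
  L0 c g -> L0 c h -> (forall x, oint c x -> 0 <= g x <= h x)%R ->
  dist mu c g s <= dist mu c h s.
Proof.
move=> [_ mono _] mg mh gh; apply: mono.
- exact: (superlevel_measurable s mg).
- exact: (superlevel_measurable s mh).
- move=> x [cx /= sg]; split => //=; have /andP[g0 gx] := gh x cx.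
  move: sg; rewrite !ger0_norm// ?(le_trans g0)// => sg; exact: lt_le_trans gx.
- by move=> x [].
Qed.

Let dist_kn n s : (0 <= s)%R -> dist mw a (kn n) s = dist m b (phi n) s.
Proof.
move=> s0; apply: (@eq_dist_steps R mw m a b (L n) (fun=> 2 ^- n)%R
    (fun j => oint (T n j)%:E) (fun j => oint (Z n j)%:E)) => //.
by rewrite weighted_set0 measure0.
Qed.

(** Equality holds for the step approximations, whose intervals correspond under W; each inequality
    passes to the supremum by continuity from below. *)
Let dist_k s : (0 < s)%R -> dist mw a k s = dist m b Phi s.
Proof.
move=> /ltW s0; have hmw := density_measure_on wd; have hm := measure_on_lebesgue b.
apply/eqP; rewrite eq_le; apply/andP; split.
  apply: (@dist_sup mw a kn k) => //.
  - by move=> n x _; exact: dsteps_ge0.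
  - move=> n x ax; rewrite !knE//; apply: phi_nd.
    exact: (prim_oint a_gt0 w_gt0 w_decr W_fin b_def ax).1.
  - move=> x r ax H; apply: Phi_le.
      exact: (prim_oint a_gt0 w_gt0 w_decr W_fin b_def).
    by move=> n; rewrite -knE.
  - move=> n; rewrite dist_kn//; apply: le_dist => // y yb.
    by rewrite phi_ge0 phi_le.
apply: (@dist_sup m b phi Phi) => //.
- by move=> n x [x0 _]; exact: phi_nd.
- move=> n; rewrite -dist_kn//; apply: le_dist => // x ax.
  by rewrite dsteps_ge0 kn_le.
Qed.

Definition level_fun (x : R) : R := (w x * k x)%R.

Lemma level_fun_Mspace : [/\ carrier (Mspace a b w E) level_fun,
  (fnorm (Mspace a b w E) level_fun <= K)%R &
  {ae m, forall x, oint a x -> rearr m a level_fun x = (level_fun x)%:E}].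
Proof.
have [EPhi PhiK] := Phi_in.
have [M1 M2 M3] := @M_transfer R a b w w_gt0 w_decr E k Phi
  (bfs_ae_invariant E_bfs) EPhi mPhi Phi_ge0 Phi_ni mk k_ge0 k_ni dist_k.
by split => //; rewrite M2.
Qed.

Let x_lt_measure x s : oint a x -> x%:E < dist m a f s ->
  exists n0, forall n, (n0 <= n)%N -> (x < X n s)%R.
Proof.
move=> ax xs; apply: contrapT => H.
have Xx n : (X n s <= x)%R.
  rewrite leNgt; apply/negP => xX; apply: H; exists n => l nl.
  apply: lt_le_trans xX _.
  have Xnd : {homo (fun n => X n s) : i j / (i <= j)%N >-> (i <= j)%R}.
    by apply/nondecreasing_seqP => i; exact: X_nd.
  exact: Xnd.
have [_ _ cont] := measure_on_lebesgue a; have mAn n := mA n s.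
have : m (\bigcup_n A n s) <= x%:E.
  apply: (cont (fun n => A n s)).
  - by [].
  - by move=> n; exact: A_suba.
  - apply/nondecreasing_seqP => n; rewrite subsetEset => y [ys yn]; split => //.
    by apply: oint_sub yn; rewrite lee_fin oexh_nd.
  - by move=> n; rewrite -XE lee_fin.
have -> : \bigcup_n A n s = superlevel a f s.
  apply/seteqP; split => y; first by move=> [n _ []].
  move=> ys; have [n yn] := oexh_lt ys.1; exists n => //; split => //.
  by split; [exact: ys.1.1|rewrite lte_fin].
by rewrite leNgt xs.
Qed.

(** For s >= 0, x < X n s holds for all large n exactly when s lies below the rearrangement at x, so
    in the limit the dyadic sums count the right levels. *)
Let rearr_cvg x : oint a x ->
  (dsteps n n (X n) x)%:E @[n --> \oo] --> rearr m a f x.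
Proof.
move=> ax; have hm := measure_on_lebesgue a; have x0 := ax.1.
apply: ereal_cvg_of_approx.
- by move=> n; apply: dsteps_nd => // s t _; exact: X_ni.
- move=> n; rewrite dstepsE//; case E1 : (rearr m a f x) => [r||]; last 2 first.
  + by rewrite leey.
  + by have := rearr_ge0 m a f x; rewrite E1.
  have r0 : (0 <= r)%R by rewrite -lee_fin -E1 rearr_ge0.
  rewrite lee_fin; apply: dyadic_nat_le => // t rt; apply/negbTE; rewrite -leNgt.
  rewrite -lee_fin XE; apply: (@le_trans _ _ (dist m a f t)).
    apply: le_measure; rewrite ?inE; [exact: mA|exact: superlevel_measurable|].
    by move=> y [].
  rewrite leNgt -rearr_gt//; last by rewrite (le_trans r0) ?ltW.
  by rewrite E1 lte_fin -leNgt ltW.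
- move=> r rf; have [r0|r0] := leP r 0%R.
    by exists 0%N; apply: le_trans r0 _; exact: dsteps_ge0.
  have [s [rs sf]] : exists s, (r < s)%R /\ s%:E < rearr m a f x.
    case: (rearr m a f x) rf => [t||//]; rewrite ?lte_fin => rt.
      by exists ((r + t) / 2)%R; rewrite lte_fin !midf_lt.
    by exists (r + 1)%R; rewrite ltrDl ltry.
  have s0 : (0 <= s)%R by rewrite ltW// (lt_trans r0).
  have [n1 n1P] : exists n0, forall n, (n0 <= n)%N -> (x < X n s)%R.
    by apply: x_lt_measure => //; rewrite -rearr_gt.
  have [n0 n0P] := @expr2V_small R (s - r)%R ltac:(by rewrite subr_gt0).
  pose n := maxn (maxn n0 n1) (Num.truncn s).+1.
  have sn : (s <= n%:R)%R.
    by rewrite (le_trans (ltW (truncnS_gt _)))// ler_nat leq_maxr.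
  exists n; rewrite dstepsE//.
  have H := @dyadic_nat_ge R n n (fun u => x < X n u)%R s s0 sn.
  apply: le_trans (H _).
    have := n0P n; rewrite /n !leq_max leqnn/= => /(_ isT); lra.
  move=> t t0 ts; apply: (@lt_le_trans _ _ (X n s)); last exact: X_ni.
  by apply: n1P; rewrite /n !leq_max leqnn orbT.
Qed.

(** [tops_majorize] bounds F n x by the integral of w kn, hence of w k, plus the error 2^-n W(x),
    while F n x tends to the integral of the rearrangement of [f]. *)
Lemma level_fun_submaj : submaj a f level_fun.
Proof.
move=> x ax; have xa := ltW ax.2; have [_ _ aeE] := level_fun_Mspace.
have odx : odom a x by right.
have subx : oint x%:E `<=` oint a by exact: oint_sub.
have mwx : measurable_fun (oint x%:E) w.
  exact: (measurable_funS (oint_measurable a) subx (weight_measurable w_decr)).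
have mkx : measurable_fun (oint x%:E) k.
  exact: (measurable_funS (oint_measurable a) subx mk).
have lfg0 t : oint x%:E t -> (0 <= level_fun t)%R.
  by move=> /subx at_; rewrite mulr_ge0 ?k_ge0// ltW// w_gt0.
have -> : \int[m]_(t in oint x%:E) rearr m a level_fun t =
    \int[m]_(t in oint x%:E) (level_fun t)%:E.
  apply: ge0_ae_eq_integral => //.
  - apply: (rearr_measurable (measure_on_lebesgue a)).
    by apply: measurable_funM => //; exact: weight_measurable.
  - by apply/measurable_EFinP; exact: measurable_funM.
  - by move=> t _; exact: rearr_ge0.
  - by apply: ae_imp aeE => t H xt; apply: H; exact: subx.
have FE n : \int[m]_(t in oint x%:E) (dsteps n n (X n) t)%:E = (F n x)%:E.
  by rewrite -integral_steps_oint ?(ltW ax.1) ?ltW.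
have cv : \int[m]_(t in oint x%:E) (dsteps n n (X n) t)%:E @[n --> \oo] -->
    \int[m]_(t in oint x%:E) rearr m a f t.
  rewrite (_ : \int[m]_(t in oint x%:E) rearr m a f t =
      \int[m]_(t in oint x%:E) limn (fun n => (dsteps n n (X n) t)%:E)); last first.
    apply: eq_integral => t; rewrite inE => /subx at_.
    by apply/esym/cvg_lim => //; exact: rearr_cvg.
  apply: cvg_monotone_convergence => //.
  - by move=> n; apply/measurable_EFinP; apply: steps_measurable.
  - by move=> n t _; rewrite lee_fin dsteps_ge0.
  - move=> t [t0 _]; apply/nondecreasing_seqP => n; rewrite lee_fin.
    by apply: dsteps_nd => // s u _; exact: X_ni.
have le n : (F n x)%:E <=
    \int[m]_(t in oint x%:E) (level_fun t)%:E + (2 ^- n * W x)%:E.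
  have := @tops_majorize R a (F n) W (2 ^- n)%R (L n) (T n) (pow_gt0 n) (F0 n)
    (prim0 w) (prim_le w_gt0 w_decr W_fin) (fun j _ => T_top n j) (T_last n)
    (L_gt0 n) x odx.
  rewrite lerBlDr -lee_fin => /le_trans; apply; rewrite EFinD leeD2r//.
  apply: (@le_trans _ _ (\int[m]_(t in oint x%:E) (w t * kn n t)%:E)).
    rewrite (@integral_steps _ _ w (L n) (fun=> 2 ^- n)%R (fun j => oint (T n j)%:E))//.
    - rewrite mulr_sumr -sumEFin; apply: lee_sum => j _.
      rewrite EFinM lee_wpmul2l ?lee_fin ?(ltW (pow_gt0 n))// ointI.
      rewrite (primE w_gt0 W_fin) ?EFin_min//.
      by rewrite /Num.min; case: ifP => // _; exact: T_dom.
    - by move=> t /subx /w_gt0 /ltW.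
    - by move=> j _; exact: measurableI.
  apply: ge0_le_integral => //.
  - by move=> t /subx at_; rewrite lee_fin mulr_ge0 ?dsteps_ge0// ltW// w_gt0.
  - apply/measurable_EFinP; apply: measurable_funM => //.
    exact: (measurable_funS (oint_measurable a) subx (mkn n)).
  - by apply/measurable_EFinP; exact: measurable_funM.
  - move=> t /subx at_; rewrite lee_fin ler_wpM2l ?kn_le//.
    exact/ltW/w_gt0.
apply/lee_addgt0Pr => e e0; apply: cvge_to_le cv _.
have W1 : (0 < W x + 1)%R.
  by rewrite ltr_wpDl//; exact: (prim_ge0 w_gt0 w_decr W_fin odx).
have [n0 n0P] := @expr2V_small R (e / (W x + 1))%R ltac:(by rewrite divr_gt0).
exists n0 => // n /= n0n; rewrite FE; apply: (le_trans (le n)); rewrite leeD2l// lee_fin.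
have := n0P n n0n; rewrite ltr_pdivlMr// mulrDr mulr1 => H.
by have := pow_gt0 n; lra.
Qed.

End level_function.

(** The gauges may differ outside the carrier, so the two records need not be equal; the Fatou
    property never looks there. *)
Lemma eq_fatou_property (R : realType) (c : \bar R) (F G : fspace R) :
  carrier F = carrier G -> (forall f, carrier F f -> fnorm F f = fnorm G f) ->
  fatou_property c F -> fatou_property c G.
Proof.
case: F G => S n [S' n'] /= <- {S'} nn' [bfs fat].
have nE f : S f -> n' f = n f by move=> /nn'.
split.
  have [L D0 DD DZ Dsol Dsup n0 n00 nD nZ nmono ncompl] := bfs; split => //=.
  - by move=> f Sf; rewrite nE//; exact: n0.
  - by move=> f Sf; rewrite nE//; exact: n00.
  - by move=> f g Sf Sg; rewrite !nE//; [exact: nD|exact: DD].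
  - by move=> k f Sf; rewrite !nE//; [exact: nZ|exact: DZ].
  - by move=> f g Sf Sg fg; rewrite !nE//; exact: nmono.
  - have DB (f g : R -> R) : S f -> S g -> S (fun x => f x - g x)%R.
      move=> Sf Sg; have := DD _ _ Sf (DZ (-1)%R _ Sg) => /=.
      by under eq_fun do rewrite mulN1r.
    move=> f_ Sf cau; have [|f Sf' cv] := ncompl f_ Sf.
      move=> e /cau[N NP]; exists N => p q Np Nq.
      by rewrite /= -nE; [exact: NP|exact: DB].
    exists f => //; rewrite (_ : (fun k => _) = (fun k => n (fun x => f_ k x - f x)%R))//.
    by apply/funext => k; rewrite nE//; exact: DB.
move=> f_ f Sf mf ff [C fC] /=.
have fE : (fun k => n' (f_ k)) = (fun k => n (f_ k)).
  by apply/funext => k; rewrite (nE _ (Sf k)).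
have [] := fat f_ f Sf mf ff; first by exists C => k; rewrite /= -(nE _ (Sf k)) fC.
by move=> /= Sf' nd cv; split => //; rewrite fE// nE.
Qed.

Lemma le_rearr (R : realType) (mu : set R -> \bar R) c (f g : R -> R) t :
  measure_on c mu -> L0 c f -> L0 c g ->
  (forall x, oint c x -> `|f x| <= `|g x|)%R ->
  rearr mu c f t <= rearr mu c g t.
Proof.
move=> [_ mono _] mf mg fg; apply: ereal_inf_le_tmp => _ [s [s0 ds] <-].
exists s => //; split => //; apply: le_trans ds; apply: mono.
- exact: (superlevel_measurable s mf).
- exact: (superlevel_measurable s mg).
- by move=> x [cx /= sf]; split => //=; exact: lt_le_trans (fg x cx).
- by move=> x [].
Qed.

(** * Identification of the Koethe dual of Lambda *)

Section koethe_dual_of_Lambda.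
Variables (R : realType) (a b : \bar R) (w : R -> R) (E : fspace R).
Local Notation m := (@lebesgue_measure R).
Hypothesis a_gt0 : 0 < a.
Hypothesis w_gt0 : forall x, oint a x -> (0 < w x)%R.
Hypothesis w_decr : forall x y, oint a x -> oint a y -> (x <= y)%R -> (w y <= w x)%R.
Hypothesis W_fin : forall t, oint a t -> \int[m]_(x in oint t%:E) (w x)%:E < +oo.
Hypothesis b_def : b = \int[m]_(x in oint a) (w x)%:E.
Hypothesis E_fs : fully_symmetric b E.
Hypothesis E_supp : has_support b E.
Hypothesis E_fatou : fatou_property b E.

Local Notation mw := (weighted w).
Local Notation W := (prim w).
Local Notation Lam := (Lambda a b w (kothe_dual b E)).
Local Notation D := (kothe_dual a Lam).
Local Notation Q := (Qspace a b w E).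
Local Notation M := (Mspace a b w E).
Let b0 : 0 < b := b_gt0 a_gt0 w_gt0 w_decr W_fin b_def.
Let wd : has_density a mw w := weight_density w_gt0 w_decr.
Let E_bfs : banach_function_space b E := fs_bfs E_fs.

Let W_oint x : oint a x -> oint b (W x) :=
  @prim_oint R a b w a_gt0 w_gt0 w_decr W_fin b_def x.

Let step (t x : R) : R -> R := steps 1 (fun=> t) (fun=> oint x%:E).

Let stepE t x : step t x = (fun y => t * \1_(oint x%:E) y)%R.
Proof. by apply/funext => y; rewrite /step /steps big_ord1. Qed.

Let step_L0 c t x : L0 c (step t x).
Proof. exact: steps_measurable. Qed.

Let step_ge0 t x y : (0 <= t)%R -> (0 <= step t x y)%R.
Proof. by move=> t0; exact: steps_ge0. Qed.

Let step_ni t x y z : (0 <= t)%R -> (0 < y)%R -> (y <= z)%R ->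
  (step t x z <= step t x y)%R.
Proof. by move=> t0 y0 yz; apply: (@steps_oint_ni R 1 (fun=> t) (fun=> x)). Qed.

Let dist_step t x s : oint a x -> (0 <= t)%R -> (0 < s)%R ->
  dist mw a (step t x) s = dist m b (step t (W x)) s.
Proof.
move=> ax t0 /ltW s0; have bW := W_oint ax.
apply: eq_dist_steps => //.
- by apply: (@nested_oint R a (fun=> x)) => // _; exact/ltW/ax.2.
- by apply: (@nested_oint R b (fun=> W x)) => // _; exact/ltW/bW.2.
- by rewrite weighted_set0 measure0.
- move=> _ _; rewrite lebesgue_oint ?lee_fin ?(ltW bW.1)//.
  by rewrite (primE w_gt0 W_fin)//; right.
Qed.

(** The norming functional for the single interval (0, z): its coefficient cannot vanish, since the
    indicator has positive norm. *)
Lemma dual_indic z : oint b z -> exists t : R, [/\ (0 < t)%R,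
  carrier (kothe_dual b E) (step t z) & (fnorm (kothe_dual b E) (step t z) <= 1)%R].
Proof.
move=> bz; have z0 := ltW bz.1.
have [eta [e0 etaP etan]] := @norming_functional R b E E_fs E_supp 1%R 1 (fun=> z) z
  ltr01 bz (fun=> z0) (fun=> lexx _) (fun _ _ _ => lexx _).
have n0 := fnorm_indic_gt0 E_fs E_supp bz.
have e1 : (0 < eta 0%N)%R.
  rewrite lt_def e0 andbT; apply/eqP => eta0; move: etan n0.
  rewrite big_ord1 eta0 mul0r -/(step 1 z) stepE.
  under eq_fun do rewrite mul1r.
  by rewrite leNgt => /negbTE ->.
suff [D1 D2] : carrier (kothe_dual b E) (step (eta 0%N) z) /\
    (fnorm (kothe_dual b E) (step (eta 0%N) z) <= 1)%R by exists (eta 0%N).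
apply: (kothe_mem b0 (E_indic E_fs E_supp)) => // g Eg g1.
have mg : measurable_fun (oint b) (fun x => `|g x|%R).
  by apply: measurableT_comp => //; exact: (bfs_L0 E_bfs Eg).
have -> : \int[m]_(x in oint b) `|step (eta 0%N) z x * g x|%:E =
    \sum_(j < 1) (eta 0%N)%:E * \int[m]_(t in oint z%:E) `|g t|%:E.
  transitivity (\int[m]_(x in oint b) (`|g x| * step (eta 0%N) z x)%:E).
    apply: eq_integral => x _; rewrite normrM mulrC.
    by rewrite [X in (_ * X)%R]ger0_norm// step_ge0.
  rewrite (@integral_steps _ _ (fun x => `|g x|%R) 1 (fun=> eta 0%N) (fun=> oint z%:E))//.
  - by apply: eq_bigr => j _; rewrite ointIl//; exact/ltW/bz.2.
  - by move=> j _; exact: measurableI.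
have := etaP g Eg; rewrite !big_ord1 => /le_trans; apply.
by rewrite lee_fin.
Qed.

Lemma Lambda_indic x : oint a x -> exists t : R, [/\ (0 < t)%R,
  carrier Lam (fun y => t * \1_(oint x%:E) y)%R &
  (fnorm Lam (fun y => t * \1_(oint x%:E) y) <= 1)%R].
Proof.
move=> ax; have [t [t0 D1 D2]] := dual_indic (W_oint ax).
exists t; rewrite -stepE.
have [L1 L2] := @Lambda_transfer R a b w w_gt0 w_decr (kothe_dual b E) (step t x)
  (step t (W x)) (kothe_ae_invariant (bfs_L0 E_bfs)) D1 (@step_L0 _ _ _)
  (fun y _ => step_ge0 _ _ (ltW t0))
  (fun y z by_ _ yz => step_ni _ (ltW t0) by_.1 yz) (@step_L0 _ _ _)
  (fun y _ => step_ge0 _ _ (ltW t0))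
  (fun y z ay _ yz => step_ni _ (ltW t0) ay.1 yz)
  (fun s s0 => dist_step ax (ltW t0) s0) (step t x) (@step_L0 _ _ _) (fun s _ => erefl).
by split => //; rewrite L2.
Qed.

(** On (0, x) the weight is at least w(x), so the indicator lies below w / w(x) cut off at x. That
    function is in M because its quotient by w is a multiple of the indicator. *)
Lemma Qspace_indic x : oint a x -> carrier Q \1_(oint x%:E).
Proof.
move=> ax; have wx := w_gt0 ax; have wi0 : (0 <= (w x)^-1)%R by rewrite invr_ge0 ltW.
have Ephi : carrier E (step (w x)^-1 (W x)).
  by rewrite stepE; apply: (bfs_Z E_bfs); exact: (indic_oint_in E_supp (W_oint ax)).
have [M1 _ _] := @M_transfer R a b w w_gt0 w_decr E (step (w x)^-1 x)
  (step (w x)^-1 (W x)) (bfs_ae_invariant E_bfs) Ephi (@step_L0 _ _ _)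
  (fun y _ => step_ge0 _ _ wi0)
  (fun y z by_ _ yz => step_ni _ wi0 by_.1 yz) (@step_L0 _ _ _)
  (fun y _ => step_ge0 _ _ wi0)
  (fun y z ay _ yz => step_ni _ wi0 ay.1 yz)
  (fun s s0 => dist_step ax wi0 s0).
have mi : L0 a (\1_(oint x%:E) : R -> R) by exact: measurable_indic.
split => //; exists (fun y => w y * step (w x)^-1 x y)%R => // y ay.
have hm := measure_on_lebesgue a.
apply: ge0_le_integral => //.
- by move=> t _; exact: rearr_ge0.
- exact: (rearr_measurable hm mi).
- exact: (rearr_measurable hm M1.1).
- move=> t _; apply: (le_rearr _ hm mi M1.1) => z az.
  rewrite stepE indicE; have [xz|_] := boolP (z \in oint x%:E); last by rewrite !mulr0.
  move: xz; rewrite inE => -[_]; rewrite lte_fin => zx.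
  rewrite mulr1 normr1 ger0_norm; last by rewrite mulr_ge0// ltW// w_gt0.
  by rewrite ler_pdivlMr// mul1r w_decr// ltW.
Qed.

(** The level function built with K equal to the dual norm of [f] attains the infimum; by
    [integral_prod_le_Mnorm] no competitor does better. *)
Lemma kothe_dual_Lambda f : L0 a f -> carrier D f ->
  carrier Q f /\ fnorm Q f = fnorm D f.
Proof.
move=> mf Df.
have fK h : carrier Lam h -> (fnorm Lam h <= 1)%R ->
    \int[m]_(x in oint a) `|f x * h x|%:E <= (fnorm D f)%:E.
  exact: (kothe_le a_gt0 Lambda_indic Df).
have [Mg gK _] := level_fun_Mspace a_gt0 w_gt0 w_decr W_fin b_def E_fs E_supp E_fatou mf fK.
have fg := level_fun_submaj a_gt0 w_gt0 w_decr W_fin b_def E_fs E_supp E_fatou mf fK.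
split; first by split => //; eexists; [exact: Mg|exact: fg].
have lb g : carrier M g -> submaj a f g -> (fnorm D f <= fnorm M g)%R.
  move=> M' fg'.
  apply: (@kothe_mem R a Lam a_gt0 Lambda_indic f (fnorm M g) mf _).2 => h Lh h1.
  exact: (integral_prod_le_Mnorm a_gt0 w_gt0 w_decr W_fin b_def E_fs E_supp mf M' fg' Lh h1).
apply/eqP; rewrite eq_le; apply/andP; split.
  apply: le_trans gK; apply: ge_inf; last by eexists; [split; [exact: Mg|exact: fg]|].
  by exists (fnorm D f) => _ [g [M' fg'] <-]; exact: lb.
apply: lb_le_inf; first by eexists; eexists; [split; [exact: Mg|exact: fg]|].
by move=> _ [g [M' fg'] <-]; exact: lb.
Qed.

Lemma Qspace_sub_kothe_dual f : carrier Q f -> carrier D f.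
Proof.
move=> [mf [g Mg fg]].
apply: (@kothe_mem R a Lam a_gt0 Lambda_indic f (fnorm M g) mf _).1 => h Lh h1.
exact: (integral_prod_le_Mnorm a_gt0 w_gt0 w_decr W_fin b_def E_fs E_supp mf Mg fg Lh h1).
Qed.

End koethe_dual_of_Lambda.

Unset Implicit Arguments.

Theorem proposition6p12 (R : realType) (a b : \bar R) (w : R -> R)
    (E : fspace R)
    (a_gt0 : 0 < a)
    (w_gt0 : forall x, oint a x -> (0 < w x)%R)
    (w_decr : forall x y, oint a x -> oint a y -> (x <= y)%R -> (w y <= w x)%R)
    (W_fin : forall t, oint a t ->
      \int[lebesgue_measure]_(x in oint t%:E) (w x)%:E < +oo)
    (b_def : b = \int[lebesgue_measure]_(x in oint a) (w x)%:E)
    (E_fs : fully_symmetric b E)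
    (E_supp : has_support b E)
    (E_fatou : fatou_property b E) :
  fatou_property a (Qspace a b w E) /\
  (let D := kothe_dual a (Lambda a b w (kothe_dual b E)) in
   carrier D = carrier (Qspace a b w E) /\
   (forall f, carrier D f -> fnorm D f = fnorm (Qspace a b w E) f)).
Proof.
have LL0 : carrier (Lambda a b w (kothe_dual b E)) `<=` L0 a by move=> h [].
have L_indic := Lambda_indic a_gt0 w_gt0 w_decr W_fin b_def E_fs E_supp.
have QD := Qspace_sub_kothe_dual a_gt0 w_gt0 w_decr W_fin b_def E_fs E_supp.
have DQ f (Df : carrier (kothe_dual a (Lambda a b w (kothe_dual b E))) f) :=
  kothe_dual_Lambda a_gt0 w_gt0 w_decr W_fin b_def E_fs E_supp E_fatou Df.1 Df.
have carrierE : carrier (kothe_dual a (Lambda a b w (kothe_dual b E))) =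
    carrier (Qspace a b w E).
  by apply/seteqP; split => f; [move=> /DQ[]|exact: QD].
have fnormE f : carrier (kothe_dual a (Lambda a b w (kothe_dual b E))) f ->
    fnorm (kothe_dual a (Lambda a b w (kothe_dual b E))) f =
    fnorm (Qspace a b w E) f by move=> /DQ[].
split; last by split.
apply: (eq_fatou_property carrierE fnormE).
(* The indicators that the dual must contain are found in Q, where an explicit majorant exists. *)
apply: kothe_fatou => // x ax; apply: QD.
exact: (Qspace_indic a_gt0 w_gt0 w_decr W_fin b_def E_fs E_supp ax).
Qed.
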